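(* Let $\sigma$ be a structure that is stably metrizable and Polish with preserved roots. Let $\tau_{\mathcal P}(\sigma)$ be the structure assigning to each bcm space $X$ the space $\mathcal{P}(\sigma(X))$ of Borel probability measures on $\sigma(X)$ with the weak topology, and to each isometric embedding $f\colon X\to Y$ the pushforward map $P\mapsto P\circ\sigma_f^{-1}$. Then $\tau_{\mathcal P}(\sigma)$ is stably metrizable and Polish with preserved roots.
   Context: A bcm (boundedly-compact metric) space is a non-empty metric space in which every closed ball of finite radius is compact; a rooted bcm space $(X,\rho_X)$ is a bcm space $X$ with a distinguished point $\rho_X$. The metric of $X$ is denoted $d_X$. An isometric embedding is a distance-preserving map (not necessarily onto); a map is root-preserving if it sends root to root. A topological embedding is a homeomorphism onto its image. Structure: a functor $\tau$ from the category of bcm spaces (morphisms: isometric embeddings) to the category of metrizable topological spaces (morphisms: topological embeddings). That is, to each bcm space $X$ it assigns a metrizable space $\tau(X)$ and to each isometric embedding $f\colon X\to Y$ a topological embedding $\tau_f\colon\tau(X)\to\tau(Y)$, with $\tau_{\mathrm{id}_X}=\mathrm{id}_{\tau(X)}$ and $\tau_{g\circ f}=\tau_g\circ\tau_f$. When $X$ is isometrically embedded into $Y$ by $f$, $\tau(X)$ is regarded as a subspace of $\tau(Y)$ via $\tau_f$. $\tau$ is continuous if all of the following hold. Embedding-continuity: if $f_n\colon X\to Y$, $n\in\mathbb{N}\cup\{\infty\}$, are isometric embeddings between bcm spaces with $f_n\to f_\infty$ uniformly on compact sets, then $\tau_{f_n}(a)\to\tau_{f_\infty}(a)$ for all $a\in\tau(X)$.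 Upper and lower semicontinuity: whenever bcm spaces $X_n$, $n\in\mathbb{N}\cup\{\infty\}$, are isometrically embedded into a common bcm space $Y$ so that $X_n\to X_\infty$ in the Fell topology as subsets of $Y$, (upper) if $a_n\in\tau(X_n)$ converge to some $a\in\tau(Y)$ then $a\in\tau(X_\infty)$; (lower) for every $a\in\tau(X_\infty)$ there are a subsequence $(n_k)$ and $a_k\in\tau(X_{n_k})$ with $a_k\to a$ in $\tau(Y)$. The Fell topology on closed subsets of $Y$ is generated by the sets $\{A: A\cap K=\emptyset\}$ ($K$ compact) and $\{A: A\cap U\ne\emptyset\}$ ($U$ open). Element-rooted metrization $\tau^{\mathrm{erm}}$: a choice, for each bcm space $X$, of a metric $d^{\tau^{\mathrm{erm}}}_{X}$ on $\tau(X)\times X$ inducing the product topology such that $\tau_f\times f$ is distance-preserving for every isometric embedding $f\colon X\to Y$. It is stable if there is $\Theta\colon[0,\infty)\to[0,\infty)$ with $\lim_{\varepsilon\to0}\Theta(\varepsilon)=\Theta(0)=0$ such that: for all bcm spaces $X,Y,M_1,M_2$, isometric embeddings $f_i\colon X\to M_i$, $g_i\colon Y\to M_i$ ($i=1,2$) and $\varepsilon\ge 0$ with $d_{M_2}(f_2(x),g_2(y))\le d_{M_1}(f_1(x),g_1(y))+\varepsilon$ for all $x\in X,y\in Y$, one has $$d^{\tau^{\mathrm{erm}}}_{M_2}\bigl((\tau_{f_2}(a),f_2(x)),(\tau_{g_2}(b),g_2(y))\bigr)\le d^{\tau^{\mathrm{erm}}}_{M_1}\bigl((\tau_{f_1}(a),f_1(x)),(\tau_{g_1}(b),g_1(y))\bigr)+\Theta(\varepsilon)$$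 for all $(a,x)\in\tau(X)\times X$, $(b,y)\in\tau(Y)\times Y$. $\tau$ is stably metrizable if it admits a stable element-rooted metrization. Space-rooted metrization: a choice, for each rooted bcm space $(X,\rho_X)$, of a metric on $\tau(X)$ inducing the given topology, such that $\tau_f$ is distance-preserving for every root-preserving isometric embedding $f\colon(X,\rho_X)\to(Y,\rho_Y)$ (with respect to the metrics assigned to $(X,\rho_X)$ and $(Y,\rho_Y)$). It is complete if all these metrics are complete. $\tau$ is Polish with preserved roots if there exist another structure $\tilde\tau$, a topological embedding $\eta\colon\tau\Rightarrow\tilde\tau$ (a family of topological embeddings $\eta_X\colon\tau(X)\to\tilde\tau(X)$ with $\eta_Y\circ\tau_f=\tilde\tau_f\circ\eta_X$ for every isometric embedding $f\colon X\to Y$), and a sequence $(\tilde\tau_k)_{k\ge1}$, where each $\tilde\tau_k$ assigns to every rooted bcm space $(X,\rho_X)$ a subset $\tilde\tau_k(X,\rho_X)\subseteq\tilde\tau(X)$ with $\tilde\tau_f(\tilde\tau_k(X,\rho_X))\subseteq\tilde\tau_k(Y,\rho_Y)$ for every root-preserving isometric embedding $f\colon(X,\rho_X)\to(Y,\rho_Y)$, such that: (P1) $\tilde\tau$ is continuous and admits a complete space-rooted metrization; (P2) each $\tilde\tau_k(X,\rho_X)$ is open in $\tilde\tau(X)$, and $\tilde\tau_k$ is pullback-stable: $\tilde\tau_f^{-1}(\tilde\tau_k(Y,\rho_Y))=\tilde\tau_k(X,\rho_X)$ for every root-preserving isometric embedding $f\colon(X,\rho_X)\to(Y,\rho_Y)$;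 (P3) $\eta_X(\tau(X))=\bigcap_{k\ge1}\tilde\tau_k(X,\rho_X)$ for every rooted bcm space $(X,\rho_X)$.
   Formalization: It is assumed that for each X either σ(X) is separable or P(σ(X)) is metrizable; this is presupposed by calling τ_P(σ) a structure, but can fail for non-separable σ(X) (e.g. discrete of real-valued measurable cardinality). *)

(* Defs.v *)
From HB Require Import structures.
From mathcomp Require Import all_boot all_order all_algebra.
From mathcomp Require Import all_classical all_reals all_analysis.
From mathcomp Require Import measurable_realfun.
Import Order.TTheory GRing.Theory Num.Theory.
Import numFieldNormedType.Exports.

Set Implicit Arguments.
Unset Strict Implicit.
Unset Printing Implicit Defensive.

Local Open Scope classical_set_scope.
Local Open Scope ring_scope.

Section metrics.
Variables (R : realType) (T : topologicalType).

Definition metrizes (d : T -> T -> R) : Prop :=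
  [/\ forall x, d x x = 0,
      forall x y, d x y = 0 -> x = y,
      forall x y, d x y = d y x,
      forall x y z, d x z <= d x y + d y z &
      forall x (A : set T),
        nbhs x A <-> exists2 e, 0 < e & [set y | d x y < e] `<=` A].

Definition metrizable : Prop := exists d, metrizes d.

Definition complete_metric (d : T -> T -> R) : Prop :=
  forall u : nat -> T,
    (forall e, 0 < e -> exists N, forall m n,
       (N <= m)%N -> (N <= n)%N -> d (u m) (u n) < e) ->
    exists l : T, u @ \oo --> l.

Definition separable : Prop := exists2 D : set T, countable D & dense D.

End metrics.

Definition topological_embedding (S T : topologicalType) (f : S -> T) : Prop :=
  [/\ injective f, continuous f &
      forall A, open A -> exists2 B, open B & f @` A = B `&` range f].

Record bcm (R : realType) := Bcm {
  bcm_space :> metricType R;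
  bcm_nonempty : [set: bcm_space] !=set0;
  bcm_compact : forall (x : bcm_space) (r : R),
    compact [set y | mdist x y <= r] }.

Section isometric_embeddings.
Variable R : realType.

Record isoemb (X Y : bcm R) := IsoEmb {
  isoemb_fun :> X -> Y;
  isoembP : forall x y, mdist (isoemb_fun x) (isoemb_fun y) = mdist x y }.

Definition isoemb_id (X : bcm R) : isoemb X X :=
  @IsoEmb X X id (fun _ _ => erefl).

Lemma isoemb_compP (X Y Z : bcm R) (g : isoemb Y Z) (f : isoemb X Y) x y :
  mdist ((g \o f) x) ((g \o f) y) = mdist x y.
Proof. by rewrite /= !isoembP. Qed.

Definition isoemb_comp (X Y Z : bcm R) (g : isoemb Y Z) (f : isoemb X Y) :
  isoemb X Z := IsoEmb (isoemb_compP g f).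

Lemma isoemb_continuous (X Y : bcm R) (f : isoemb X Y) : continuous f.
Proof.
move=> x A /nbhs_ballP[e e0 eA]; apply/nbhs_ballP; exists e => // y.
by rewrite ballEmdist/= => xy; apply: eA; rewrite ballEmdist/= isoembP.
Qed.

Lemma isoemb_range_closed (X Y : bcm R) (f : isoemb X Y) : closed (range f).
Proof.
move=> y clfy.
have [_ [[x _ <-] xy]] := clfy _ (nbhsx_ballx y 1 ltr01).
pose K := f @` [set x' | mdist x x' <= 2].
have cK : closed K.
  apply: compact_closed; first exact: metric_hausdorff.
  apply: continuous_compact; last exact: bcm_compact.
  exact: continuous_subspaceT (@isoemb_continuous _ _ f).
suff : K y by move=> [x' _ <-]; exists x'.
apply: cK => B yB.
have [_ [[x' _ <-] [Bx' x'y]]] :=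
  clfy _ (filterI yB (nbhsx_ballx y 1 ltr01)).
exists (f x'); split => //; exists x' => //=.
rewrite -(isoembP f) (le_trans (metric_triangle _ y _))//.
move: xy x'y; rewrite !ballEmdist/= => xy x'y.
by rewrite metric_sym -[2]/(1 + 1) lerD// ltW.
Qed.

End isometric_embeddings.

Record closed_set (Y : topologicalType) := ClosedSet {
  cset :> set Y;
  csetP : closed cset }.

HB.instance Definition _ (Y : topologicalType) := gen_eqMixin (closed_set Y).
HB.instance Definition _ (Y : topologicalType) := gen_choiceMixin (closed_set Y).

Definition fell_subbase (Y : topologicalType) : set (set (closed_set Y)) :=
  [set [set A : closed_set Y | A `&` K = set0] | K in @compact Y] `|`
  [set [set A : closed_set Y | A `&` U !=set0] | U in @open Y].

HB.instance Definition _ (Y : topologicalType) :=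
  @isSubBaseTopological.Build (closed_set Y)
    (set (closed_set Y)) (@fell_subbase Y) id.

Definition isoemb_range (R : realType) (X Y : bcm R) (f : isoemb X Y) :
  closed_set Y := ClosedSet (@isoemb_range_closed R X Y f).

(* A functor from bcm spaces to all topological spaces; the structures are those
   satisfying [is_structure]. *)
Record bcm_functor (R : realType) := BcmFunctor {
  fobj :> bcm R -> topologicalType;
  fmor : forall X Y : bcm R, isoemb X Y -> fobj X -> fobj Y;
  fmor_continuous : forall (X Y : bcm R) (f : isoemb X Y), continuous (fmor f);
  fmor_id : forall (X : bcm R) (a : fobj X), fmor (isoemb_id X) a = a;
  fmor_comp : forall (X Y Z : bcm R) (g : isoemb Y Z) (f : isoemb X Y)
    (a : fobj X), fmor (isoemb_comp g f) a = fmor g (fmor f a) }.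

Arguments fmor {R} _ {X Y} f a.

Section structures.
Variable R : realType.
Implicit Types tau : bcm_functor R.

Definition is_structure tau : Prop :=
  (forall X, metrizable R (tau X)) /\
  (forall X Y (f : isoemb X Y), topological_embedding (fmor tau f)).

Definition embedding_continuous tau : Prop :=
  forall (X Y : bcm R) (f_ : nat -> isoemb X Y) (f : isoemb X Y),
    {family compact, (fun n => f_ n : X -> Y) @ \oo --> (f : X -> Y)} ->
    forall a : tau X, fmor tau (f_ n) a @[n --> \oo] --> fmor tau f a.

Definition upper_semicontinuous tau : Prop :=
  forall (Y : bcm R) (X_ : nat -> bcm R) (X : bcm R)
    (e_ : forall n, isoemb (X_ n) Y) (e : isoemb X Y),
    isoemb_range (e_ n) @[n --> \oo] --> isoemb_range e ->
    forall (a_ : forall n, tau (X_ n)) (a : tau Y),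
      fmor tau (e_ n) (a_ n) @[n --> \oo] --> a -> range (fmor tau e) a.

Definition lower_semicontinuous tau : Prop :=
  forall (Y : bcm R) (X_ : nat -> bcm R) (X : bcm R)
    (e_ : forall n, isoemb (X_ n) Y) (e : isoemb X Y),
    isoemb_range (e_ n) @[n --> \oo] --> isoemb_range e ->
    forall a : tau X, exists k : nat -> nat,
      {homo k : m n / (m < n)%N} /\
      exists b : forall j, tau (X_ (k j)),
        fmor tau (e_ (k j)) (b j) @[j --> \oo] --> fmor tau e a.

Definition continuous_structure tau : Prop :=
  [/\ embedding_continuous tau, upper_semicontinuous tau &
      lower_semicontinuous tau].

Definition fmor_prod tau (X Y : bcm R) (f : isoemb X Y) (p : tau X * X) :
  tau Y * Y := (fmor tau f p.1, f p.2).

Definition element_rooted_metrization tau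
    (d : forall X : bcm R, tau X * X -> tau X * X -> R) : Prop :=
  (forall X : bcm R, metrizes (d X)) /\
  (forall (X Y : bcm R) (f : isoemb X Y) (p q : tau X * X),
     d Y (fmor_prod f p) (fmor_prod f q) = d X p q).

Definition stable_metrization tau
    (d : forall X : bcm R, tau X * X -> tau X * X -> R) : Prop :=
  exists Theta : R -> R,
    [/\ forall e, 0 <= e -> 0 <= Theta e,
        Theta 0 = 0,
        Theta e @[e --> 0^'+] --> (0 : R) &
        forall (X Y M1 M2 : bcm R)
          (f1 : isoemb X M1) (f2 : isoemb X M2)
          (g1 : isoemb Y M1) (g2 : isoemb Y M2) (e : R), 0 <= e ->
          (forall x y, mdist (f2 x) (g2 y) <= mdist (f1 x) (g1 y) + e) ->
          forall (p : tau X * X) (q : tau Y * Y),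
            d M2 (fmor_prod f2 p) (fmor_prod g2 q) <=
            d M1 (fmor_prod f1 p) (fmor_prod g1 q) + Theta e].

Definition stably_metrizable tau : Prop :=
  exists d : forall X : bcm R, tau X * X -> tau X * X -> R,
    element_rooted_metrization d /\ stable_metrization d.

(* A rooted bcm space is passed as a space followed by its root. *)
Definition space_rooted_metrization tau
    (d : forall X : bcm R, X -> tau X -> tau X -> R) : Prop :=
  (forall (X : bcm R) (rho : X), metrizes (d X rho)) /\
  (forall (X Y : bcm R) (rhoX : X) (rhoY : Y) (f : isoemb X Y),
     f rhoX = rhoY -> forall a b : tau X,
     d Y rhoY (fmor tau f a) (fmor tau f b) = d X rhoX a b).

Definition completely_space_rooted_metrizable tau : Prop :=
  exists d : forall X : bcm R, X -> tau X -> tau X -> R,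
    space_rooted_metrization d /\
    forall (X : bcm R) (rho : X), complete_metric (d X rho).

Definition embedding_of_structures (tau tau' : bcm_functor R)
    (eta : forall X : bcm R, tau X -> tau' X) : Prop :=
  (forall X, topological_embedding (eta X)) /\
  (forall (X Y : bcm R) (f : isoemb X Y) (a : tau X),
     eta Y (fmor tau f a) = fmor tau' f (eta X a)).

Definition polish_with_preserved_roots tau : Prop :=
  exists (tau' : bcm_functor R) (eta : forall X : bcm R, tau X -> tau' X)
    (tau_ : nat -> forall X : bcm R, X -> set (tau' X)),
  [/\ is_structure tau',
      embedding_of_structures eta,
      forall k (X Y : bcm R) (rhoX : X) (rhoY : Y) (f : isoemb X Y),
        f rhoX = rhoY ->
        fmor tau' f @` tau_ k X rhoX `<=` tau_ k Y rhoY &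
   [/\ continuous_structure tau' /\ completely_space_rooted_metrizable tau',
      (forall k (X : bcm R) (rho : X), open (tau_ k X rho)) /\
      (forall k (X Y : bcm R) (rhoX : X) (rhoY : Y) (f : isoemb X Y),
        f rhoX = rhoY ->
        fmor tau' f @^-1` tau_ k Y rhoY = tau_ k X rhoX) &
      forall (X : bcm R) (rho : X), range (eta X) = \bigcap_k tau_ k X rho]].

End structures.

Section borel.
Variable T : topologicalType.

(* Measurable types are pointed in the library, whereas the value of a structure
   may be empty; the base point is taken from a proof of nonemptiness and plays
   no role. *)
Definition pointed_space (h : [set: T] !=set0) : Type := T.

Variable h : [set: T] !=set0.

HB.instance Definition _ := Topological.on (pointed_space h).
HB.instance Definition _ := isPointed.Build (pointed_space h) (projT1 (cid h)).

Definition borel_space := g_sigma_algebraType (@open (pointed_space h)).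

HB.instance Definition _ := Measurable.on borel_space.

End borel.

(* A [probability] is a function on all sets, unconstrained (but for its sign)
   outside of the sigma-algebra; [bp_off] makes two elements equal exactly when
   they agree on the Borel sets. *)
Record borel_prob (R : realType) (T : topologicalType) := BorelProb {
  bp_nonempty : [set: T] !=set0;
  bp_measure :> probability (borel_space bp_nonempty) R;
  bp_off : forall A : set T, ~ <<s @open T >> A -> bp_measure A = 0%E }.

Record bounded_continuous (R : realType) (T : topologicalType) :=
  BoundedContinuous {
    bc_fun :> T -> R;
    bc_continuous : continuous bc_fun;
    bc_bounded : exists M, forall x, `|bc_fun x| <= M }.

HB.instance Definition _ R T := gen_eqMixin (bounded_continuous R T).
HB.instance Definition _ R T := gen_choiceMixin (bounded_continuous R T).
HB.instance Definition _ R T := gen_eqMixin (borel_prob R T).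
HB.instance Definition _ R T := gen_choiceMixin (borel_prob R T).

Definition bp_integral (R : realType) (T : topologicalType)
    (P : borel_prob R T) (f : bounded_continuous R T) : R :=
  \int[bp_measure P]_x f x.

(* [{ptws _ -> R}] carries the product topology, so this is the coarsest topology
   making every [P |-> \int f dP] continuous. *)
HB.instance Definition _ (R : realType) (T : topologicalType) :=
  Topological.copy (borel_prob R T)
    (initial_topology
      (@bp_integral R T : borel_prob R T -> {ptws bounded_continuous R T -> R})).

Section borel_prob_theory.
Variable R : realType.

Lemma borel_prob_eq (T : topologicalType) (P Q : borel_prob R T) :
  (forall A, <<s @open T >> A -> bp_measure P A = bp_measure Q A) -> P = Q.
Proof.
case: P Q => [h P Poff] [h' Q Qoff] /=.
move: Q Qoff; rewrite (Prop_irrelevance h' h) => Q Qoff PQ.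
have E : (P : set (borel_space h) -> \bar R) = Q.
  apply/funext => A; have [/PQ//|nA] := pselect (<<s @open T >> A).
  by rewrite Poff// Qoff.
have {}E : P = Q.
  clear -E; case: P Q E => [p [[p1 p2] [p3] [p4] [p5] [p6] [p7] [p8]]].
  case=> [q [[q1 q2] [q3] [q4] [q5] [q6] [q7] [q8]]] /= pq.
  move: q1 q2 q3 q4 q5 q6 q7 q8; rewrite -pq => q1 q2 q3 q4 q5 q6 q7 q8.
  rewrite (Prop_irrelevance q1 p1) (Prop_irrelevance q2 p2).
  rewrite (Prop_irrelevance q3 p3) (Prop_irrelevance q4 p4).
  rewrite (Prop_irrelevance q5 p5) (Prop_irrelevance q6 p6).
  by rewrite (Prop_irrelevance q7 p7) (Prop_irrelevance q8 p8).
by subst Q; rewrite (Prop_irrelevance Poff Qoff).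
Qed.

Lemma borel_preimage (S T : topologicalType) (f : S -> T) (A : set T) :
  continuous f -> <<s @open T >> A -> <<s @open S >> (f @^-1` A).
Proof.
move=> fc; apply: (@smallest_sub _ _ _ [set B | <<s @open S >> (f @^-1` B)]).
- split=> [|B /= SB|F SF] /=.
  + by rewrite preimage_set0; exact: sigma_algebra0.
  + by rewrite setTD preimage_setC -setTD; exact: sigma_algebraCD.
  + by rewrite preimage_bigcup; exact: sigma_algebra_bigcup.
- by move=> B oB; apply: sub_gen_smallest; move/continuousP: fc; apply.
Qed.

Section pushforward.
Variables (S T : topologicalType) (f : S -> T).
Hypothesis fc : continuous f.
Variable P : borel_prob R S.

Lemma bp_push_nonempty : [set: T] !=set0.
Proof. by have [x _] := bp_nonempty P; exists (f x). Qed.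

Definition bp_push_fun (A : set (borel_space bp_push_nonempty)) : \bar R :=
  if `[< <<s @open T >> A >] then bp_measure P (f @^-1` A) else 0%E.

Let push0 : bp_push_fun set0 = 0%E.
Proof. by rewrite /bp_push_fun preimage_set0 measure0; case: ifP. Qed.

Let push_ge0 A : (0 <= bp_push_fun A)%E.
Proof. by rewrite /bp_push_fun; case: ifP. Qed.

Let push_sigma_additive : semi_sigma_additive bp_push_fun.
Proof.
move=> F mF tF mUF.
have pushE A : <<s @open T >> A -> bp_push_fun A = bp_measure P (f @^-1` A).
  by move=> mA; rewrite /bp_push_fun asboolT.
rewrite pushE// preimage_bigcup.
rewrite (_ : (fun n => _) =
    (fun n => \sum_(0 <= i < n) bp_measure P (f @^-1` F i))%E); last first.
  by apply/funext => n; apply: eq_bigr => i _; exact: pushE (mF i).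
apply: measure_semi_sigma_additive.
- by move=> n; apply: (borel_preimage fc); exact: mF.
- by move=> i j _ _ [x [Fix Fjx]]; apply: tF => //; exists (f x).
- by rewrite -preimage_bigcup; exact: (borel_preimage fc).
Qed.

HB.instance Definition _ := isMeasure.Build _ (borel_space bp_push_nonempty) R
  bp_push_fun push0 push_ge0 push_sigma_additive.

Let push_setT : bp_push_fun setT = 1%E.
Proof.
rewrite /bp_push_fun asboolT ?preimage_setT ?probability_setT//.
by apply: sub_gen_smallest; exact: openT.
Qed.

HB.instance Definition _ := Measure_isProbability.Build _ _ _
  bp_push_fun push_setT.

Lemma bp_push_off (A : set T) : ~ <<s @open T >> A -> bp_push_fun A = 0%E.
Proof. by move=> nA; rewrite /bp_push_fun asboolF. Qed.

Definition bp_push : borel_prob R T :=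
  @BorelProb R T bp_push_nonempty bp_push_fun bp_push_off.

Lemma bp_pushE (A : set T) : <<s @open T >> A ->
  bp_measure bp_push A = bp_measure P (f @^-1` A).
Proof. by move=> mA; rewrite /= /bp_push_fun asboolT. Qed.

End pushforward.

Lemma bp_push_id (T : topologicalType) (f : T -> T) (fc : continuous f) P :
  f =1 id -> bp_push fc P = P.
Proof.
move=> fid; apply: borel_prob_eq => A mA; rewrite bp_pushE//.
by congr (bp_measure P _); apply/funext => x /=; rewrite fid.
Qed.

Lemma bp_push_comp (S T U : topologicalType) (f : S -> T) (g : T -> U)
    (h : S -> U) (fc : continuous f) (gc : continuous g) (hc : continuous h) P :
  h =1 g \o f -> bp_push hc P = bp_push gc (bp_push fc P).
Proof.
move=> hgf; apply: borel_prob_eq => A mA; rewrite !bp_pushE//; last first.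
  exact: borel_preimage.
by congr (bp_measure P _); apply/funext => x /=; rewrite hgf.
Qed.

Definition bc_comp (S T : topologicalType) (f : S -> T) (fc : continuous f)
  (g : bounded_continuous R T) : bounded_continuous R S.
Proof.
exists (g \o f).
- by move=> x; apply: continuous_comp; [exact: fc|exact: bc_continuous].
- by have [M gM] := bc_bounded g; exists M => x; exact: gM.
Defined.

Lemma bc_measurable (T : topologicalType) (h : [set: T] !=set0)
    (g : bounded_continuous R T) :
  measurable_fun [set: borel_space h] (g : borel_space h -> R).
Proof.
apply: (measurability _ (RGenOpens.measurableE R)).
move=> _ [_ [a [b ->] <-]]; rewrite setTI; apply: sub_gen_smallest.
by have /continuousP := @bc_continuous _ _ g; apply; exact: interval_open.
Qed.

Lemma bp_integral_push (S T : topologicalType) (f : S -> T)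
    (fc : continuous f) P (g : bounded_continuous R T) :
  bp_integral (bp_push fc P) g = bp_integral P (bc_comp fc g).
Proof.
pose hS := bp_nonempty P; pose hT := bp_push_nonempty f P.
pose phi : borel_space hS -> borel_space hT := f.
have mphi : measurable_fun [set: borel_space hS] phi.
  by move=> _ A mA; rewrite setTI; exact: (borel_preimage fc).
have mg : measurable_fun [set: borel_space hT] (EFin \o g).
  by apply/measurable_EFinP; exact: bc_measurable.
congr fine.
transitivity (\int[pushforward (bp_measure P) phi]_x (g x)%:E)%E.
  by apply: eq_measure_integral => A mA _; exact: bp_pushE.
rewrite (@integral_pushforward _ _ _ _ R phi mphi (bp_measure P) setT
  (EFin \o g) mg)//.
have UE : phi @^-1` [set: borel_space hT] = [set: borel_space hS] by [].
have [M gM] := bc_bounded g.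
apply: (@measurable_bounded_integrable _ _ _ (bp_measure P) (g \o f)).
- by rewrite UE.
- by rewrite UE; apply: (@le_lt_trans _ _ 1%E); [exact: probability_le1|exact: ltry].
- exact: (@bc_measurable S hS (bc_comp fc g)).
- exists M; split; first exact: num_real.
  by move=> x Mx y _ /=; rewrite (le_trans (gM _))// ltW.
Qed.

Lemma bp_push_continuous (S T : topologicalType) (f : S -> T)
    (fc : continuous f) : continuous (bp_push fc).
Proof.
pose w : borel_prob R T -> {ptws bounded_continuous R T -> R} := @bp_integral R T.
apply: (@continuous_comp_initial _ _ _ w) => P.
have FF : Filter ((w \o bp_push fc) x @[x --> P]) by apply: fmap_filter; exact: nbhs_filter.
apply/cvg_sup => g A [_ [[B oB <-] /= Bx]] /filterS; apply.
pose v : borel_prob R S -> {ptws bounded_continuous R S -> R} := @bp_integral R S.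
have cg : continuous (@proj _ (fun=> R) (bc_comp fc g) \o v).
  move=> Q; apply: (@continuous_comp _ _ _ v).
    exact: (@initial_continuous _ _ v).
  exact: proj_continuous.
have BP : nbhs ((@proj _ (fun=> R) (bc_comp fc g) \o v) P) B.
  apply: open_nbhs_nbhs; split => //.
  change (B (bp_integral P (bc_comp fc g))).
  by rewrite -bp_integral_push; exact: Bx.
change (nbhs P [set Q | B (bp_integral (bp_push fc Q) g)]).
apply: (@filterS _ _ (nbhs_filter P) _ _ _ (cg P B BP)) => Q BQ.
change (B (bp_integral (bp_push fc Q) g)).
by rewrite bp_integral_push; exact: BQ.
Qed.

End borel_prob_theory.

(* Whether the values of [prob_functor sigma] are metrizable is not decided by
   [is_structure sigma] alone. They are when each [sigma X] is separable. If
   [sigma X] is an uncountable discrete space, [prob_functor sigma X] is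
   metrizable if and only if every probability measure on the power set of
   [sigma X] is carried by a countable set, a set-theoretic condition. *)
Definition prob_functor (R : realType) (sigma : bcm_functor R) : bcm_functor R :=
  @BcmFunctor R
    (fun X => borel_prob R (sigma X))
    (fun X Y f => bp_push (@fmor_continuous R sigma X Y f))
    (fun X Y f => @bp_push_continuous R _ _ _ (@fmor_continuous R sigma X Y f))
    (fun X P => @bp_push_id R _ _ _ P (@fmor_id R sigma X))
    (fun X Y Z g f P => @bp_push_comp R _ _ _ _ _ _ _ _ _ P
      (@fmor_comp R sigma X Y Z g f)).

(* Main.v *)
(* Let a structure sigma' and open subfunctors sigma'_k witness that sigma is Polish
   with preserved roots. A measure is called separably carried if it gives full
   mass to the closure of a countable set. Since sigma' X may be too large for all of
   its Borel probabilities to be well behaved, the structure witnessing the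
   conclusion is P_s(sigma'), the separably carried probabilities on sigma' X.
   The hypothesis on sigma makes every probability P on sigma X separably carried:
   finitely many bounded continuous functions are nearly constant on the cells of
   a countable Borel partition, so P is in the weak closure of the measures carried
   by countable sets, and, the weak topology being metrizable, it is a weak limit of
   a sequence of such measures.

   All metrics are Kantorovich distances: the supremum of (int f dP - int f dQ) over
   the functions f that are 1-Lipschitz for min(d, 1). By McShane extension an
   inequality d2(u2 a, v2 b) <= d1(u1 a, v1 b) + t is inherited by the distances of
   the pushforwards, which gives both the isometry and the stability requirements,
   with the same Theta. For the element-rooted metrization, (P, x) is mapped to the
   image of P under a |-> (a, x). The distance metrizes the weak topology on
   separably carried measures (partition of unity).

   It is complete when d is: for a Cauchy sequence P_n the limit L f of the integrals
   exists for Lipschitz f; uniform tightness up to small balls and completeness of d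
   give the Daniell property of L; then U |-> sup {L f : 0 <= f <= 1_U} defines an
   outer measure for which open sets are Caratheodory measurable, and its
   restriction to the Borel sets represents L.

   Finally P in P_s(sigma' X) comes from P(sigma X) if and only if
   P(sigma'_i) > 1 - 1/(j+1) for all i and j, an open condition for each (i, j). *)
Require Import Defs.
From HB Require Import structures.
From mathcomp Require Import all_boot all_order all_algebra.
From mathcomp Require Import all_classical all_reals all_analysis.
From mathcomp Require Import measurable_realfun lra.
Import Order.TTheory GRing.Theory Num.Theory.
Import numFieldNormedType.Exports.

Set Implicit Arguments.
Unset Strict Implicit.
Unset Printing Implicit Defensive.

Local Open Scope classical_set_scope.
Local Open Scope ring_scope.

(** * Borel sets and integrals of bounded Borel functions *)

Definition borel (T : topologicalType) : set (set T) := <<s @open T >>.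
Arguments borel {T} A.

Definition borel_fun (S T : topologicalType) (f : S -> T) : Prop :=
  forall A, open A -> borel (f @^-1` A).

Definition bounded_real (R : realType) (T : Type) (f : T -> R) : Prop :=
  exists M : R, forall x, `|f x| <= M.

Section borel_sets.
Variable T : topologicalType.
Implicit Types A B : set T.

Lemma borel_open A : open A -> borel A.
Proof. exact: sub_gen_smallest. Qed.

Lemma borelC A : borel A -> borel (~` A).
Proof. by rewrite -setTD; exact: sigma_algebraCD. Qed.

Lemma borel_closed A : closed A -> borel A.
Proof.
move=> cA; rewrite -(setCK A); apply: borelC; apply: borel_open.
by rewrite openC.
Qed.

Lemma borel0 : borel (@set0 T). Proof. exact: sigma_algebra0. Qed.

Lemma borelT : borel [set: T]. Proof. by apply: borel_open; exact: openT. Qed.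

Lemma borel_bigcup (F : nat -> set T) :
  (forall n, borel (F n)) -> borel (\bigcup_n F n).
Proof. by move=> bF; exact: sigma_algebra_bigcup. Qed.

Lemma borel_bigcap (F : nat -> set T) :
  (forall n, borel (F n)) -> borel (\bigcap_n F n).
Proof.
move=> bF; rewrite -(setCK (\bigcap_n F n)) setC_bigcap.
by apply: borelC; apply: borel_bigcup => n; exact: borelC.
Qed.

Lemma borelU A B : borel A -> borel B -> borel (A `|` B).
Proof.
move=> bA bB; rewrite -bigcup2E; apply: borel_bigcup => -[|[|n]] //=.
exact: borel0.
Qed.

Lemma borelI A B : borel A -> borel B -> borel (A `&` B).
Proof.
move=> bA bB; rewrite -(setCK (A `&` B)) setCI.
by apply: borelC; apply: borelU; exact: borelC.
Qed.

End borel_sets.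

Section borel_functions.

Lemma borel_fun_preimage (S T : topologicalType) (f : S -> T) (A : set T) :
  borel_fun f -> borel A -> borel (f @^-1` A).
Proof.
move=> fc; apply: (@smallest_sub _ _ _ [set B | borel (f @^-1` B)]) => //.
split=> [|B /= SB|F SF] /=.
- by rewrite preimage_set0; exact: borel0.
- by rewrite setTD preimage_setC; exact: borelC.
- by rewrite preimage_bigcup; exact: borel_bigcup.
Qed.

Lemma continuous_borel_fun (S T : topologicalType) (f : S -> T) :
  continuous f -> borel_fun f.
Proof. by move=> /continuousP fc A /fc; exact: borel_open. Qed.

Lemma borel_fun_comp (S T U : topologicalType) (f : S -> T) (g : T -> U) :
  borel_fun f -> borel_fun g -> borel_fun (g \o f).
Proof. by move=> bf bg A /bg; exact: borel_fun_preimage. Qed.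

Variables (R : realType) (T : topologicalType).
Implicit Types f g : T -> R.

Lemma borel_fun_measurable (h : [set: T] !=set0) f : borel_fun f ->
  measurable_fun [set: borel_space h] (f : borel_space h -> R).
Proof.
move=> bf; apply: (measurability _ (RGenOpens.measurableE R)).
move=> _ [_ [a [b ->] <-]]; rewrite setTI.
by apply: bf; exact: interval_open.
Qed.

Lemma measurable_borel_fun f :
  (forall h, measurable_fun [set: borel_space h] (f : borel_space h -> R)) ->
  borel_fun f.
Proof.
(* [borel_space] takes a proof of nonemptiness, so the empty space is treated apart: there every
   preimage is empty. *)
move=> mf A oA; have [h|/set0P/negP/negPn/eqP T0] := pselect ([set: T] !=set0).
  have := mf h measurableT A; rewrite setTI; apply.
  exact: open_measurable.
rewrite (_ : _ @^-1` _ = set0); first exact: borel0.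
by apply/seteqP; split => // x _; have : [set: T] x by []; rewrite T0.
Qed.

Lemma borel_funD f g : borel_fun f -> borel_fun g ->
  borel_fun (fun x => f x + g x).
Proof.
move=> bf bg; apply: measurable_borel_fun => h.
by apply: measurable_funD; exact: borel_fun_measurable.
Qed.

Lemma borel_funB f g : borel_fun f -> borel_fun g ->
  borel_fun (fun x => f x - g x).
Proof.
move=> bf bg; apply: measurable_borel_fun => h.
by apply: measurable_funB; exact: borel_fun_measurable.
Qed.

Lemma borel_funZ (k : R) f : borel_fun f -> borel_fun (fun x => k * f x).
Proof.
move=> bf; apply: measurable_borel_fun => h.
by apply: measurable_funM => //; exact: borel_fun_measurable.
Qed.

Lemma borel_fun_cst (k : R) : borel_fun (fun _ : T => k).
Proof. by apply: continuous_borel_fun => x; exact: cvg_cst. Qed.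

Lemma borel_fun_indic (A : set T) : borel A -> borel_fun (\1_A : T -> R).
Proof.
move=> bA; apply: measurable_borel_fun => h.
exact: (@measurable_indic _ (borel_space h)).
Qed.

Lemma bounded_realD f g : bounded_real f -> bounded_real g ->
  bounded_real (fun x => f x + g x).
Proof.
move=> [M fM] [N gN]; exists (M + N) => x.
by rewrite (le_trans (ler_normD _ _))// lerD.
Qed.

Lemma bounded_realB f g : bounded_real f -> bounded_real g ->
  bounded_real (fun x => f x - g x).
Proof.
move=> [M fM] [N gN]; exists (M + N) => x.
by rewrite (le_trans (ler_normB _ _))// lerD.
Qed.

Lemma bounded_realZ (k : R) f : bounded_real f ->
  bounded_real (fun x => k * f x).
Proof.
by move=> [M fM]; exists (`|k| * M) => x; rewrite normrM ler_wpM2l.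
Qed.

Lemma bounded_real_cst (k : R) : bounded_real (fun _ : T => k).
Proof. by exists `|k|. Qed.

Lemma bounded_real_indic (A : set T) : bounded_real (\1_A : T -> R).
Proof.
by exists 1 => x; rewrite indicE; case: (_ \in _); rewrite ?normr1// normr0.
Qed.

Lemma bounded_real01 f : (forall x, 0 <= f x <= 1) -> bounded_real f.
Proof. by move=> f01; exists 1 => x; have := f01 x; rewrite ler_norml; lra. Qed.

End borel_functions.

(** * Integrals and probabilities as real numbers *)

Section mean.
Variables (R : realType) (T : topologicalType).
Implicit Types (P Q : borel_prob R T) (f g : T -> R) (A B : set T).

Definition mean P f : R := \int[bp_measure P]_x f x.

Definition prob P A : R := fine (bp_measure P A).

Lemma prob_EFin P A : borel A -> bp_measure P A = (prob P A)%:E.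
Proof.
move=> bA; rewrite /prob fineK//.
exact: (@fin_num_measure _ _ _ (bp_measure P) A bA).
Qed.

Lemma mean_integrable P f : borel_fun f -> bounded_real f ->
  (bp_measure P).-integrable setT (EFin \o f).
Proof.
move=> bf [M fM]; apply: measurable_bounded_integrable => //.
- by apply: (@le_lt_trans _ _ 1%E); [exact: probability_le1|exact: ltry].
- exact: borel_fun_measurable.
- exists M; split; first exact: num_real.
  by move=> x Mx y _ /=; rewrite (le_trans (fM _))// ltW.
Qed.

Lemma mean_cst P (k : R) : mean P (fun=> k) = k.
Proof. by rewrite /mean Rintegral_cst//= probability_setT/= mulr1. Qed.

Lemma meanD P f g : borel_fun f -> bounded_real f ->
  borel_fun g -> bounded_real g -> mean P (fun x => f x + g x) = mean P f + mean P g.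
Proof. by move=> *; apply: RintegralD => //; exact: mean_integrable. Qed.

Lemma meanB P f g : borel_fun f -> bounded_real f ->
  borel_fun g -> bounded_real g -> mean P (fun x => f x - g x) = mean P f - mean P g.
Proof. by move=> *; apply: RintegralB => //; exact: mean_integrable. Qed.

Lemma meanZ P (k : R) f : borel_fun f -> bounded_real f ->
  mean P (fun x => k * f x) = k * mean P f.
Proof. by move=> *; apply: RintegralZl => //; exact: mean_integrable. Qed.

Lemma meanN P f : borel_fun f -> bounded_real f ->
  mean P (fun x => - f x) = - mean P f.
Proof.
move=> bf Bf; rewrite -mulN1r -meanZ//.
by congr mean; apply/funext => x; rewrite mulN1r.
Qed.

Lemma le_mean P f g : borel_fun f -> bounded_real f ->
  borel_fun g -> bounded_real g -> (forall x, f x <= g x) -> mean P f <= mean P g.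
Proof. by move=> *; apply: le_Rintegral => //; exact: mean_integrable. Qed.

Lemma mean_ge0 P f : (forall x, 0 <= f x) -> 0 <= mean P f.
Proof. by move=> f0; apply: Rintegral_ge0. Qed.

Lemma ler_dist_mean P f g h : borel_fun f -> bounded_real f ->
  borel_fun g -> bounded_real g -> borel_fun h -> bounded_real h ->
  (forall x, `|f x - g x| <= h x) -> `|mean P f - mean P g| <= mean P h.
Proof.
move=> bf Bf bg Bg bh Bh fgh.
suff H f' g' : borel_fun f' -> bounded_real f' -> borel_fun g' ->
    bounded_real g' -> (forall x, `|f' x - g' x| <= h x) ->
    mean P f' - mean P g' <= mean P h.
  rewrite ler_norml; have := H g f bg Bg bf Bf.
  have := H f g bf Bf bg Bg fgh => ? /(_ _) gf.
  have {}gf := gf (fun x => ltac:(rewrite distrC; exact: fgh)).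
  by apply/andP; split; lra.
move=> bf' Bf' bg' Bg' H; rewrite -meanB//; apply: le_mean => //.
- exact: borel_funB.
- exact: bounded_realB.
- by move=> x; rewrite (le_trans _ (H x))// ler_norm.
Qed.

Lemma mean_indic P A : borel A -> mean P \1_A = prob P A.
Proof.
move=> bA; rewrite /mean /Rintegral /prob; congr fine.
by rewrite integral_indic// setIT.
Qed.

(** Dominated convergence, with the constant [M] as dominating function. *)
Lemma mean_cvg P (f_ : nat -> T -> R) f (M : R) :
  (forall n, borel_fun (f_ n)) -> borel_fun f ->
  (forall n x, `|f_ n x| <= M) -> (forall x, f_ n x @[n --> \oo] --> f x) ->
  mean P (f_ n) @[n --> \oo] --> mean P f.
Proof.
move=> bf_ bf fM ff.
have ig : (bp_measure P).-integrable setT (EFin \o (fun=> M)).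
  apply: mean_integrable; first exact: borel_fun_cst.
  exact: bounded_real_cst.
have [] := @dominated_convergence _ _ R (bp_measure P) setT measurableT
  (fun n => EFin \o f_ n) (EFin \o f) (EFin \o fun=> M).
- by move=> n; apply/measurable_EFinP; exact: borel_fun_measurable.
- by apply/measurable_EFinP; exact: borel_fun_measurable.
- by apply: aeW => x _; apply/cvg_EFin; [exact: nearW|exact: ff].
- exact: ig.
- by apply: aeW => x n _; rewrite /= lee_fin.
move=> intf _ cvf; apply: fine_cvg.
by rewrite /mean /Rintegral fineK//; exact: integrable_fin_num.
Qed.

Lemma prob_ge0 P A : 0 <= prob P A.
Proof. by rewrite fine_ge0. Qed.

Lemma probT P : prob P setT = 1.
Proof. by rewrite /prob probability_setT. Qed.

Lemma le_prob P A B : borel A -> borel B -> A `<=` B -> prob P A <= prob P B.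
Proof.
move=> bA bB AB; rewrite -lee_fin -!prob_EFin//.
by apply: le_measure => //; rewrite inE.
Qed.

Lemma prob_le1 P A : borel A -> prob P A <= 1.
Proof. by move=> bA; rewrite -(probT P) le_prob//; exact: borelT. Qed.

Lemma probC P A : borel A -> prob P (~` A) = 1 - prob P A.
Proof.
move=> bA; apply: EFin_inj; rewrite -prob_EFin; last exact: borelC.
rewrite EFinB -prob_EFin//; exact: probability_setC.
Qed.

Lemma probU_le P A B : borel A -> borel B ->
  prob P (A `|` B) <= prob P A + prob P B.
Proof.
move=> bA bB; rewrite -lee_fin EFinD -!prob_EFin//; last exact: borelU.
exact: measureU2.
Qed.

Lemma prob_bigcup0 P (F : nat -> set T) : (forall n, borel (F n)) ->
  (forall n, prob P (F n) = 0) -> prob P (\bigcup_n F n) = 0.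
Proof.
move=> bF F0; apply: EFin_inj; rewrite -prob_EFin; last exact: borel_bigcup.
apply/eqP; rewrite eq_le measure_ge0 andbT.
apply: (le_trans (measure_sigma_subadditive (bp_measure P) (F := F) bF
  (borel_bigcup bF) (@subset_refl _ _))).
by rewrite eseries0// => i _ _; exact: (etrans (prob_EFin P (bF i)) (congr1 EFin (F0 i))).
Qed.

Lemma prob_bigcap1 P (F : nat -> set T) : (forall n, borel (F n)) ->
  (forall n, prob P (F n) = 1) -> prob P (\bigcap_n F n) = 1.
Proof.
move=> bF F1; rewrite -(setCK (\bigcap_n F n)) setC_bigcap probC.
  rewrite prob_bigcup0 ?subr0// => n; first exact: borelC.
  by rewrite probC// F1 subrr.
by apply: borel_bigcup => n; exact: borelC.
Qed.

Lemma prob_cvg P (F : nat -> set T) : (forall n, borel (F n)) ->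
  (forall n, F n `<=` F n.+1) -> prob P (F n) @[n --> \oo] --> prob P (\bigcup_n F n).
Proof.
move=> bF ndF; apply: fine_cvg; rewrite -prob_EFin; last exact: borel_bigcup.
apply: nondecreasing_cvg_mu => //; first exact: (borel_bigcup bF).
by apply/nondecreasing_seqP => n; apply/subsetPset; exact: ndF.
Qed.

(* Markov-type bound used in place of almost-everywhere arguments. *)
Lemma mean_le_prob P f A (e M : R) : borel_fun f -> bounded_real f -> borel A ->
  0 <= M -> (forall x, ~ A x -> f x <= e) -> (forall x, A x -> f x <= e + M) ->
  mean P f <= e + M * prob P A.
Proof.
move=> bf Bf bA M0 fe fM.
have bi : borel_fun (\1_A : T -> R) by exact: borel_fun_indic.
have Bi : bounded_real (\1_A : T -> R) by exact: bounded_real_indic.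
rewrite -(mean_indic P bA) -{1}(mean_cst P e) -meanZ// -meanD//.
- apply: le_mean => //.
  + by apply: borel_funD; [exact: borel_fun_cst|exact: borel_funZ].
  + by apply: bounded_realD; [exact: bounded_real_cst|exact: bounded_realZ].
  + move=> x; rewrite indicE; have [xA|xA] := boolP (x \in A).
      by rewrite mulr1; apply: fM; rewrite inE in xA.
    by rewrite mulr0 addr0; apply: fe; rewrite notin_setE in xA.
- exact: borel_fun_cst.
- exact: bounded_real_cst.
- exact: borel_funZ.
- exact: bounded_realZ.
Qed.

End mean.

(** * Images of probabilities under Borel maps *)

Section borel_pushforward.
Variables (R : realType) (S T : topologicalType) (f : S -> T).
Hypothesis bf : borel_fun f.
Variable P : borel_prob R S.

Let nonempty : [set: T] !=set0.
Proof. by have [x _] := bp_nonempty P; exists (f x). Qed.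

Let mu (A : set (borel_space nonempty)) : \bar R :=
  if `[< borel (A : set T) >] then bp_measure P (f @^-1` A) else 0%E.

Let mu0 : mu set0 = 0%E.
Proof. by rewrite /mu preimage_set0 measure0; case: ifP. Qed.

Let mu_ge0 A : (0 <= mu A)%E.
Proof. by rewrite /mu; case: ifP. Qed.

Let mu_sigma_additive : semi_sigma_additive mu.
Proof.
move=> F mF tF mUF.
have muE A : borel (A : set T) -> mu A = bp_measure P (f @^-1` A).
  by move=> mA; rewrite /mu asboolT.
rewrite muE// preimage_bigcup.
rewrite (_ : (fun n => _) =
    (fun n => \sum_(0 <= i < n) bp_measure P (f @^-1` F i))%E); last first.
  by apply/funext => n; apply: eq_bigr => i _; exact: muE (mF i).
apply: measure_semi_sigma_additive.
- by move=> n; apply: (borel_fun_preimage bf); exact: mF.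
- by move=> i j _ _ [x [Fix Fjx]]; apply: tF => //; exists (f x).
- by rewrite -preimage_bigcup; exact: (borel_fun_preimage bf).
Qed.

HB.instance Definition _ := isMeasure.Build _ (borel_space nonempty) R
  mu mu0 mu_ge0 mu_sigma_additive.

Let mu_setT : mu setT = 1%E.
Proof. by rewrite /mu asboolT ?preimage_setT ?probability_setT//; exact: borelT. Qed.

HB.instance Definition _ := Measure_isProbability.Build _ _ _ mu mu_setT.

Let mu_off (A : set T) : ~ borel A -> mu A = 0%E.
Proof. by move=> nA; rewrite /mu asboolF. Qed.

(** Extends [bp_push] beyond continuous maps: discretizations of a probability and Borel left
    inverses of embeddings are only Borel. *)
Definition bp_map : borel_prob R T := @BorelProb R T nonempty mu mu_off.

Lemma bp_mapE (A : set T) : borel A ->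
  bp_measure bp_map A = bp_measure P (f @^-1` A).
Proof. by move=> mA; rewrite /= /mu asboolT. Qed.

Lemma prob_map (A : set T) : borel A -> prob bp_map A = prob P (f @^-1` A).
Proof. by move=> mA; rewrite /prob bp_mapE. Qed.

Lemma mean_map (g : T -> R) : borel_fun g -> bounded_real g ->
  mean bp_map g = mean P (g \o f).
Proof.
move=> bg Bg; pose hS := bp_nonempty P.
pose phi : borel_space hS -> borel_space nonempty := f.
have mphi : measurable_fun [set: borel_space hS] phi.
  by move=> _ A mA; rewrite setTI; exact: (borel_fun_preimage bf).
have mg : measurable_fun [set: borel_space nonempty] (EFin \o g).
  by apply/measurable_EFinP; exact: borel_fun_measurable.
congr fine.
transitivity (\int[pushforward (bp_measure P) phi]_x (g x)%:E)%E.
  by apply: eq_measure_integral => A mA _; exact: bp_mapE.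
rewrite (@integral_pushforward _ _ _ _ R phi mphi (bp_measure P) setT
  (EFin \o g) mg)//.
apply: (@mean_integrable R S P (g \o f)); first exact: borel_fun_comp.
by have [M gM] := Bg; exists M => x; exact: gM.
Qed.

End borel_pushforward.

Lemma bp_map_push (R : realType) (S T : topologicalType) (f : S -> T)
    (bf : borel_fun f) (fc : continuous f) (P : borel_prob R S) :
  bp_map bf P = bp_push fc P.
Proof. by apply: borel_prob_eq => A mA; rewrite bp_mapE// bp_pushE. Qed.

Lemma prob_push (R : realType) (S T : topologicalType) (f : S -> T)
    (fc : continuous f) (P : borel_prob R S) (A : set T) : borel A ->
  prob (bp_push fc P) A = prob P (f @^-1` A).
Proof. by move=> bA; rewrite /prob bp_pushE. Qed.

Lemma mean_push (R : realType) (S T : topologicalType) (f : S -> T)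
    (fc : continuous f) (P : borel_prob R S) (g : T -> R) :
  borel_fun g -> bounded_real g -> mean (bp_push fc P) g = mean P (g \o f).
Proof.
by move=> ? ?; rewrite -(bp_map_push (continuous_borel_fun fc)) mean_map.
Qed.

(** * Lipschitz functions and the Kantorovich distance *)

Section truncated_metric.
Variables (R : realType) (T : topologicalType) (d : T -> T -> R).

Definition trunc (x y : T) : R := Num.min (d x y) 1.

(** The one-sided bound controls the absolute value too, since [trunc] is symmetric as soon as [d]
    is. Truncation bounds the oscillation of such an [f] by [m], so [f] is bounded whatever the
    diameter of [d]. *)
Definition lip (m : R) (f : T -> R) : Prop :=
  forall x y, f x - f y <= m * trunc x y.

Hypothesis md : metrizes d.

Lemma metrizes_xx x : d x x = 0. Proof. by have [] := md. Qed.

Lemma metrizes_sym x y : d x y = d y x. Proof. by have [] := md. Qed.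

Lemma metrizes_triangle y x z : d x z <= d x y + d y z.
Proof. by have [] := md. Qed.

Lemma metrizes_eq0 x y : d x y = 0 -> x = y.
Proof. by have [_ + _ _ _] := md; apply. Qed.

Lemma metrizes_nbhsP x (A : set T) :
  nbhs x A <-> exists2 e, 0 < e & [set y | d x y < e] `<=` A.
Proof. by have [] := md. Qed.

Lemma metrizes_ge0 x y : 0 <= d x y.
Proof.
have := metrizes_triangle y x x; rewrite metrizes_xx (metrizes_sym y x); lra.
Qed.

Lemma metrizes_nbhs_ball x (e : R) : 0 < e -> nbhs x [set y | d x y < e].
Proof. by move=> e0; apply/metrizes_nbhsP; exists e. Qed.

Lemma metrizes_open_ball x (e : R) : open [set y | d x y < e].
Proof.
rewrite openE => y /= xy; apply/metrizes_nbhsP; exists (e - d x y).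
  by rewrite subr_gt0.
by move=> z /= yz; have := metrizes_triangle y x z; lra.
Qed.

Lemma metrizes_cvgP (F : set_system T) (x : T) : Filter F ->
  (forall e, 0 < e -> F [set y | d x y < e]) <-> F --> x.
Proof.
move=> FF; split=> [Fe A /metrizes_nbhsP[e e0 eA]|Fx e e0].
  by apply: filterS eA _; exact: Fe.
by apply: Fx; exact: metrizes_nbhs_ball.
Qed.

Lemma closureP_metrizes (A : set T) x :
  closure A x <-> forall e, 0 < e -> exists2 y, A y & d x y < e.
Proof.
split=> [clA e e0|Ae B /metrizes_nbhsP[e e0 eB]].
  by have [y [Ay xy]] := clA _ (metrizes_nbhs_ball x e0); exists y.
by have [y Ay xy] := Ae _ e0; exists y; split => //; exact: eB.
Qed.

Lemma trunc_le x y : trunc x y <= d x y.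
Proof. by rewrite /trunc ge_min lexx. Qed.

Lemma trunc_le1 x y : trunc x y <= 1.
Proof. by rewrite /trunc ge_min lexx orbT. Qed.

Lemma trunc_xx x : trunc x x = 0.
Proof. by rewrite /trunc metrizes_xx; apply/min_idPl. Qed.

Lemma trunc_ge0 x y : 0 <= trunc x y.
Proof. by rewrite /trunc le_min metrizes_ge0/=. Qed.

Lemma trunc_sym x y : trunc x y = trunc y x.
Proof. by rewrite /trunc metrizes_sym. Qed.

Lemma trunc_triangle y x z : trunc x z <= trunc x y + trunc y z.
Proof.
have H1 := metrizes_triangle y x z; have H2 := metrizes_ge0 x y.
have H3 := metrizes_ge0 y z; rewrite /trunc.
have [?|?] := leP (d x z) 1; have [?|?] := leP (d x y) 1;
  by have [?|?] := leP (d y z) 1; lra.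
Qed.

Lemma lip_continuous m f : lip m f -> continuous f.
Proof.
move=> lf x; apply/cvgrPdist_lt => e e0.
(* The sign of [m] is unknown and [m] may be 0, so the Lipschitz constant is enlarged to a positive
   one. *)
have K0 : 0 < `|m| + 1 by rewrite ltr_wpDl.
apply/metrizes_nbhsP; exists (e / (`|m| + 1)); first exact: divr_gt0.
move=> y /=; rewrite ltr_pdivlMr// => xy.
have le_m z w : f z - f w <= d z w * (`|m| + 1).
  rewrite (le_trans (lf z w))//.
  have := trunc_le z w; have := trunc_ge0 z w; have := ler_norm m.
  have := normr_ge0 m; nra.
by have := le_m x y; have := le_m y x; rewrite (metrizes_sym y) ltr_norml; lra.
Qed.

Lemma lip_osc m f x y : 0 <= m -> lip m f -> f x - f y <= m.
Proof.
by move=> m0 /(_ x y)/le_trans; apply; rewrite ler_piMr// trunc_le1.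
Qed.

Lemma lip_bounded m f : 0 <= m -> lip m f -> bounded_real f.
Proof.
move=> m0 lf; have [[x0 _]|T0] := pselect ([set: T] !=set0); last first.
  by exists 0 => x; exfalso; apply: T0; exists x.
exists (m + `|f x0|) => x; rewrite ler_norml.
have := lip_osc x x0 m0 lf; have := lip_osc x0 x m0 lf.
by have := ler_norm (f x0); have := ler_norm (- f x0); rewrite normrN; lra.
Qed.

Lemma lip_borel_fun m f : lip m f -> borel_fun f.
Proof. by move=> lf; apply: continuous_borel_fun; exact: lip_continuous lf. Qed.

Lemma lipN m f : lip m f -> lip m (fun x => - f x).
Proof. by move=> lf x y; rewrite trunc_sym; have := lf y x; lra. Qed.

Lemma lip_cst m k : 0 <= m -> lip m (fun=> k).
Proof. by move=> m0 x y; rewrite subrr mulr_ge0// trunc_ge0. Qed.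

Lemma lip_mono m m' f : m <= m' -> lip m f -> lip m' f.
Proof.
move=> mm' lf x y; rewrite (le_trans (lf x y))//.
by rewrite ler_wpM2r// trunc_ge0.
Qed.

End truncated_metric.

(* The inf-convolution of [g] with [m * trunc d] along [p]. It is used for McShane
   extensions ([m = 1]), Lipschitz approximations from below of lower
   semicontinuous functions ([p = id]) and truncated distances to sets. *)
Section inf_convolution.
Variables (R : realType) (E : topologicalType) (d : E -> E -> R).
Hypothesis md : metrizes d.
Variables (I : Type) (i0 : I) (p : I -> E) (g : I -> R) (c m : R).
Hypotheses (cg : forall i, c <= g i) (m0 : 0 <= m).

Definition infconv (x : E) : R :=
  inf [set g i + m * trunc d (p i) x | i in [set: I]].

Lemma infconv_le i x : infconv x <= g i + m * trunc d (p i) x.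
Proof.
apply: ge_inf; last by exists i.
exists c => _ [j _ <-]; rewrite (le_trans (cg j))// lerDl mulr_ge0//.
exact: trunc_ge0.
Qed.

Lemma le_infconv k x :
  (forall i, k <= g i + m * trunc d (p i) x) -> k <= infconv x.
Proof.
move=> kg; apply: lb_le_inf; last by move=> _ [i _ <-].
by exists (g i0 + m * trunc d (p i0) x), i0.
Qed.

Lemma infconv_lip : lip d m infconv.
Proof.
move=> x y; rewrite lerBlDl addrC -lerBlDl; apply: le_infconv => i.
rewrite lerBlDl (le_trans (infconv_le i x))// addrCA lerD2l -mulrDr.
rewrite ler_wpM2l// addrC (trunc_sym md x y); exact: trunc_triangle.
Qed.

End inf_convolution.

(** * Lower semicontinuous functions and their Lipschitz approximation from below *)

Definition lsc (R : realType) (T : topologicalType) (g : T -> R) : Prop :=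
  forall x e, 0 < e -> nbhs x [set y | g x - e < g y].

Lemma continuous_lsc (R : realType) (T : topologicalType) (g : T -> R) :
  continuous g -> lsc g.
Proof.
move=> gc x e e0; have /cvgrPdist_lt/(_ e e0) := gc x.
by apply: filterS => y; rewrite ltr_norml => /andP[]; rewrite /=; lra.
Qed.

Lemma indic_lsc (R : realType) (T : topologicalType) (U : set T) :
  open U -> lsc (\1_U : T -> R).
Proof.
move=> oU x e e0; have [xU|xU] := boolP (x \in U).
  apply: filterS (open_nbhs_nbhs (conj oU (set_mem xU))) => y Uy /=.
  by rewrite !indicE xU mem_set//=; lra.
by apply: nearW => y /=; rewrite !indicE (negbTE xU)/=; case: (_ \in _) => /=; lra.
Qed.

Section lipschitz_approximation.
Variables (R : realType) (T : topologicalType) (d : T -> T -> R).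
Hypothesis md : metrizes d.

(** Within [r] of [x], lower semicontinuity keeps [g] above [g x - e]. Farther away the penalty is
    at least [n%:R * Num.min r 1], which for large [n] exceeds [g x - c]. *)
Lemma infconv_cvg (g : T -> R) (c : R) x : lsc g -> (forall y, c <= g y) ->
  infconv d id g n%:R x @[n --> \oo] --> g x.
Proof.
move=> lg cg; apply/cvgrPdist_le => e e0.
have /(metrizes_nbhsP md)[r r0 rg] := lg x e e0.
have s0 : 0 < Num.min r 1 by rewrite lt_min r0/=.
near=> n; have n0 : 0 <= n%:R :> R by [].
have := infconv_le md id cg n0 x x; rewrite (trunc_xx md) mulr0 addr0 => Fg.
suff : g x - e <= infconv d id g n%:R x by rewrite ler_norml; lra.
apply: (le_infconv (d := d) x) => y.
have [xy|xy] := ltP (d x y) r.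
  have /= := rg _ xy; have := mulr_ge0 n0 (trunc_ge0 md y x); lra.
have H : Num.min r 1 <= trunc d y x.
  by rewrite /trunc (metrizes_sym md y x) le_min !ge_min lexx orbT xy.
have : g x - c <= n%:R * Num.min r 1.
  rewrite -ler_pdivrMr//; near: n; exact: nbhs_infty_ger.
have := cg y; have := ler_wpM2l n0 H; lra.
Unshelve. all: by end_near. Qed.

(** The inf-convolutions stay below [g] and converge to it pointwise, so their means converge by
    dominated convergence. Applied to indicators of open sets and to bounded continuous
    functions. *)
Lemma lsc_approx (P : borel_prob R T) (g : T -> R) (c : R) :
  borel_fun g -> bounded_real g -> lsc g -> c < mean P g ->
  exists (m : R) f, [/\ 0 < m, lip d m f, forall x, f x <= g x & c < mean P f].
Proof.
move=> bg [M gM] lg cP.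
have [x0 _] := bp_nonempty P.
have Mg y : - M <= g y by have := gM y; rewrite ler_norml => /andP[].
have n0 n : 0 <= n%:R :> R by [].
have lF n : lip d n%:R (infconv d id g n%:R).
  exact: (infconv_lip md x0 id Mg (n0 n)).
have Fg n x : infconv d id g n%:R x <= g x.
  by have := infconv_le md id Mg (n0 n) x x; rewrite (trunc_xx md) mulr0 addr0.
have MF n x : - M <= infconv d id g n%:R x.
  apply: (le_infconv (d := d) x0) => y.
  by rewrite (le_trans (Mg y))// lerDl mulr_ge0// trunc_ge0.
have cv : mean P (infconv d id g n%:R) @[n --> \oo] --> mean P g.
  apply: (@mean_cvg _ _ _ _ _ M) => //.
  - by move=> n; apply: lip_borel_fun (lF n).
  - move=> n x; rewrite ler_norml MF/= (le_trans (Fg n x))//.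
    by have := gM x; rewrite ler_norml => /andP[].
  - by move=> x; exact: infconv_cvg.
have [N _ /(_ N (leqnn N)) /= cN] := cvgr_gt _ cv _ cP.
(* [N] may be 0, whereas the Lipschitz constant must be positive. *)
exists (N%:R + 1), (infconv d id g N%:R); split => //.
by apply: lip_mono (lF N) => //; lra.
Qed.

(** Lipschitz functions below the indicator of an open set have means arbitrarily close to its mass,
    so [P] and [Q] agree on open sets. These are stable under intersection and generate the Borel
    sets. *)
Lemma borel_prob_mean_eq (P Q : borel_prob R T) :
  (forall (m : R) f, 0 < m -> lip d m f -> mean P f = mean Q f) -> P = Q.
Proof.
move=> PQ.
have le_open (P' Q' : borel_prob R T) (U : set T) : open U ->
    (forall (m : R) f, 0 < m -> lip d m f -> mean P' f = mean Q' f) ->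
    prob P' U <= prob Q' U.
  move=> oU PQ'; have bU := borel_open oU.
  rewrite leNgt; apply/negP; rewrite -{1}(mean_indic P' bU) => QP.
  have [||| m [f [m0 lf fU]]] := lsc_approx _ _ _ QP.
  - exact: borel_fun_indic.
  - exact: bounded_real_indic.
  - exact: indic_lsc.
  rewrite (PQ' _ _ m0 lf) ltNge; apply/negP/negPn; rewrite -mean_indic//.
  apply: le_mean => //.
  - exact: lip_borel_fun lf.
  - exact: lip_bounded (ltW m0) lf.
  - exact: borel_fun_indic.
  - exact: bounded_real_indic.
have {le_open PQ} PQ (U : set T) : open U -> bp_measure P U = bp_measure Q U.
  move=> oU; rewrite !prob_EFin; try exact: borel_open.
  congr EFin; apply/eqP; rewrite eq_le !le_open// => m f m0 lf.
  by rewrite (PQ _ _ m0 lf).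
(* The two measures live on types indexed by different proofs of nonemptiness, which proof
   irrelevance identifies. *)
case: P Q PQ => [h P Poff] [h' Q Qoff] /=.
move: Q Qoff; rewrite (Prop_irrelevance h' h) => Q Qoff PQ.
apply: borel_prob_eq => A bA /=.
apply: (@measure_unique _ R (borel_space h) (@open T) (fun=> setT)) => //.
- by move=> ? ?; exact: openI.
- by move=> ?; exact: openT.
- by rewrite bigcup_const//; exists 0%N.
- by move=> k; apply: (@le_lt_trans _ _ 1%E); [exact: probability_le1|exact: ltry].
Qed.

End lipschitz_approximation.

Section kantorovich.
Variables (R : realType) (T : topologicalType) (d : T -> T -> R).
Hypothesis md : metrizes d.
Implicit Types P Q : borel_prob R T.

(** The class [lip d 1] is stable under negation, so differences without absolute value already give
    a symmetric distance. *)
Definition kr P Q : R := sup [set mean P f - mean Q f | f in lip d 1].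

(** Makes the supremum in [kr] that of a bounded set. Pointwise [f] exceeds its mean under [Q] by at
    most its oscillation; this is then integrated against [P]. *)
Lemma kr_lip_osc P Q f : lip d 1 f -> mean P f - mean Q f <= 1.
Proof.
move=> lf; have bf := lip_borel_fun md lf; have Bf := lip_bounded ler01 lf.
have fQ x : f x <= mean Q f + 1.
  rewrite -lerBlDr -(mean_cst Q (f x - 1)); apply: le_mean => //.
  - exact: borel_fun_cst.
  - exact: bounded_real_cst.
  - by move=> y; have := lip_osc x y ler01 lf; lra.
suff : mean P f <= mean Q f + 1 by lra.
rewrite -[leRHS](mean_cst P); apply: le_mean => //.
- exact: borel_fun_cst.
- exact: bounded_real_cst.
Qed.

Lemma kr_ub P Q f : lip d 1 f -> mean P f - mean Q f <= kr P Q.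
Proof.
move=> lf; apply: ub_le_sup; last by exists f.
by exists 1 => _ [g lg <-]; exact: kr_lip_osc.
Qed.

Lemma kr_le P Q c :
  (forall f, lip d 1 f -> mean P f - mean Q f <= c) -> kr P Q <= c.
Proof.
move=> fc; apply: ge_sup; last by move=> _ [f lf <-]; exact: fc.
by exists (mean P (fun=> 0) - mean Q (fun=> 0)), (fun=> 0) => //; exact: lip_cst.
Qed.

Lemma kr_xx P : kr P P = 0.
Proof.
apply/eqP; rewrite eq_le kr_le => [|f _]; last by rewrite subrr.
by have := @kr_ub P P (fun=> 0) (lip_cst md _ ler01); rewrite subrr.
Qed.

Lemma kr_ge0 P Q : 0 <= kr P Q.
Proof.
by have := @kr_ub P Q (fun=> 0) (lip_cst md _ ler01); rewrite !mean_cst subrr.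
Qed.

Lemma kr_sym P Q : kr P Q = kr Q P.
Proof.
suff H P' Q' : kr P' Q' <= kr Q' P' by apply/eqP; rewrite eq_le !H.
apply: kr_le => f lf; have := @kr_ub Q' P' _ (lipN md lf).
rewrite !meanN; try exact: lip_borel_fun md _ _ lf.
  lra.
all: exact: lip_bounded ler01 lf.
Qed.

Lemma kr_triangle Q P S : kr P S <= kr P Q + kr Q S.
Proof.
by apply: kr_le => f lf; have := @kr_ub P Q f lf; have := @kr_ub Q S f lf; lra.
Qed.

Lemma kr_lip P Q m f : 0 < m -> lip d m f ->
  `|mean P f - mean Q f| <= m * kr P Q.
Proof.
move=> m0 lf; have bf := lip_borel_fun md lf.
have Bf := lip_bounded (ltW m0) lf.
have lf1 : lip d 1 (fun x => m^-1 * f x).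
  by move=> x y; rewrite -mulrBr mul1r mulrC ler_pdivrMr// mulrC.
have H P' Q' : mean P' f - mean Q' f <= m * kr P' Q'.
  by have := @kr_ub P' Q' _ lf1; rewrite !meanZ// -mulrBr mulrC ler_pdivrMr// mulrC.
by have := H P Q; have := H Q P; rewrite (kr_sym Q P) ler_norml; lra.
Qed.

(** The topology of [kr] is at least as fine as the weak one. A Lipschitz minorant with nearly the
    same mean gives the lower bound, and the same argument for [- f] gives the upper bound. *)
Lemma kr_mean P f (e : R) : continuous f -> bounded_real f -> 0 < e ->
  exists2 r : R, 0 < r & forall Q, kr P Q < r -> `|mean Q f - mean P f| < e.
Proof.
have half P' g : continuous g -> bounded_real g -> 0 < e ->
    exists2 r : R, 0 < r & forall Q, kr P' Q < r -> mean P' g - e < mean Q g.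
  move=> gc Bg e0; have bg := continuous_borel_fun gc.
  have lt_e : mean P' g - e / 2 < mean P' g by lra.
  have [m [h [m0 lh hg hP]]] := lsc_approx md bg Bg (continuous_lsc gc) lt_e.
  (* Half of [e] is spent on replacing [g] by [h], the other half on passing from [P'] to [Q]. *)
  exists (e / 2 / m); first by rewrite divr_gt0// divr_gt0.
  move=> Q; rewrite ltr_pdivlMr// mulrC => PQ.
  have := kr_lip P' Q m0 lh.
  have := @le_mean _ _ Q h g (lip_borel_fun md lh)
    (lip_bounded (ltW m0) lh) bg Bg hg.
  by rewrite ler_norml; lra.
move=> fc Bf e0; have [r r0 rP] := half P f fc Bf e0.
have Nfc : continuous (fun x => - f x) by move=> x; apply: cvgN; exact: fc.
have NBf : bounded_real (fun x => - f x).
  by have [M fM] := Bf; exists M => x; rewrite normrN.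
have [s s0 sP] := half P _ Nfc NBf e0.
exists (Num.min r s); first by rewrite lt_min r0.
move=> Q; rewrite lt_min => /andP[/rP + /sP].
rewrite !meanN//; last by exact: continuous_borel_fun.
  by rewrite ltr_norml; lra.
exact: continuous_borel_fun.
Qed.

Lemma kr_eq0 P Q : kr P Q = 0 -> P = Q.
Proof.
move=> PQ; apply: (borel_prob_mean_eq md) => m f m0 lf.
have := kr_lip P Q m0 lf; rewrite PQ mulr0 normr_le0 subr_eq0.
by move/eqP.
Qed.

End kantorovich.

(* McShane extension: [z |-> sup_a (f (u2 a) - trunc d1 (u1 a) z)] dominates
   [f \o u2] along [u1] and is at most [f \o v2 + t] along [v1]. *)
Lemma le_kr_push (R : realType) (A B E1 E2 : topologicalType)
    (d1 : E1 -> E1 -> R) (d2 : E2 -> E2 -> R)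
    (u1 : A -> E1) (u2 : A -> E2) (v1 : B -> E1) (v2 : B -> E2)
    (cu1 : continuous u1) (cu2 : continuous u2)
    (cv1 : continuous v1) (cv2 : continuous v2)
    (P : borel_prob R A) (Q : borel_prob R B) (t : R) :
  metrizes d1 -> metrizes d2 -> 0 <= t ->
  (forall a b, d2 (u2 a) (v2 b) <= d1 (u1 a) (v1 b) + t) ->
  kr d2 (bp_push cu2 P) (bp_push cv2 Q) <=
  kr d1 (bp_push cu1 P) (bp_push cv1 Q) + t.
Proof.
move=> md1 md2 t0 d12; apply: kr_le => // f lf.
have bf := lip_borel_fun md2 lf; have Bf := lip_bounded ler01 lf.
have [a0 _] := bp_nonempty P; have [M fM] := Bf.
have Mg a : - M <= - f (u2 a) by have := fM (u2 a); rewrite ler_norml; lra.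
pose F := infconv d1 u1 (fun a => - f (u2 a)) 1.
have lF : lip d1 1 F by exact: (infconv_lip md1 a0 u1 Mg ler01).
have bF := lip_borel_fun md1 lF; have BF := lip_bounded ler01 lF.
have Fu a : f (u2 a) <= - F (u1 a).
  have := infconv_le md1 u1 Mg ler01 a (u1 a).
  by rewrite (trunc_xx md1) mulr0 addr0 -/F; lra.
have Fv b : - F (v1 b) <= f (v2 b) + t.
  suff : - f (v2 b) - t <= F (v1 b) by lra.
  apply: (le_infconv (d := d1) a0) => a.
  (* Truncating both distances at 1 preserves the bound [d2 <= d1 + t] because [0 <= t]. *)
  have := lf (u2 a) (v2 b); rewrite !mul1r /trunc.
  have := d12 a b => /[swap]; have [?|?] := leP (d2 (u2 a) (v2 b)) 1.
    by have [?|?] := leP (d1 (u1 a) (v1 b)) 1; lra.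
  by have [?|?] := leP (d1 (u1 a) (v1 b)) 1; lra.
have := kr_ub md1 (bp_push cu1 P) (bp_push cv1 Q) (lipN md1 lF).
have bNF : borel_fun (fun x => - F x) by exact: (lip_borel_fun md1 (lipN md1 lF)).
have BNF : bounded_real (fun x => - F x).
  exact: (lip_bounded ler01 (lipN md1 lF)).
have comp_bounded S1 S2 (g : S2 -> R) (h : S1 -> S2) :
    bounded_real g -> bounded_real (g \o h).
  by move=> [K gK]; exists K => x; exact: gK.
rewrite !mean_push//.
have H1 : mean P (f \o u2) <= mean P ((fun x => - F x) \o u1).
  apply: le_mean => //; try exact: comp_bounded.
    by apply: borel_fun_comp => //; exact: continuous_borel_fun.
  by apply: borel_fun_comp => //; exact: continuous_borel_fun.
have H2 : mean Q ((fun x => - F x) \o v1) <= mean Q (f \o v2) + t.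
  rewrite -[X in _ + X](mean_cst Q) -meanD.
  - apply: le_mean => //.
    + by apply: borel_fun_comp => //; exact: continuous_borel_fun.
    + exact: comp_bounded.
    + apply: borel_funD; last exact: borel_fun_cst.
      by apply: borel_fun_comp => //; exact: continuous_borel_fun.
    + by apply: bounded_realD; [exact: comp_bounded|exact: bounded_real_cst].
  - by apply: borel_fun_comp => //; exact: continuous_borel_fun.
  - exact: comp_bounded.
  - exact: borel_fun_cst.
  - exact: bounded_real_cst.
lra.
Qed.

(** Both images are integrals over the same [P]: for [f] in [lip d 1], the functions [f \o u] and
    [f \o v] differ by at most [e] off [N] and by at most 1 on [N]. *)
Lemma kr_map_le (R : realType) (S T : topologicalType) (d : T -> T -> R)
    (u v : S -> T) (bu : borel_fun u) (bv : borel_fun v) (P : borel_prob R S)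
    (e : R) (N : set S) : metrizes d -> 0 <= e -> borel N ->
  (forall x, ~ N x -> d (u x) (v x) <= e) ->
  kr d (bp_map bu P) (bp_map bv P) <= e + prob P N.
Proof.
move=> md e0 bN Ne; apply: kr_le => // f lf.
have bf := lip_borel_fun md lf; have [M fM] := lip_bounded ler01 lf.
have Bf : bounded_real f by exists M.
have bfu : borel_fun (f \o u) by exact: borel_fun_comp.
have bfv : borel_fun (f \o v) by exact: borel_fun_comp.
have Bfu : bounded_real (f \o u) by exists M => x; exact: fM.
have Bfv : bounded_real (f \o v) by exists M => x; exact: fM.
rewrite !mean_map// -meanB// -[prob P N]mul1r; apply: mean_le_prob => //.
- exact: borel_funB.
- exact: bounded_realB.
- move=> x /Ne xe; have := lf (u x) (v x); have := trunc_le d (u x) (v x).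
  by rewrite /=; lra.
- by move=> x _; have := lip_osc (u x) (v x) ler01 lf; rewrite /=; lra.
Qed.

(** * The weak topology *)

Section weak_topology.
Variables (R : realType) (T : topologicalType).
Implicit Types P Q : borel_prob R T.

Lemma nbhs_mean P (f : T -> R) (e : R) : continuous f -> bounded_real f -> 0 < e ->
  nbhs P [set Q | `|mean Q f - mean P f| < e].
Proof.
move=> fc Bf e0; pose g := BoundedContinuous fc Bf.
pose v : borel_prob R T -> {ptws bounded_continuous R T -> R} := @bp_integral R T.
have cg : continuous (@proj _ (fun=> R) g \o v).
  move=> Q; apply: (@continuous_comp _ _ _ v).
    exact: (@initial_continuous _ _ v).
  exact: proj_continuous.
have /cvgrPdist_lt/(_ e e0) := cg P.
apply: (@filterS _ _ (nbhs_filter P)) => Q /=.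
by rewrite distrC.
Qed.

Lemma cvg_mean P (F : set_system (borel_prob R T)) : Filter F ->
  (forall f e, continuous f -> bounded_real f -> 0 < e ->
     F [set Q | `|mean Q f - mean P f| < e]) -> F --> P.
Proof.
move=> FF Ff.
pose w : borel_prob R T -> {ptws bounded_continuous R T -> R} := @bp_integral R T.
suff H : (w @ F) --> w P.
  move=> A [B [[C oC CB] BP BA]]; apply: filterS BA _.
  have := H C; rewrite -CB; apply; apply: open_nbhs_nbhs; split => //.
  by move: BP; rewrite -CB.
have FF' : Filter (w @ F) by exact: fmap_filter.
apply/cvg_sup => g A [_ [[B oB <-] /= Bx]] /filterS; apply.
have : nbhs (mean P g) B by apply: open_nbhs_nbhs; split.
move=> /nbhs_ballP[e /= e0 eB]; change (F [set Q | B (mean Q g)]).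
apply: filterS (Ff g e (@bc_continuous _ _ g) (bc_bounded g) e0) => Q /= Qe.
by apply: eB; rewrite /ball/= distrC.
Qed.

(** The sets with this property form a filter, which converges to [P] by [cvg_mean] and therefore
    contains every neighbourhood of [P]. *)
Lemma nbhs_mean_basis P (A : set (borel_prob R T)) : nbhs P A ->
  exists (gs : seq (bounded_continuous R T)) (e : R), 0 < e /\
    forall Q, (forall g, g \in gs -> `|mean Q g - mean P g| < e) -> A Q.
Proof.
pose F : set_system (borel_prob R T) := [set A : set (borel_prob R T) |
  exists (gs : seq (bounded_continuous R T)) (e : R), 0 < e /\
    forall Q, (forall g, g \in gs -> `|mean Q g - mean P g| < e) -> A Q].
have FF : Filter F.
  split.
  - by exists [::], 1; split.
  - move=> B C [gs [e [e0 H]]] [hs [r [r0 K]]].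
    exists (gs ++ hs), (Num.min e r); split; first by rewrite lt_min e0.
    move=> Q HQ; split.
      apply: H => g ggs; have := HQ g; rewrite mem_cat ggs/= => /(_ isT).
      by rewrite lt_min => /andP[].
    apply: K => g ghs; have := HQ g; rewrite mem_cat ghs orbT => /(_ isT).
    by rewrite lt_min => /andP[].
  - move=> B C BC [gs [e [e0 H]]]; exists gs, e; split => // Q /H.
    exact: BC.
suff : F --> P by apply.
apply: cvg_mean => f e fc Bf e0; exists [:: BoundedContinuous fc Bf], e.
by split => // Q /(_ _ (mem_head _ _)).
Qed.

Section metric.
Variable d : T -> T -> R.
Hypothesis md : metrizes d.

(** The open-set half of the portmanteau theorem: some Lipschitz function below the indicator of [U]
    already has mean above [c], and its mean depends continuously on the measure. *)
Lemma nbhs_prob_gt P (U : set T) (c : R) : open U -> c < prob P U ->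
  nbhs P [set Q | c < prob Q U].
Proof.
move=> oU; have bU := borel_open oU; rewrite -(mean_indic P bU) => cU.
have [||| m [f [m0 lf fU cf]]] := lsc_approx md _ _ _ cU.
- exact: borel_fun_indic.
- exact: bounded_real_indic.
- exact: indic_lsc.
have e0 : 0 < mean P f - c by rewrite subr_gt0.
have Bf := lip_bounded (ltW m0) lf.
have := nbhs_mean P (lip_continuous md lf) Bf e0.
apply: (@filterS _ _ (nbhs_filter P)) => Q /=; rewrite ltr_norml => Qf.
apply: (@lt_le_trans _ _ (mean Q f)); first lra.
rewrite -(mean_indic Q bU); apply: le_mean => //.
- exact: lip_borel_fun lf.
- exact: borel_fun_indic.
- exact: bounded_real_indic.
Qed.

Lemma nbhs_kr P (A : set (borel_prob R T)) : nbhs P A ->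
  exists2 r, 0 < r & [set Q | kr d P Q < r] `<=` A.
Proof.
pose F : set_system (borel_prob R T) := [set A : set (borel_prob R T) |
  exists2 r : R, 0 < r & [set Q | kr d P Q < r] `<=` A].
have FF : Filter F.
  split.
  - by exists 1.
  - move=> B C [e e0 H] [r r0 K]; exists (Num.min e r); first by rewrite lt_min e0.
    by move=> Q /=; rewrite lt_min => /andP[/H ? /K].
  - by move=> B C BC [e e0 H]; exists e => // Q /H; exact: BC.
suff : F --> P by apply.
apply: cvg_mean => f e fc Bf e0; have [r r0 rP] := kr_mean md P fc Bf e0.
by exists r.
Qed.

End metric.
End weak_topology.

(** * Separably carried probabilities *)

Definition sep_carried (R : realType) (T : topologicalType) (P : borel_prob R T) :=
  exists u : nat -> T, prob P (closure (range u)) = 1.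

Section distance_to_a_closed_set.
Variables (R : realType) (T : topologicalType) (d : T -> T -> R).
Hypothesis md : metrizes d.
Variable C : set T.
Hypothesis cC : closed C.

(** The penalty 1 off [C] makes this the truncated distance to [C], and the constant 1 when [C] is
    empty. *)
Definition set_dist : T -> R := infconv d id (\1_(~` C)) 1.

Let ge0C (x : T) : 0 <= \1_(~` C) x :> R. Proof. by rewrite indicE. Qed.

Lemma set_dist_lip : lip d 1 set_dist.
Proof.
move=> x; exact: (infconv_lip md x id ge0C ler01).
Qed.

Lemma set_dist_ge0 x : 0 <= set_dist x.
Proof.
apply: (le_infconv (d := d) x) => y.
by rewrite addr_ge0// mulr_ge0// trunc_ge0.
Qed.

Lemma set_dist_le1 x : set_dist x <= 1.
Proof.
have := infconv_le md id ge0C ler01 x x; rewrite (trunc_xx md) mulr0 addr0.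
by move/le_trans; apply; rewrite indicE; case: (_ \in _).
Qed.

Lemma set_dist_le x y : C y -> set_dist x <= d x y.
Proof.
move=> Cy; have := infconv_le md id ge0C ler01 y x.
rewrite indicE in_setC mem_set//= add0r mul1r (trunc_sym md) => /le_trans.
by apply; exact: trunc_le.
Qed.

Lemma set_dist0 x : C x -> set_dist x = 0.
Proof.
move=> Cx; apply/eqP; rewrite eq_le set_dist_ge0 andbT.
by rewrite -(metrizes_xx md x) set_dist_le.
Qed.

Lemma set_dist_gt0 x : ~ C x -> 0 < set_dist x.
Proof.
move=> Cx; have /(metrizes_nbhsP md)[e e0 eC] : nbhs x (~` C).
  by apply: open_nbhs_nbhs; split => //; rewrite openC.
have m0 : 0 < Num.min e 1 by rewrite lt_min e0/=.
apply: (lt_le_trans m0); apply: (le_infconv (d := d) x) => y.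
rewrite mul1r indicE; have [yC|yC] := boolP (y \in ~` C).
  by rewrite (@le_trans _ _ 1)// ?ge_min ?lexx ?orbT// lerDl trunc_ge0.
rewrite add0r (trunc_sym md) /trunc le_min !ge_min lexx orbT andbT.
rewrite leNgt; apply/orP; left; apply/negP => xy.
by rewrite notin_setE in yC; apply: yC; exact: eC.
Qed.

(** Turns full mass on a closed set into the vanishing of the mean of a Lipschitz function, a
    condition that passes to limits. *)
Lemma prob1P (P : borel_prob R T) : prob P C = 1 <-> mean P set_dist = 0.
Proof.
have bC := borel_closed cC; have bD := lip_borel_fun md set_dist_lip.
have BD := lip_bounded ler01 set_dist_lip.
split=> [P1|P0].
  apply/eqP; rewrite eq_le mean_ge0 ?andbT; last exact: set_dist_ge0.
  have : mean P set_dist <= 0 + 1 * prob P (~` C).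
    apply: mean_le_prob => //; first exact: borelC.
      by move=> x; rewrite /setC/= => /contrapT Cx; rewrite set_dist0.
    by move=> x _; rewrite add0r set_dist_le1.
  by rewrite probC// P1 subrr mulr0 addr0.
(* These level sets exhaust the complement of [C], and each is null by Markov's inequality. *)
pose A n := [set x | n.+1%:R^-1 < set_dist x].
have oA n : open (A n).
  have /continuousP := lip_continuous md set_dist_lip.
  by move=> /(_ _ (@open_gt R n.+1%:R^-1)).
suff : prob P (~` C) = 0 by rewrite probC//; lra.
have -> : ~` C = \bigcup_n A n.
  apply/seteqP; split=> [x Cx|x [n _ An] Cx]; last first.
    by move: An; rewrite /A/= set_dist0// ltNge invr_ge0 ler0n.
  have := set_dist_gt0 Cx => /ltr_add_invr[n]; rewrite add0r => nx.
  by exists n.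
apply: prob_bigcup0 => n; first exact: borel_open.
apply/eqP; rewrite eq_le prob_ge0 andbT.
have bA := borel_open (oA n).
have : mean P (fun x => n.+1%:R^-1 * \1_(A n) x) <= mean P set_dist.
  apply: le_mean => //.
  - by apply: borel_funZ; exact: borel_fun_indic.
  - by apply: bounded_realZ; exact: bounded_real_indic.
  - move=> x; rewrite indicE; case: (boolP (x \in A n)) => [|_].
      by rewrite inE mulr1 => /ltW.
    by rewrite mulr0 set_dist_ge0.
rewrite P0 meanZ; [|exact: borel_fun_indic|exact: bounded_real_indic].
by rewrite mean_indic// pmulr_rle0// invr_gt0.
Qed.

End distance_to_a_closed_set.

Section separably_carried.
Variables (R : realType) (T : topologicalType) (d : T -> T -> R).
Hypothesis md : metrizes d.
Implicit Types P Q : borel_prob R T.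

Definition ball_union (u : nat -> T) (e : R) (n : nat) : set T :=
  [set x | exists2 i, (i < n)%N & d (u i) x < e].

Lemma ball_union_open u e n : open (ball_union u e n).
Proof.
have -> : ball_union u e n = \bigcup_(i in `I_n) [set x | d (u i) x < e].
  by apply/seteqP; split => x [i]; exists i.
by apply: bigcup_open => i _; exact: metrizes_open_ball.
Qed.

(** The balls of radius [e] around all the [u i] cover the closure of the range, so by continuity
    from below finitely many carry mass above [c]. This plays the part of tightness. *)
Lemma sep_carried_ball_union P u e c : prob P (closure (range u)) = 1 ->
  0 < e -> c < 1 -> exists n, c < prob P (ball_union u e n).
Proof.
move=> P1 e0 c1.
have bF n : borel (ball_union u e n) by apply: borel_open; exact: ball_union_open.
have cv : prob P (ball_union u e n) @[n --> \oo] --> prob P (\bigcup_n ball_union u e n).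
  apply: prob_cvg => // n x [i /ltnW ? ?]; exists i => //.
have cP : c < prob P (\bigcup_n ball_union u e n).
  rewrite (lt_le_trans c1)// -P1; apply: le_prob.
  - by apply: borel_closed; exact: closed_closure.
  - exact: borel_bigcup.
  - move=> x /(closureP_metrizes md)/(_ e e0)[_ [i _ <-] xi].
    by exists i.+1 => //; exists i => //; rewrite (metrizes_sym md).
by have [n _ /(_ n (leqnn n)) /= cn] := cvgr_gt _ cv _ cP; exists n.
Qed.

Lemma borel_fun_countable (S : topologicalType) (G : S -> nat) (c : nat -> T) :
  (forall n, borel (G @^-1` [set n])) -> borel_fun (c \o G).
Proof.
move=> bG A _.
have -> : (c \o G) @^-1` A =
    \bigcup_n (if n \in c @^-1` A then G @^-1` [set n] else set0).
  apply/seteqP; split=> [x Ax|x [n _]].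
    by exists (G x) => //; rewrite mem_set.
  by case: ifPn => //; rewrite inE => cn /= ->.
by apply: borel_bigcup => n; case: ifP => _ //; exact: borel0.
Qed.

Lemma sep_carried_countable (S : topologicalType) (G : S -> nat) (c : nat -> T)
  (b : borel_fun (c \o G)) (P : borel_prob R S) : sep_carried (bp_map b P).
Proof.
exists c; rewrite prob_map; last by apply: borel_closed; exact: closed_closure.
rewrite (_ : _ @^-1` _ = setT) ?probT//; apply/seteqP; split => // x _.
by apply: subset_closure; exists (G x).
Qed.

Lemma sep_carried_map (S : topologicalType) (f : T -> S) (fc : continuous f) P :
  sep_carried P -> sep_carried (bp_push fc P).
Proof.
move=> [u u1]; exists (f \o u).
have bC (V : topologicalType) (v : nat -> V) : borel (closure (range v)).
  by apply: borel_closed; exact: closed_closure.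
apply/eqP; rewrite eq_le prob_le1//= prob_push// -u1; apply: le_prob => //.
  by apply: borel_fun_preimage; [exact: continuous_borel_fun|exact: bC].
move=> x ux A fxA.
have [_ [[n _ <-] An]] := ux _ (fc _ _ fxA).
by exists (f (u n)); split => //; exists n.
Qed.

(* [w i = v i.+1 - v i] is a partition of unity subordinate to the balls of
   radius [2 * e] around the [u i], with sum 1 on [ball_union u e n]. *)
Lemma sep_carried_nbhs_kr P e : sep_carried P -> 0 < e ->
  nbhs P [set Q | kr d P Q < e].
Proof.
move=> [u u1] e0; pose r := e / 10.
have r0 : 0 < r by rewrite divr_gt0.
have [N Nr] := sep_carried_ball_union (c := 1 - r) u1 r0 ltac:(lra).
have cd y : continuous (fun x => d y x : R).
  move=> x; apply/cvgrPdist_lt => k k0; apply/(metrizes_nbhsP md).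
  exists k => // z /= xz; have := metrizes_triangle md x y z.
  have := metrizes_triangle md z y x; rewrite (metrizes_sym md z x).
  by rewrite ltr_norml; lra.
(* A continuous bump, equal to 1 within [r] of [u i] and to 0 beyond [2 * r]; [v] is the running
   maximum of these bumps. *)
pose chi i x : R := Num.max 0 (Num.min 1 (2 - d (u i) x / r)).
have cchi i : continuous (chi i).
  move=> x; apply: (@continuous_max R T (fun=> 0)); first exact: cvg_cst.
  apply: (@continuous_min R T (fun=> 1)); first exact: cvg_cst.
  apply: cvgB; first exact: cvg_cst.
  by apply: cvgM; [exact: cd|exact: cvg_cst].
have chi01 i x : 0 <= chi i x <= 1.
  by rewrite /chi le_max lexx/= ge_max ler01/= ge_min lexx.
have chi1 i x : d (u i) x < r -> chi i x = 1.
  move=> ux; have : d (u i) x / r < 1 by rewrite ltr_pdivrMr// mul1r.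
  by rewrite /chi => ?; rewrite min_l ?max_r//; lra.
have chi0 i x : 2 * r <= d (u i) x -> chi i x = 0.
  move=> ux; have : 2 <= d (u i) x / r by rewrite ler_pdivlMr.
  rewrite /chi => ?; apply/max_idPl; rewrite ge_min; apply/orP; right; lra.
pose v := fix v n x : R := if n is k.+1 then Num.max (v k x) (chi k x) else 0.
have v01 n x : 0 <= v n x <= 1.
  elim: n => [|n /andP[v0 v1]]/=; first by rewrite lexx ler01.
  have /andP[c0 c1] := chi01 n x.
  by rewrite le_max v0/= ge_max v1.
have cv n : continuous (v n).
  elim: n => [|n vn] x; first exact: cvg_cst.
  by apply: (@continuous_max R T (v n) (chi n)); [exact: vn|exact: cchi].
have v1 x : ball_union u r N x -> v N x = 1.
  move=> [i]; elim: N {Nr} => [//|n IH]; rewrite ltnS leq_eqVlt => /predU1P[->|ni] ux.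
    by rewrite /= (chi1 _ _ ux); apply/max_idPr; have /andP[] := v01 n x.
  by rewrite /= IH//; apply/max_idPl; have /andP[] := chi01 n x.
pose w n x := v n.+1 x - v n x.
have cw n : continuous (w n) by move=> x; apply: cvgB; exact: cv.
have w0 n x : 0 <= w n x by rewrite /w/= subr_ge0 le_max lexx.
have wchi n x : 2 * r <= d (u n) x -> w n x = 0.
  move=> /chi0 c0; rewrite /w/= c0 max_l ?subrr//.
  by have /andP[] := v01 n x.
have Bw n : bounded_real (w n).
  exists 1 => x; have := v01 n x; have := v01 n.+1 x; rewrite /w ler_norml; lra.
have Bv n : bounded_real (v n) by apply: bounded_real01 => x; exact: v01.
have bv n : borel_fun (v n) by apply: continuous_borel_fun; exact: cv.
have bw n : borel_fun (w n) by apply: continuous_borel_fun; exact: cw.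
(* The [N] errors of size [s] add up to at most [r]; the successor keeps the denominator nonzero
   when [N] is 0. *)
pose s := r / N.+1%:R.
have s0 : 0 < s by rewrite divr_gt0.
have : nbhs P [set Q | forall i, (i < N)%N -> `|mean Q (w i) - mean P (w i)| < s].
  elim: (N) => [|n IH]; first exact: filterE.
  apply: filterS (filterI IH (nbhs_mean P (cw n) (Bw n) s0)) => Q [/= Qn wn] i.
  by rewrite ltnS leq_eqVlt => /predU1P[->//|]; exact: Qn.
apply: filterS => Q Qw /=.
have Ns : N%:R * s <= r.
  rewrite /s mulrCA ler_piMr ?ltW//.
  by rewrite ltr_pdivrMr// mul1r ltr_nat.
have Qv : `|mean Q (v N) - mean P (v N)| <= N%:R * s.
  elim: (N) Qw => [_|n IH Qw]; first by rewrite !mean_cst subrr normr0 mul0r.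
  have vE S : mean S (v n.+1) = mean S (v n) + mean S (w n).
    by rewrite -meanD//; congr mean; apply/funext => x; rewrite /w; lra.
  have := IH (fun i ni => Qw i (ltnW ni)); have := Qw n (leqnn _).
  by rewrite !vE -natr1 mulrDl mul1r ler_norml ltr_norml ler_norml; lra.
have Pv : 1 - r < mean P (v N).
  have bU := borel_open (ball_union_open u r N).
  rewrite (lt_le_trans Nr)// -mean_indic//; apply: le_mean => //.
  - exact: borel_fun_indic.
  - exact: bounded_real_indic.
  - move=> x; rewrite indicE; have [/set_mem/v1->//|_] := boolP (_ \in _).
    by have /andP[] := v01 N x.
(* Replacing a test function by [sm N] below costs at most [3 * r] under [P] and [4 * r] under [Q];
   comparing the means of [sm N] costs [r]. *)
suff H : kr d P Q <= 8 * r by rewrite /= (le_lt_trans H)//; rewrite /r; lra.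
apply: kr_le => // f lf.
have bf := lip_borel_fun md lf; have Bf := lip_bounded ler01 lf.
have [x0 _] := bp_nonempty P.
(* Subtracting a constant leaves differences of means unchanged and makes [h] bounded by 1, so the
   coefficients [h (u n)] amplify no error. *)
pose h x := f x - f x0.
have lh : lip d 1 h by move=> x y; rewrite /h; have := lf x y; lra.
have bh := lip_borel_fun md lh; have Bh := lip_bounded ler01 lh.
have hE S : mean S h = mean S f - f x0.
  by rewrite meanB// ?mean_cst//; [exact: borel_fun_cst|exact: bounded_real_cst].
have h1 x : -1 <= h x <= 1.
  have := lip_osc x x0 ler01 lf; have := lip_osc x0 x ler01 lf; rewrite /h; lra.
(* Only the coefficients depend on [f]: control of the finitely many means of the [w k] serves all
   Lipschitz [f] at once. *)
pose sm := fix sm n x : R := if n is k.+1 then sm k x + h (u k) * w k x else 0.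
have csm n : borel_fun (sm n) /\ bounded_real (sm n).
  elim: n => [|n [cn Bn]]; first by split; [exact: borel_fun_cst|exact: bounded_real_cst].
  by split; [apply: borel_funD => //; exact: borel_funZ|
             apply: bounded_realD => //; exact: bounded_realZ].
have hv n x : `|h x * v n x - sm n x| <= 2 * r * v n x.
  elim: n => [|n IH]; first by rewrite /= !mulr0 subrr normr0.
  have -> : v n.+1 x = v n x + w n x by rewrite /w; lra.
  rewrite [sm _ _]/=.
  suff : `|(h x - h (u n)) * w n x| <= 2 * r * w n x.
    by move: IH; rewrite !ler_norml; lra.
  rewrite normrM (ger0_norm (w0 n x)).
  have [ux|/wchi->] := ltP (d (u n) x) (2 * r); last by rewrite !mulr0.
  rewrite ler_wpM2r//; have := lh x (u n); have := lh (u n) x.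
  have := trunc_le d x (u n); have := trunc_le d (u n) x.
  by rewrite (metrizes_sym md x) ler_norml; lra.
have hs x : `|h x - sm N x| <= 2 * r + (1 - v N x).
  have := hv N x; have := h1 x; have := v01 N x.
  rewrite !ler_norml => /andP[? ?] /andP[? ?] /andP[? ?].
  by apply/andP; split; nra.
have [bsm Bsm] := csm N.
have Qs : `|mean Q (sm N) - mean P (sm N)| <= N%:R * s.
  elim: (N) Qw => [_|n IH Qw]; first by rewrite !mean_cst subrr normr0 mul0r.
  have [bn Bn] := csm n.
  have sE S : mean S (sm n.+1) = mean S (sm n) + h (u n) * mean S (w n).
    by rewrite -meanZ// -meanD//; [exact: borel_funZ|exact: bounded_realZ].
  have := IH (fun i ni => Qw i (ltnW ni)); have := Qw n (leqnn _).
  rewrite !sE -[n.+1%:R]natr1 [(_ + 1) * s]mulrDl mul1r.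
  set a := mean Q (w n) - mean P (w n).
  move=> /ltW as_ IHn.
  rewrite (_ : _ - _ = mean Q (sm n) - mean P (sm n) + h (u n) * a); last first.
    by rewrite /a; lra.
  rewrite (le_trans (ler_normD _ _))// lerD// normrM.
  rewrite (le_trans _ as_)// ler_piMl//.
  by have := h1 (u n); rewrite ler_norml.
have hms S : `|mean S h - mean S (sm N)| <= 2 * r + (1 - mean S (v N)).
  have bc k : borel_fun (fun _ : T => k : R) by exact: borel_fun_cst.
  have Bc k : bounded_real (fun _ : T => k : R) by exact: bounded_real_cst.
  have E : mean S (fun x => (2 * r + 1) - v N x) = 2 * r + (1 - mean S (v N)).
    by rewrite meanB// mean_cst; lra.
  rewrite -E; apply: ler_dist_mean => //.
  - exact: borel_funB.
  - exact: bounded_realB.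
  - by move=> x; have := hs x; lra.
have := hms P; have := hms Q; rewrite !hE; move: Qv Qs.
by rewrite !ler_norml; lra.
Qed.

End separably_carried.

(** * Embeddings, isometries and metrization by the Kantorovich distance *)

Section embeddings.
Variables (R : realType) (S T : topologicalType).

Lemma topological_embedding_isometry (dS : S -> S -> R) (dT : T -> T -> R)
    (f : S -> T) : metrizes dS -> metrizes dT ->
  (forall x y, dT (f x) (f y) = dS x y) -> topological_embedding f.
Proof.
move=> mS mT fd; split.
- move=> x y fxy; apply: (metrizes_eq0 mS).
  by rewrite -fd fxy (metrizes_xx mT).
- move=> x A /(metrizes_nbhsP mT)[e e0 eA]; apply/(metrizes_nbhsP mS).
  by exists e => // y xy; apply: eA; rewrite /= fd.
- move=> A oA.
  (* The union of the balls around image points whose counterparts in [S] are contained in [A]. *)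
  exists (\bigcup_(p in [set p : S * R | [set y | dS p.1 y < p.2] `<=` A])
     [set z | dT (f p.1) z < p.2]).
    by apply: bigcup_open => p _; exact: metrizes_open_ball.
  apply/seteqP; split=> [_ [x Ax <-]|z [[[x e] /= xeA xz] [y _ yz]]].
    split; last by exists x.
    have /(metrizes_nbhsP mS)[e e0 eA] : nbhs x A by exact: open_nbhs_nbhs.
    by exists (x, e) => //=; rewrite (metrizes_xx mT).
  by move: xz; rewrite -yz fd => xy; exists y => //; exact: xeA.
Qed.

Lemma metrizes_embedding (d : T -> T -> R) (f : S -> T) : metrizes d ->
  topological_embedding f -> metrizes (fun x y => d (f x) (f y)).
Proof.
move=> md [finj fc fo]; split.
- by move=> x; exact: metrizes_xx.
- by move=> x y /(metrizes_eq0 md)/finj.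
- by move=> x y; exact: metrizes_sym.
- by move=> x y z; exact: metrizes_triangle.
move=> x A; split=> [|[e e0 eA]]; last first.
  apply: filterS eA _; exact: fc _ _ (metrizes_nbhs_ball md (f x) e0).
rewrite nbhsE => -[A' [oA' Ax] A'A]; have [B oB BE] := fo _ oA'.
have /(metrizes_nbhsP md)[e e0 eB] : nbhs (f x) B.
  apply: open_nbhs_nbhs; split => //.
  by have [] : (B `&` range f) (f x) by rewrite -BE; exists x.
exists e => // y xy; apply: A'A.
have [z Az /finj <-//] : (f @` A') (f y).
by rewrite BE; split; [exact: eB|exists y].
Qed.

End embeddings.

Lemma continuous_id (T : topologicalType) : continuous (@id T).
Proof. by move=> x A. Qed.

(** Two uses of [le_kr_push] with [t = 0], comparing [f] with the identity in either direction. *)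
Lemma kr_push_isometry (R : realType) (S T : topologicalType)
    (dS : S -> S -> R) (dT : T -> T -> R) (f : S -> T) (fc : continuous f)
    (P Q : borel_prob R S) : metrizes dS -> metrizes dT ->
  (forall x y, dT (f x) (f y) = dS x y) ->
  kr dT (bp_push fc P) (bp_push fc Q) = kr dS P Q.
Proof.
move=> mS mT fd; have cid := @continuous_id S.
have idE (P' : borel_prob R S) : bp_push cid P' = P' by exact: bp_push_id.
have le1 x y : dT (f x) (f y) <= dS (id x) (id y) + 0 by rewrite fd addr0.
have le2 x y : dS (id x) (id y) <= dT (f x) (f y) + 0 by rewrite fd addr0.
have := le_kr_push cid fc cid fc P Q mS mT (lexx 0) le1.
have := le_kr_push fc cid fc cid P Q mT mS (lexx 0) le2.
by rewrite !idE !addr0 => ? ?; apply/le_anti/andP.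
Qed.

Section subspaces_of_probabilities.
Variables (R : realType) (T V : topologicalType) (d : T -> T -> R).
Variable i : V -> borel_prob R T.

(** The space [V] is kept abstract to cover both [sep_prob] and, with [i] the identity, the whole of
    [borel_prob]. One inclusion of topologies is [nbhs_kr], the other [sep_carried_nbhs_kr]. *)
Lemma metrizes_kr : metrizes d -> injective i -> continuous i ->
  (forall v A, nbhs v A -> exists2 B, nbhs (i v) B & i @^-1` B `<=` A) ->
  (forall v, sep_carried (i v)) -> metrizes (fun v w => kr d (i v) (i w)).
Proof.
move=> md iinj ic ni si; split.
- by move=> v; exact: kr_xx.
- by move=> v w /(kr_eq0 md)/iinj.
- by move=> v w; exact: kr_sym.
- by move=> v w z; exact: kr_triangle.
move=> v A; split=> [/ni[B Bv BA]|[e e0 eA]].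
  by have [r r0 rB] := nbhs_kr md Bv; exists r => // w /rB/BA.
by apply: filterS eA _; exact: ic _ _ (sep_carried_nbhs_kr md (si v) e0).
Qed.

End subspaces_of_probabilities.

(** * The space of separably carried probabilities *)

Record sep_prob (R : realType) (T : topologicalType) := SepProb {
  sep_prob_val :> borel_prob R T;
  sep_probP : sep_carried sep_prob_val }.

HB.instance Definition _ R T := gen_eqMixin (sep_prob R T).
HB.instance Definition _ R T := gen_choiceMixin (sep_prob R T).
HB.instance Definition _ (R : realType) (T : topologicalType) :=
  Topological.copy (sep_prob R T)
    (initial_topology (@sep_prob_val R T : sep_prob R T -> borel_prob R T)).

Section sep_prob_topology.
Variables (R : realType) (T : topologicalType).

Lemma sep_prob_val_inj : injective (@sep_prob_val R T).
Proof.
move=> [P sP] [Q sQ] /= PQ; move: sQ; rewrite -PQ => sQ.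
by rewrite (Prop_irrelevance sP sQ).
Qed.

Lemma sep_prob_val_continuous : continuous (@sep_prob_val R T).
Proof. exact: (@initial_continuous _ _ (@sep_prob_val R T)). Qed.

Lemma sep_prob_nbhs (P : sep_prob R T) (A : set (sep_prob R T)) :
  nbhs P A -> exists2 B, nbhs (sep_prob_val P) B & @sep_prob_val R T @^-1` B `<=` A.
Proof.
move=> [_ [[B oB <-] BP] BA]; exists B => //.
exact: open_nbhs_nbhs.
Qed.

Lemma sep_prob_cvg_mean (P_ : nat -> sep_prob R T) (P : sep_prob R T) :
  (forall f e, continuous f -> bounded_real f -> 0 < e ->
     exists N, forall n, (N <= n)%N -> `|mean (P_ n) f - mean P f| < e) ->
  P_ n @[n --> \oo] --> P.
Proof.
move=> Pf A /sep_prob_nbhs[B PB BA].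
suff H : sep_prob_val (P_ n) @[n --> \oo] --> sep_prob_val P.
  by have [N _ HN] := H _ PB; exists N => // n /HN; exact: BA.
by apply: cvg_mean => f e fc Bf e0; have [N HN] := Pf f e fc Bf e0; exists N.
Qed.

Lemma metrizes_sep_prob (d : T -> T -> R) : metrizes d ->
  metrizes (fun P Q : sep_prob R T => kr d P Q).
Proof.
move=> md; apply: metrizes_kr => //.
- exact: sep_prob_val_inj.
- exact: sep_prob_val_continuous.
- exact: sep_prob_nbhs.
- exact: sep_probP.
Qed.

Lemma metrizes_borel_prob (d : T -> T -> R) : metrizes d ->
  (forall P : borel_prob R T, sep_carried P) ->
  metrizes (kr d : borel_prob R T -> borel_prob R T -> R).
Proof.
move=> md sP; apply: (@metrizes_kr _ _ _ d id md) => //.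
- exact: continuous_id.
- by move=> v A vA; exists A.
Qed.

End sep_prob_topology.

Lemma sep_push_subproof (R : realType) (S T : topologicalType) (f : S -> T)
  (fc : continuous f) (P : sep_prob R S) : sep_carried (bp_push fc P).
Proof. by apply: sep_carried_map; exact: sep_probP. Qed.

Definition sep_push (R : realType) (S T : topologicalType) (f : S -> T)
  (fc : continuous f) (P : sep_prob R S) : sep_prob R T :=
  SepProb (sep_push_subproof fc P).

Lemma sep_push_continuous (R : realType) (S T : topologicalType) (f : S -> T)
  (fc : continuous f) : continuous (@sep_push R S T f fc).
Proof.
move=> P A /sep_prob_nbhs[B fB BA].
have := sep_prob_val_continuous (bp_push_continuous fB).
apply: (@filterS _ _ (nbhs_filter P)) => Q BQ.
exact: (BA (sep_push fc Q) BQ).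
Qed.

(** * When all probabilities are separably carried *)

Section every_probability_is_separably_carried.
Variables (R : realType) (T : topologicalType).
Implicit Types P Q : borel_prob R T.

Lemma separable_sep_carried P : separable T -> sep_carried P.
Proof.
move=> [D /countable_injP[f finj] dD].
have [x0 _] := bp_nonempty P.
pose u n := xget x0 [set x | D x /\ f x = n].
exists u; rewrite (_ : closure _ = setT) ?probT//.
apply/seteqP; split => // x _ A; rewrite nbhsE => -[B [oB Bx] BA].
have [y [By Dy]] : B `&` D !=set0 by apply: dD => //; exists x.
exists y; split; last exact: BA.
exists (f y) => //; rewrite /u; case: xgetP => [z _ [Dz fz]|/(_ y)]; last by case.
by apply: finj; rewrite ?inE.
Qed.

Lemma borel_closure_range (u : nat -> T) : borel (closure (range u)).
Proof. by apply: borel_closed; exact: closed_closure. Qed.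

(* Finitely many bounded continuous functions are nearly constant on the cells
   of a countable Borel partition; moving each cell to one of its points moves
   [P] little in the weak topology. *)
Lemma sep_carried_dense P (A : set (borel_prob R T)) : nbhs P A ->
  exists2 Q, A Q & sep_carried Q.
Proof.
move=> /nbhs_mean_basis[gs [e [e0 gsA]]].
have [x0 _] := bp_nonempty P.
(* The code of [x] records in which interval of length [e / 2] each function takes its value;
   pickling it numbers the countably many cells. *)
pose code (hs : seq (bounded_continuous R T)) x : seq int :=
  [seq Num.floor ((h : bounded_continuous R T) x / (e / 2)) | h <- hs].
pose G x := pickle (code gs x).
have bG n : borel (G @^-1` [set n]).
  suff bcode hs s : borel [set x | code hs x = s].
    have [sn|sn] := pselect (exists s : seq int, pickle s = n).
      case: sn => s sE.
      suff -> : G @^-1` [set n] = [set x | code gs x = s] by [].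
      apply/seteqP; split=> x; rewrite /G /= -sE; last by move=> ->.
      exact: (pcan_inj (@pickleK _)).
    rewrite (_ : _ @^-1` _ = set0); first exact: borel0.
    by apply/seteqP; split => // x /= Gx; apply: sn; exists (code gs x).
  elim: hs s => [|h hs IH] [|z s].
  - by rewrite (_ : [set _ | _] = setT); [exact: borelT|apply/seteqP].
  - by rewrite (_ : [set _ | _] = set0); [exact: borel0|apply/seteqP; split=> x /=].
  - by rewrite (_ : [set _ | _] = set0); [exact: borel0|apply/seteqP; split=> x /=].
  - have -> : [set x | code (h :: hs) x = z :: s] =
        (([set x | z%:~R * (e / 2) <= h x] `&`
        [set x | h x < (z + 1)%:~R * (e / 2)]) `&` [set x | code hs x = s]).
      apply/seteqP; split=> x /=.
        move=> [hz ->]; split => //; have := Num.Theory.floor_itv (h x / (e / 2)).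
        by rewrite hz ler_pdivlMr ?ltr_pdivrMr ?divr_gt0// => /andP[].
      move=> [[zh hz] ->]; congr cons; apply: Num.Theory.floor_def.
      by rewrite ler_pdivlMr ?ltr_pdivrMr ?divr_gt0// zh hz.
    apply: borelI => //; apply: borelI.
      apply: borel_closed.
      have /continuous_closedP := @bc_continuous _ _ h.
      by move=> /(_ _ (@closed_ge R (z%:~R * (e / 2)))).
    apply: borel_open; have /continuousP := @bc_continuous _ _ h.
    by move=> /(_ _ (@open_lt R ((z + 1)%:~R * (e / 2)))).
(* A representative of the cell [n]. The default [x0] is met only for empty cells, whose numbers are
   not of the form [G x]. *)
pose c n := xget x0 [set x | G x = n].
have Gc x : G (c (G x)) = G x.
  by rewrite /c; case: xgetP => [y _ //|/(_ x)]; case.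
have bc := @borel_fun_countable T T G c bG.
exists (bp_map bc P); last exact: sep_carried_countable.
apply: gsA => g ggs.
have bg : borel_fun g by apply: continuous_borel_fun; exact: bc_continuous.
have Bg : bounded_real g by exact: bc_bounded.
have bgc : borel_fun (g \o (c \o G)) by exact: borel_fun_comp.
have Bgc : bounded_real (g \o (c \o G)).
  by have [M gM] := Bg; exists M => x; exact: gM.
rewrite mean_map//.
suff : `|mean P (g \o (c \o G)) - mean P g| <= e / 2 by lra.
rewrite -(mean_cst P (e / 2)); apply: ler_dist_mean => //.
- exact: borel_fun_cst.
- exact: bounded_real_cst.
move=> x /=.
have : Num.floor (g (c (G x)) / (e / 2)) = Num.floor (g x / (e / 2)).
  have := Gc x; rewrite {1 3}/G => /(pcan_inj (@pickleK _)).
  move=> /eqP; rewrite /code => /eqP/eq_in_map; exact.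
have fl a : (Num.floor (a / (e / 2)))%:~R * (e / 2) <= a <
    (Num.floor (a / (e / 2)))%:~R * (e / 2) + e / 2.
  have := Num.Theory.floor_itv (a / (e / 2)).
  by rewrite intrD ler_pdivlMr ?ltr_pdivrMr ?divr_gt0// mulrDl mul1r.
have := fl (g x); have := fl (g (c (G x))) => + + fE; rewrite fE.
by move=> /andP[? ?] /andP[? ?]; rewrite ler_norml; lra.
Qed.

(** Metrizability turns the approximations of [sep_carried_dense] into a sequence [Q n] converging
    to [P]. The distance to the closure of one countable set carrying all [Q n] has mean 0 under
    each of them, hence under [P]. *)
Lemma metrizable_sep_carried P : metrizable R T ->
  metrizable R (borel_prob R T) -> sep_carried P.
Proof.
move=> [d md] [D mD].
have /choice[Q Q_] n : exists Q, D P Q < n.+1%:R^-1 /\ sep_carried Q.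
  have [|Q ? ?] := @sep_carried_dense P [set Q | D P Q < n.+1%:R^-1].
    by apply: (metrizes_nbhs_ball mD); rewrite invr_gt0.
  by exists Q.
have /choice[u u_] n := (Q_ n).2.
pose v k := let p := if unpickle k is Some p then p else (0, 0)%N in u p.1 p.2.
exists v.
have cC : closed (closure (range v)) by exact: closed_closure.
apply/(prob1P md cC).
set f := set_dist _ _.
have lf : lip d 1 f by exact: set_dist_lip.
have f0 n : mean (Q n) f = 0.
  apply/(prob1P md cC)/eqP; rewrite eq_le prob_le1/=; last exact: borel_closure_range.
  rewrite -(u_ n); apply: le_prob; try exact: borel_closure_range.
  by apply: closure_subset => _ [k _ <-]; exists (pickle (n, k)) => //; rewrite /v pickleK.
apply/eqP; rewrite -normr_eq0 eq_le normr_ge0 andbT; apply/ler_addgt0Pl => e e0.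
have := nbhs_mean P (lip_continuous md lf) (lip_bounded ler01 lf) e0.
move=> /(metrizes_nbhsP mD)[r /ltr_add_invr[n]]; rewrite add0r => nr.
move=> /(_ (Q n) (lt_trans (Q_ n).1 nr)) /=.
by rewrite f0 sub0r normrN addr0 => /ltW.
Qed.

End every_probability_is_separably_carried.

(** * Probabilities carried by the range of an embedding, and locally null sets *)

Section probabilities_carried_by_a_range.
Variables (R : realType) (S T : topologicalType) (d : T -> T -> R) (f : S -> T).
Hypotheses (md : metrizes d) (fe : topological_embedding f).
Hypothesis fc : continuous f.
Hypothesis bf : borel (range f).

(** [P] is the image of [Q] under a left inverse of [f] that is constant off the range; it is Borel
    because [f] is an embedding with Borel range. *)
Lemma prob_push_range (Q : borel_prob R T) : prob Q (range f) = 1 ->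
  exists P : borel_prob R S, bp_push fc P = Q.
Proof.
move=> Q1; have [finj _ fo] := fe.
have [s0 _] : [set: S] !=set0.
  apply/set0P/eqP => S0; move: Q1; rewrite S0 image_set0.
  by rewrite /prob measure0/=; lra.
pose r y := xget s0 [set s | f s = y].
have rf s : r (f s) = s by rewrite /r; case: xgetP => [t _ /finj//|/(_ s)]; case.
have rN y : ~ range f y -> r y = s0.
  by rewrite /r => Ny; case: xgetP => // t _ ty; exfalso; apply: Ny; exists t.
have br : borel_fun r.
  move=> A oA; have [B oB BE] := fo A oA.
  have -> : r @^-1` A = (B `&` range f) `|`
      ((if s0 \in A then setT else set0) `&` ~` range f).
    apply/seteqP; split=> [y Ay|y [|[]]].
    - have [[s _ sy]|yf] := pselect (range f y).
        by left; rewrite -BE; exists s => //; move: Ay; rewrite /preimage/= -sy rf.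
      right; split => //; move: Ay; rewrite /preimage/= (rN _ yf) => As.
      by rewrite mem_set.
    - by rewrite -BE => -[s As <-]; rewrite /preimage/= rf.
    - by case: ifPn => // /set_mem As _ yf; rewrite /preimage/= (rN _ yf).
  apply: borelU; first by apply: borelI => //; exact: borel_open.
  apply: borelI; last exact: borelC.
  by case: ifP => _; [exact: borelT|exact: borel0].
exists (bp_map br Q); apply: borel_prob_eq => A bA.
have bA' : borel (f @^-1` A).
  by apply: borel_fun_preimage => //; exact: continuous_borel_fun.
have bA'' : borel (r @^-1` (f @^-1` A)) by exact: borel_fun_preimage.
rewrite bp_pushE// bp_mapE// !prob_EFin//; congr EFin.
have half (B C : set T) : borel B -> borel C -> B `&` range f `<=` C ->
    prob Q B <= prob Q C.
  move=> bB bC BC; apply: (@le_trans _ _ (prob Q (C `|` ~` range f))).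
    apply: le_prob => //; first by apply: borelU => //; exact: borelC.
    move=> y By; have [fy|] := pselect (range f y); [left|right] => //.
    exact: BC.
  by rewrite (le_trans (probU_le _ _ _))//; [exact: borelC|rewrite probC// Q1 subrr addr0].
apply/eqP; rewrite eq_le; apply/andP; split; apply: half => //.
  by move=> y [yA [s _ sy]]; move: yA; rewrite -sy /preimage/= rf.
by move=> y [yA [s _ sy]]; move: yA; rewrite -sy /preimage/= rf.
Qed.

(** The points [u i] may lie outside the range of [f], so for each [i] and [n] a point whose image
    is within [n.+1%:R^-1] of [u i] is chosen whenever there is one. *)
Lemma sep_carried_push_inv (P : borel_prob R S) :
  sep_carried (bp_push fc P) -> sep_carried P.
Proof.
move=> [u]; have bu := borel_closure_range u; rewrite prob_push// => u1.
have [s0 _] := bp_nonempty P.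
have mS := metrizes_embedding md fe.
pose v k := if (unpickle k : option (nat * nat)) is Some p then
  xget s0 [set s | d (u p.1) (f s) < p.2.+1%:R^-1] else s0.
exists v; have bv := borel_closure_range v.
apply/eqP; rewrite eq_le prob_le1//= -u1; apply: le_prob => //.
  by apply: borel_fun_preimage => //; exact: continuous_borel_fun.
move=> s /(closureP_metrizes md) us; apply/(closureP_metrizes mS) => e e0.
have /ltr_add_invr[n] : 0 < e / 2 by rewrite divr_gt0.
rewrite add0r => ne; have n0 : 0 < n.+1%:R^-1 :> R by rewrite invr_gt0.
have [_ [i _ <-] ui] := us _ n0.
exists (v (pickle (i, n))); first by exists (pickle (i, n)).
rewrite /v pickleK/=; case: xgetP => [t _ /= ti|/(_ s)/=]; last first.
  by rewrite (metrizes_sym md).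
rewrite (le_lt_trans (metrizes_triangle md (u i) _ _))//.
by have := lt_trans ui ne; have := lt_trans ti ne; lra.
Qed.

End probabilities_carried_by_a_range.

(** A Lindelof argument on the carrier: the null balls among those with centre [u i] and radius
    [n.+1%:R^-1] are countably many and cover the part of [V] in the closure of the range. *)
Lemma sep_carried_locally_null (R : realType) (T : topologicalType)
    (d : T -> T -> R) (Q : borel_prob R T) (V : set T) : metrizes d ->
  sep_carried Q -> borel V ->
  (forall x, V x -> exists2 U, open U /\ U x & prob Q U = 0) -> prob Q V = 0.
Proof.
move=> md [u u1] bV nullV.
pose A k := if (unpickle k : option (nat * nat)) is Some p then
  let B := [set x | d (u p.1) x < p.2.+1%:R^-1] in
  if prob Q B == 0 then B else set0 else set0.
have bA k : borel (A k).
  rewrite /A; case: unpickle => [p|]; last exact: borel0.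
  case: ifP => _; last exact: borel0.
  by apply: borel_open; exact: metrizes_open_ball.
have A0 k : prob Q (A k) = 0.
  rewrite /A; case: unpickle => [p|]; last by rewrite /prob measure0.
  by case: ifPn => [/eqP//|_]; rewrite /prob measure0.
have bC := borelC (borel_closure_range u).
have bN := borelU bC (borel_bigcup bA).
apply/eqP; rewrite eq_le prob_ge0 andbT.
apply: (@le_trans _ _ (prob Q (~` closure (range u) `|` \bigcup_k A k))); last first.
  rewrite (le_trans (probU_le _ bC (borel_bigcup bA)))// probC ?u1 ?subrr ?add0r.
    by rewrite prob_bigcup0.
  exact: borel_closure_range.
apply: le_prob => // x Vx; have [ux|] := pselect (closure (range u) x); last by left.
right; have [U [oU Ux] U0] := nullV _ Vx.
have /(metrizes_nbhsP md)[e e0 eU] : nbhs x U by exact: open_nbhs_nbhs.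
(* With a radius below [e / 2], a ball around [u i] that contains [x] lies within distance [e] of
   [x], hence in [U]. *)
have /ltr_add_invr[n] : 0 < e / 2 by rewrite divr_gt0.
rewrite add0r => ne; have n0 : 0 < n.+1%:R^-1 :> R by rewrite invr_gt0.
have [_ [i _ <-] ui] := (closureP_metrizes md _ _).1 ux _ n0.
exists (pickle (i, n)) => //; rewrite /A pickleK/=.
rewrite ifT; first by rewrite /= (metrizes_sym md).
rewrite eq_le prob_ge0 andbT -U0; apply: le_prob.
- by apply: borel_open; exact: metrizes_open_ball.
- exact: borel_open.
- move=> y /= yi; apply: eU => /=.
  rewrite (le_lt_trans (metrizes_triangle md (u i) _ _))//.
  by have := lt_trans ui ne; have := lt_trans yi ne; lra.
Qed.

(** * Completeness of the Kantorovich distance *)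

Section borel_prob_of_outer_measure.
Variables (R : realType) (T : topologicalType).
Variable theta : {outer_measure set T -> \bar R}.
Hypothesis nonempty : [set: T] !=set0.
Hypothesis theta_open : forall U, open U -> theta.-caratheodory U.
Hypothesis theta_setT : theta setT = 1%E.

Let borel_caratheodory (A : set T) : borel A -> theta.-caratheodory A.
Proof.
apply: (@smallest_sub _ _ _ (theta.-caratheodory)); last exact: theta_open.
split; first exact: caratheodory_measurable_set0.
- by move=> B cB; rewrite setTD; exact: caratheodory_measurable_setC.
- by move=> F cF; exact: caratheodory_measurable_bigcup.
Qed.

Let mu (A : set (borel_space nonempty)) : \bar R :=
  if `[< borel (A : set T) >] then theta A else 0%E.

Let mu0 : mu set0 = 0%E.
Proof. by rewrite /mu outer_measure0; case: ifP. Qed.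

Let mu_ge0 A : (0 <= mu A)%E.
Proof. by rewrite /mu; case: ifP => // _; exact: outer_measure_ge0. Qed.

Let muE A : borel (A : set T) -> mu A = theta A.
Proof. by move=> bA; rewrite /mu asboolT. Qed.

Let mu_sigma_additive : semi_sigma_additive mu.
Proof.
move=> F mF tF mUF; rewrite muE//.
rewrite (_ : (fun n => _) = (fun n => \sum_(0 <= i < n) theta (F i))%E); last first.
  by apply/funext => n; apply: eq_bigr => i _; exact: muE (mF i).
have -> : theta (\bigcup_n F n) = (\sum_(0 <= i <oo) theta (F i))%E.
  apply/eqP; rewrite eq_le outer_measure_sigma_subadditive/=.
  have := caratheodory_lime_le (fun n => borel_caratheodory (mF n)) tF (\bigcup_n F n).
  rewrite setICr outer_measure0 adde0.
  by under eq_eseriesr do rewrite (setIidr (@bigcup_sup _ _ _ _ F I)).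
by apply: is_cvg_nneseries => n _ _; exact: outer_measure_ge0.
Qed.

HB.instance Definition _ := isMeasure.Build _ (borel_space nonempty) R
  mu mu0 mu_ge0 mu_sigma_additive.

Let mu_setT : mu setT = 1%E.
Proof. by rewrite muE//; exact: borelT. Qed.

HB.instance Definition _ := Measure_isProbability.Build _ _ _ mu mu_setT.

Let mu_off (A : set T) : ~ borel A -> mu A = 0%E.
Proof. by move=> nA; rewrite /mu asboolF. Qed.

(** Caratheodory's theorem: the measurable sets form a sigma-algebra, which contains the open sets,
    and [theta] is countably additive on it. *)
Lemma borel_prob_of_outer_measure :
  exists P : borel_prob R T, forall A, borel A -> bp_measure P A = theta A.
Proof. by exists (@BorelProb R T nonempty mu mu_off) => A bA; exact: muE. Qed.

End borel_prob_of_outer_measure.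

(** * Closure properties of the class of Lipschitz functions *)

Section lipschitz_functions.
Variables (R : realType) (T : topologicalType) (d : T -> T -> R).
Hypothesis md : metrizes d.
Implicit Types f g : T -> R.

Definition lipschitz f : Prop := exists2 m, 0 < m & lip d m f.

Lemma lipschitz_borel_fun f : lipschitz f -> borel_fun f.
Proof. by move=> [m _]; exact: lip_borel_fun. Qed.

Lemma lipschitz_bounded f : lipschitz f -> bounded_real f.
Proof. by move=> [m /ltW m0]; exact: lip_bounded. Qed.

Lemma lipschitz_cst k : lipschitz (fun=> k).
Proof. by exists 1 => //; exact: lip_cst. Qed.

Lemma lipschitzD f g : lipschitz f -> lipschitz g -> lipschitz (fun x => f x + g x).
Proof.
move=> [m m0 lf] [n n0 lg]; exists (m + n); first exact: addr_gt0.
by move=> x y; have := lf x y; have := lg x y; lra.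
Qed.

Lemma lipschitzZ k f : 0 <= k -> lipschitz f -> lipschitz (fun x => k * f x).
Proof.
(* The added 1 keeps the constant positive when [k] is 0. *)
move=> k0 [m m0 lf]; exists (k * m + 1); first by rewrite ltr_wpDl// mulr_ge0// ltW.
move=> x y; rewrite -mulrBr mulrDl -mulrA mul1r.
by rewrite (le_trans (ler_wpM2l k0 (lf x y)))// lerDl trunc_ge0.
Qed.

Lemma lipschitzN f : lipschitz f -> lipschitz (fun x => - f x).
Proof. by move=> [m m0 lf]; exists m => //; exact: lipN. Qed.

Lemma lipschitzB f g : lipschitz f -> lipschitz g -> lipschitz (fun x => f x - g x).
Proof. by move=> lf /lipschitzN; exact: lipschitzD. Qed.

Lemma lipschitz_max0 f : lipschitz f -> lipschitz (fun x => Num.max 0 (f x)).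
Proof.
move=> [m m0 lf]; exists m => // x y; have := lf x y.
have := mulr_ge0 (ltW m0) (trunc_ge0 md x y).
by case: (leP 0 (f x)); case: (leP 0 (f y)); lra.
Qed.

Lemma lipschitz_min1 f : lipschitz f -> lipschitz (fun x => Num.min 1 (f x)).
Proof.
move=> [m m0 lf]; exists m => // x y; have := lf x y.
have := mulr_ge0 (ltW m0) (trunc_ge0 md x y).
by case: (leP 1 (f x)); case: (leP 1 (f y)); lra.
Qed.

Lemma lipschitz_sum (f_ : nat -> T -> R) n : (forall i, lipschitz (f_ i)) ->
  lipschitz (fun x => \sum_(i < n) f_ i x).
Proof.
move=> lf; elim: n => [|n IH].
  by under eq_fun do rewrite big_ord0; exact: lipschitz_cst.
by under eq_fun do rewrite big_ord_recr/=; exact: lipschitzD.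
Qed.

End lipschitz_functions.

(** Layer-cake decomposition: the [i]-th term is the part of [y] between the levels [i] and
    [i + 1]. *)
Lemma sum_clamp (R : realDomainType) (k : nat) (y : R) : 0 <= y ->
  \sum_(i < k) Num.max 0 (Num.min 1 (y - i%:R)) = Num.min y k%:R.
Proof.
move=> y0; elim: k => [|k IH]; first by rewrite big_ord0 min_r.
rewrite big_ord_recr/= IH -natr1; have k0 : 0 <= k%:R :> R by [].
have [yk|yk] := leP y k%:R.
  by rewrite (@min_l _ _ y) ?max_l; [lra|rewrite ge_min; apply/orP; right; lra|lra].
have [y1|y1] := leP y (k%:R + 1).
  by rewrite min_r ?max_r; lra.
by rewrite min_l ?max_r; lra.
Qed.

(** Replacing each layer by the indicator of its being met overshoots [y] by at most 1. *)
Lemma sum_lt_nat (R : realDomainType) (k : nat) (y : R) : 0 <= y ->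
  \sum_(i < k) (i%:R < y)%R%:R <= Num.min k%:R (y + 1).
Proof.
move=> y0; elim: k => [|k IH]; first by rewrite big_ord0 le_min lexx addr_ge0.
rewrite big_ord_recr/= -natr1; move: IH; rewrite !le_min => /andP[? ?].
have [?|?] := ltP k%:R y.
  by apply/andP; split; rewrite (_ : true%:R = 1)//; lra.
by apply/andP; split; rewrite (_ : false%:R = 0)//; lra.
Qed.

(** * The limit of a Cauchy sequence of separably carried probabilities *)

Section completeness.
Variables (R : realType) (T : topologicalType) (d : T -> T -> R).
Hypotheses (md : metrizes d) (cd : complete_metric d).
Variable P_ : nat -> borel_prob R T.
Hypothesis sP : forall n, sep_carried (P_ n).
Hypothesis cauchyP : forall e, 0 < e -> exists N, forall m n,
  (N <= m)%N -> (N <= n)%N -> kr d (P_ m) (P_ n) < e.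

Let carrier : exists w : nat -> T, forall n, prob (P_ n) (closure (range w)) = 1.
Proof.
have [u u1] := choice sP.
pose w k := let p := if (unpickle k : option (nat * nat)) is Some p then p
  else (0, 0)%N in u p.1 p.2.
exists w => n; apply/eqP; rewrite eq_le prob_le1/=; last exact: borel_closure_range.
rewrite -(u1 n); apply: le_prob; try exact: borel_closure_range.
apply: closure_subset => _ [k _ <-]; exists (pickle (n, k)) => //.
by rewrite /w pickleK.
Qed.

Let w := projT1 (cid carrier).

Let w1 n : prob (P_ n) (closure (range w)) = 1.
Proof. by rewrite /w; case: cid. Qed.

(** Finitely many small balls carry most of one late [P_ n0]. A 1-Lipschitz function that is small
    on these balls and at least [r] off the balls of radius [r] transfers the bound to all later
    [P_ n]. *)
Let tight (r s : R) : 0 < r -> 0 < s -> exists N n0, forall n, (n0 <= n)%N ->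
  prob (P_ n) (~` ball_union d w r N) < s.
Proof.
(* The truncated distance only sees radii up to 1, and larger balls carry more mass. *)
wlog r1 : r / r <= 1 => [H r0 s0|r0 s0].
  have [r1|r1] := leP r 1; first exact: H.
  have [N [n0 Hn]] := H 1 (lexx _) ltr01 s0; exists N, n0 => n /Hn.
  have bo (t : R) : borel (~` ball_union d w t N).
    by apply: borelC; apply: borel_open; exact: ball_union_open.
  apply: le_lt_trans; apply: le_prob => // x rx [i iN xi]; apply: rx.
  by exists i => //; exact: lt_trans xi r1.
(* The mean of [f] is below [3 * t] under [P_ n0], hence below [4 * t = r * s] under [P_ n], and
   Markov's inequality divides this by [r]. *)
pose t := r * s / 4; have t0 : 0 < t by rewrite divr_gt0// mulr_gt0.
have [n0 Hn0] := cauchyP t0.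
have [|N HN] := sep_carried_ball_union md (c := 1 - t) (w1 n0) t0; first lra.
exists N, n0 => n n0n.
(* Indices from [N] on are penalized rather than dropped: [f] acts as truncated distance to the
   first [N] points, and the index set stays nonempty when [N] is 0. *)
pose g i : R := (N <= i)%:R.
have g0 i : 0 <= g i by rewrite /g.
pose f := infconv d w g 1.
have lf : lip d 1 f by exact: (infconv_lip md 0%N w g0 ler01).
have bf := lip_borel_fun md lf; have Bf := lip_bounded ler01 lf.
have f0 x : 0 <= f x.
  by apply: (le_infconv (d := d) 0%N) => i; rewrite addr_ge0// mulr_ge0// trunc_ge0.
have fr x : ~ ball_union d w r N x -> r <= f x.
  move=> xr; apply: (le_infconv (d := d) 0%N) => i; rewrite mul1r.
  have [iN|Ni] := ltnP i N.
    have xi : r <= d (w i) x by rewrite leNgt; apply/negP => xi; apply: xr; exists i.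
    have : r <= trunc d (w i) x by rewrite le_min xi r1.
    by have := g0 i; lra.
  by rewrite /g Ni (le_trans r1)// lerDl trunc_ge0.
have bU e : borel (ball_union d w e N) by apply: borel_open; exact: ball_union_open.
have H0 : mean (P_ n0) f <= t + 2 * prob (P_ n0) (~` ball_union d w t N).
  apply: mean_le_prob => //; first exact: borelC.
    move=> x /contrapT[i iN xi].
    have := infconv_le md w g0 ler01 i x.
    rewrite -/f {1}/g leqNgt iN/= add0r mul1r => /le_trans; apply.
    by rewrite (le_trans (trunc_le _ _ _))// ltW.
  move=> x _.
  have := infconv_le md w g0 ler01 N x; rewrite -/f => /le_trans; apply.
  have gN : g N = 1 by rewrite /g leqnn.
  by have := trunc_le1 d (w N) x; rewrite gN mul1r; lra.
have : mean (P_ n) (fun x => r * \1_(~` ball_union d w r N) x) <= mean (P_ n) f.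
  apply: le_mean => //.
  - by apply: borel_funZ; apply: borel_fun_indic; exact: borelC.
  - by apply: bounded_realZ; exact: bounded_real_indic.
  - move=> x; rewrite indicE; have [/set_mem xr|_] := boolP (_ \in _).
      by rewrite mulr1; exact: fr.
    by rewrite mulr0.
rewrite meanZ; [|by apply: borel_fun_indic; exact: borelC|exact: bounded_real_indic].
rewrite mean_indic; last exact: borelC.
rewrite -(ltr_pM2l r0) => /le_lt_trans; apply.
have := kr_ub md (P_ n) (P_ n0) lf; have := Hn0 _ _ n0n (leqnn _).
move: H0; rewrite probC//; move: t0 HN; rewrite /t; lra.
Qed.

Let bL f (lf : lipschitz d f) := lipschitz_borel_fun md lf.
Let BL f (lf : lipschitz d f) := lipschitz_bounded lf.

Let L (f : T -> R) : R := limn (fun n => mean (P_ n) f).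

Let L_cvg f : lipschitz d f -> mean (P_ n) f @[n --> \oo] --> L f.
Proof.
move=> [m m0 lf]; apply: cauchy_cvg; apply: cauchy_exP => e e0.
have [N HN] := cauchyP (divr_gt0 e0 m0).
exists (mean (P_ N) f); exists N => // n Nn /=.
rewrite /ball/= (le_lt_trans (kr_lip md _ _ m0 lf))// mulrC -ltr_pdivlMr//.
exact: HN.
Qed.

Let L_le f g : lipschitz d f -> lipschitz d g -> (forall x, f x <= g x) -> L f <= L g.
Proof.
move=> lf lg fg; apply: ler_cvg_to (L_cvg lf) (L_cvg lg) _.
by apply: nearW => n; exact: le_mean (bL lf) (BL lf) (bL lg) (BL lg) fg.
Qed.

Let LD f g : lipschitz d f -> lipschitz d g -> L (fun x => f x + g x) = L f + L g.
Proof.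
move=> lf lg; apply: cvg_lim => //.
have -> : (fun n => mean (P_ n) (fun x => f x + g x)) =
    (fun n => mean (P_ n) f + mean (P_ n) g).
  by apply/funext => n; exact: meanD (bL lf) (BL lf) (bL lg) (BL lg).
by apply: cvgD; exact: L_cvg.
Qed.

Let LZ k f : lipschitz d f -> L (fun x => k * f x) = k * L f.
Proof.
move=> lf; apply: cvg_lim => //.
have -> : (fun n => mean (P_ n) (fun x => k * f x)) = (fun n => k * mean (P_ n) f).
  by apply/funext => n; exact: meanZ (bL lf) (BL lf).
by apply: cvgM; [exact: cvg_cst|exact: L_cvg].
Qed.

Let L_cst k : L (fun=> k) = k.
Proof. by apply: cvg_lim => //; under eq_fun do rewrite mean_cst; exact: cvg_cst. Qed.

Let L_sum (f_ : nat -> T -> R) n : (forall i, lipschitz d (f_ i)) ->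
  L (fun x => \sum_(i < n) f_ i x) = \sum_(i < n) L (f_ i).
Proof.
move=> lf; elim: n => [|n IH].
  by rewrite big_ord0; under eq_fun do rewrite big_ord0; exact: L_cst.
rewrite big_ord_recr/= -IH -LD//; last exact: lipschitz_sum.
by congr L; apply/funext => x; rewrite big_ord_recr.
Qed.

(* The ultrafilter limit of points at which [h j > e / 2], chosen in finite unions
   of small balls, exists by completeness and contradicts [h j --> 0] there. *)
Let L_daniell (h : nat -> T -> R) (e : R) : 0 < e -> (forall j, lipschitz d (h j)) ->
  (forall j x, 0 <= h j x <= 1) -> (forall j x, h j.+1 x <= h j x) ->
  (forall x, exists j, h j x < e / 2) -> exists j, L (h j) <= e.
Proof.
move=> e0 lh h01 nih h0; apply: contrapT => Lh.
have {}Lh j : e < L (h j) by rewrite ltNge; apply/negP => Lj; apply: Lh; exists j.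
have hn j k x : (j <= k)%N -> h k x <= h j x.
  elim: k => [|k IH]; first by rewrite leqn0 => /eqP->.
  rewrite leq_eqVlt => /predU1P[->//|jk].
  by rewrite (le_trans (nih _ _))// IH.
have rk k : 0 < k.+1%:R^-1 :> R by rewrite invr_gt0.
have sk k : 0 < e / 2 / 2 ^+ k.+1 by rewrite !divr_gt0// exprn_gt0.
have /choice[N HN] k := tight (rk k) (sk k).
pose U k := ball_union d w k.+1%:R^-1 (N k).
have bU k : borel (U k) by apply: borel_open; exact: ball_union_open.
(* Otherwise [h j <= e / 2] on the intersection of the first [j] sets [U k], whose complement
   eventually has mass at most [e / 2], and then [L (h j) <= e]. *)
have xj j : exists2 x, (forall k, (k < j)%N -> U k x) & e / 2 < h j x.
  apply: contrapT => nx.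
  pose V j := \bigcap_(k in `I_j) U k.
  have bV i : borel (V i).
    rewrite /V bigcap_mkcond; apply: borel_bigcap => k.
    by case: ifP => _ //; exact: borelT.
  have hV x : V j x -> h j x <= e / 2.
    by move=> Vx; rewrite leNgt; apply/negP => hx; apply: nx; exists x.
  (* The right-hand side is the sum of the exceptional masses [e / 2 / 2 ^+ k.+1] over [k < i]. *)
  have Vn i : \forall n \near \oo, prob (P_ n) (~` V i) <= e / 2 * (1 - (2 ^+ i)^-1).
    elim: i => [|i IH].
      apply: nearW => n; rewrite expr0 invr1 subrr mulr0 /V II0 bigcap_set0 setCT.
      by rewrite /prob measure0.
    have [n0 Hn0] := HN i.
    near=> n.
    have -> : ~` V i.+1 = ~` V i `|` ~` U i.
      rewrite /V IIS bigcap_setU bigcap_set1 setCI; congr setU.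
    rewrite (le_trans (probU_le _ (borelC (bV i)) (borelC (bU i))))//.
    have H1 : prob (P_ n) (~` V i) <= e / 2 * (1 - (2 ^+ i)^-1) by near: n.
    have /ltW H2 : prob (P_ n) (~` U i) < e / 2 / 2 ^+ i.+1.
      by apply: Hn0; near: n; exact: nbhs_infty_ge.
    rewrite (le_trans (lerD H1 H2))// exprS invfM; lra.
  have : \forall n \near \oo, mean (P_ n) (h j) <= e.
    apply: filterS (Vn j) => n Hn.
    have : mean (P_ n) (h j) <= e / 2 + 1 * prob (P_ n) (~` V j).
      apply: mean_le_prob => //.
      - exact: bL.
      - exact: BL.
      - exact: borelC.
      - by move=> x /contrapT/hV.
      - by move=> x _; have /andP[_] := h01 j x; lra.
    have : 0 <= e / 2 * (2 ^+ j)^-1 by rewrite mulr_ge0 ?invr_ge0 ?exprn_ge0// divr_ge0// ltW.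
    move: Hn; rewrite mulrBr mulr1; lra.
  move=> He; have : L (h j) <= e by apply: cvgr_to_le (L_cvg (lh j)) He.
  by rewrite leNgt Lh.
have /choice[x Hx] j : exists x, (forall k, (k < j)%N -> U k x) /\ e / 2 < h j x.
  by have [x ? ?] := xj j; exists x.
(* An ultrafilter finer than the eventual filter stands in for a diagonal subsequence: out of
   finitely many balls covering late [x j] it selects one. *)
have [F [uF sF]] := ultraFilterLemma eventually_filter.
have FF : ProperFilter F := ultra_proper.
have fin (A : nat -> set nat) n : F [set j | exists2 i, (i < n)%N & A i j] ->
    exists i, F (A i).
  elim: n => [|n IH] FA; first by have [j []] := filter_ex FA.
  have [An|An] := in_ultra_setVsetC (A n) uF; first by exists n.
  apply: IH; apply: filterS (filterI FA An) => j [[i + Aij] nAj].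
  by rewrite ltnS leq_eqVlt => /predU1P[ni|ni]; [move: Aij; rewrite ni|exists i].
have /choice[c Fc] k : exists i, F [set j | d (w i) (x j) < k.+1%:R^-1].
  apply: (fin (fun i => [set j | d (w i) (x j) < k.+1%:R^-1]) (N k)).
  by apply: sF; exists k.+1 => // j kj; exact: (Hx j).1.
have inv_le (m n : nat) : (m <= n)%N -> n.+1%:R^-1 <= m.+1%:R^-1 :> R.
  by move=> mn; rewrite lef_pV2 ?posrE// ler_nat.
(* Any two sets of the filter share an index [j], and [x j] is close to both centres, so the
   selected centres form a Cauchy sequence. *)
have [|l yl] := cd (u := w \o c).
  move=> t t0; have /ltr_add_invr[k] : 0 < t / 2 by rewrite divr_gt0.
  rewrite add0r => kt; exists k => m n km kn /=.
  have [j [mj nj]] := filter_ex (filterI (Fc m) (Fc n)).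
  rewrite (le_lt_trans (metrizes_triangle md (x j) _ _))//.
  rewrite /= (metrizes_sym md (x j)).
  have := lt_trans mj (le_lt_trans (inv_le _ _ km) kt).
  by have := lt_trans nj (le_lt_trans (inv_le _ _ kn) kt); rewrite /=; lra.
have [i hi] := h0 l.
have ci : continuous (h i) by have [m _ lhi] := lh i; exact: lip_continuous lhi.
have : nbhs l [set z | h i z < e / 2].
  have /continuousP/(_ _ (@open_lt R (e / 2))) oh := ci.
  by apply: open_nbhs_nbhs; split.
move=> /(metrizes_nbhsP md)[t t0 ht].
have t20 : 0 < t / 2 by rewrite divr_gt0.
have /ltr_add_invr[k] := t20; rewrite add0r => kt.
have [k' _ yk'] : \forall n \near \oo, d l (w (c n)) < t / 2.
  exact: (yl _ (metrizes_nbhs_ball md l t20)).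
(* At this index both the radius of the selected ball and the distance of its centre from [l] are
   below [t / 2]. *)
have kk' := yk' (maxn k k') (leq_maxr _ _).
have Fi : F [set j | (i <= j)%N] by apply: sF; exists i.
have [j [jk /= ij]] := filter_ex (filterI (Fc (maxn k k')) Fi).
have /ht/= : d l (x j) < t.
  rewrite (le_lt_trans (metrizes_triangle md (w (c (maxn k k'))) _ _))//.
  have := lt_trans jk (le_lt_trans (inv_le _ _ (leq_maxl k k')) kt).
  by move: kk' => /=; lra.
by have := hn _ _ (x j) ij; have := (Hx j).2; lra.
Unshelve. all: by end_near. Qed.

Let test (U : set T) (f : T -> R) : Prop :=
  lipschitz d f /\ forall x, 0 <= f x <= \1_U x.

Let m (U : set T) : R := sup [set L f | f in test U].

Let test0 U : test U (fun=> 0).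
Proof. by split=> [|x]; [exact: lipschitz_cst|rewrite lexx indicE ler0n]. Qed.

Let L_le1 U f : test U f -> L f <= 1.
Proof.
move=> [lf f01]; rewrite -(L_cst 1); apply: L_le => //; first exact: lipschitz_cst.
by move=> x; have /andP[_ /le_trans] := f01 x; apply; rewrite indicE; case: (_ \in _).
Qed.

Let m_ub U f : test U f -> L f <= m U.
Proof.
move=> tf; apply: ub_le_sup; last by exists f.
by exists 1 => _ [g tg <-]; exact: L_le1 tg.
Qed.

Let m_le U (c : R) : (forall f, test U f -> L f <= c) -> m U <= c.
Proof.
move=> H; apply: ge_sup => [|_ [f tf <-]]; last exact: H.
by exists (L (fun=> 0)), (fun=> 0).
Qed.

Let m_adherent U (e : R) : 0 < e -> exists2 f, test U f & m U - e < L f.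
Proof.
move=> e0; have [|_ [f tf <-] ?] := @sup_adherent R [set L f | f in test U] e e0.
  split; first by exists (L (fun=> 0)), (fun=> 0).
  by exists 1 => _ [g tg <-]; exact: L_le1 tg.
by exists f.
Qed.

Let m_mono U V : U `<=` V -> m U <= m V.
Proof.
move=> UV; apply: m_le => f [lf fU]; apply: m_ub; split => // x.
have /andP[-> /le_trans]/= := fU x; apply; rewrite !indicE.
have [/set_mem/UV/mem_set->//|_] := boolP (x \in U).
by case: (_ \in _).
Qed.

Let m_ge0 U : 0 <= m U. Proof. by rewrite -(L_cst 0) m_ub. Qed.

Let m_set0 : m set0 = 0.
Proof.
apply/eqP; rewrite eq_le m_ge0 andbT; apply: m_le => f [lf f0].
rewrite -(L_cst 0); apply: L_le => //; first exact: lipschitz_cst.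
by move=> x; have := f0 x; rewrite indicE in_set0 => /andP[].
Qed.

Let m_setT : m setT = 1.
Proof.
apply/eqP; rewrite eq_le m_le/=; last by move=> f; exact: L_le1.
rewrite -{1}(L_cst 1); apply: m_ub; split=> [|x]; first exact: lipschitz_cst.
by rewrite indicE in_setT ler01 lexx.
Qed.

(* A test function [f] of the union is dominated by the sum [s j] of test functions
   of the first [j] sets up to [max 0 (f - s j)], which decreases to 0. *)
Let m_bigcup (U : nat -> set T) (b : R) : (forall i, open (U i)) ->
  (forall n, \sum_(i < n) m (U i) <= b) -> m (\bigcup_i U i) <= b.
Proof.
move=> oU Ub; apply: m_le => f [lf fU]; apply/ler_addgt0Pr => e e0.
have cU i : closed (~` U i) by rewrite closedC.
pose D i := set_dist d (~` U i).
have lD i : lipschitz d (D i) by exists 1 => //; exact: set_dist_lip.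
have D0 i x : 0 <= D i x by exact: set_dist_ge0.
(* As [j] grows, these functions increase to the indicator of [U i]. *)
pose g j i x := Num.min 1 (j%:R * D i x).
have lg j i : lipschitz d (g j i).
  exact: (lipschitz_min1 md (lipschitzZ md (ler0n R j) (lD i))).
have g0 j i x : 0 <= g j i x by rewrite le_min ler01/= mulr_ge0.
have tg j i : test (U i) (g j i).
  split => // x; rewrite g0/= indicE; have [xU|xU] := boolP (x \in U i).
    by rewrite ge_min lexx.
  rewrite /g /D set_dist0// ?mulr0 ?min_r//.
  by move=> xUi; move: xU; rewrite mem_set.
pose s j x := \sum_(i < j) g j i x.
have ls j : lipschitz d (s j) by exact: lipschitz_sum.
have nds j x : s j x <= s j.+1 x.
  rewrite /s big_ord_recr/= -[leLHS]addr0 lerD//; apply: ler_sum => i _.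
  by rewrite /g le_min !ge_min lexx/=; apply/orP; right; rewrite ler_wpM2r// ler_nat.
pose h j x := Num.max 0 (f x - s j x).
have s0 j x : 0 <= s j x by exact: sumr_ge0.
have f1 x : f x <= 1.
  by have /andP[_ /le_trans] := fU x; apply; rewrite indicE; case: (_ \in _).
have [||||j hj] := L_daniell (h := h) e0.
- by move=> j; apply: lipschitz_max0 => //; exact: lipschitzB.
- move=> j x; rewrite le_max lexx/= ge_max ler01/=.
  by have := s0 j x; have := f1 x; lra.
- move=> j x; rewrite /h ge_max le_max lexx/= le_max; apply/orP; right.
  by have := nds j x; lra.
- move=> x; have [[i _ Ui]|xU] := pselect ((\bigcup_i U i) x); last first.
    exists 0%N; rewrite /h /s big_ord0 subr0; have := fU x.
    rewrite indicE memNset//= => /andP[? ?]; rewrite max_l//; lra.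
  have Dx : 0 < D i x by apply: set_dist_gt0 => //; apply.
  have [k kD] : exists k : nat, (D i x)^-1 < k%:R.
    by exists (Num.truncn (D i x)^-1).+1; rewrite truncnS_gt.
  (* Large enough for the [i]-th term to occur in [s j] and for [j%:R * D i x] to reach 1. *)
  pose j := maxn k i.+1; exists j.
  have ij : (i < j)%N by rewrite /j leq_max ltnSn orbT.
  have gx : g j i x = 1.
    rewrite /g min_l// -ler_pdivrMr// mul1r (le_trans (ltW kD))// ler_nat.
    by rewrite /j leq_maxl.
  have : 1 <= s j x.
    rewrite -gx /s (bigD1 (Ordinal ij))//= lerDl sumr_ge0//.
  by move=> s1; rewrite /h max_l; [lra|have := f1 x; lra].
have : L f <= L (fun x => s j x + h j x).
  apply: L_le => //.
    by apply: lipschitzD => //; apply: lipschitz_max0 => //; exact: lipschitzB.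
  by move=> x; rewrite /h addrC -lerBlDr le_max lexx orbT.
rewrite LD//; last by apply: lipschitz_max0 => //; exact: lipschitzB.
rewrite /s L_sum//; move/le_trans; apply.
rewrite lerD// (le_trans _ (Ub j))//; apply: ler_sum => i _.
by apply: m_ub; exact: tg.
Qed.

Let thetar (A : set T) : R := inf [set m U | U in [set U | open U /\ A `<=` U]].

Let thetar_le (A U : set T) : open U -> A `<=` U -> thetar A <= m U.
Proof.
move=> oU AU; apply: ge_inf; last by exists U.
by exists 0 => _ [V _ <-].
Qed.

Let thetar_ge (A : set T) (c : R) :
  (forall U, open U -> A `<=` U -> c <= m U) -> c <= thetar A.
Proof.
move=> H; apply: lb_le_inf => [|_ [V [oV AV] <-]]; last exact: H.
by exists (m setT), setT => //; split; [exact: openT|exact: subsetT].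
Qed.

Let thetar_adherent (A : set T) (e : R) : 0 < e ->
  exists U, [/\ open U, A `<=` U & m U < thetar A + e].
Proof.
move=> e0; have [|_ [U [oU AU] <-] ?] :=
    @inf_adherent R [set m U | U in [set U | open U /\ A `<=` U]] e e0.
  split; last by exists 0 => _ [V _ <-].
  by exists (m setT), setT => //; split; [exact: openT|exact: subsetT].
by exists U.
Qed.

Let thetar_open U : open U -> thetar U = m U.
Proof.
move=> oU; apply/eqP; rewrite eq_le thetar_le//=.
by apply: thetar_ge => V _; exact: m_mono.
Qed.

Let theta (A : set T) : \bar R := (thetar A)%:E.

Let theta0 : theta set0 = 0%E.
Proof. by rewrite /theta thetar_open ?m_set0//; exact: open0. Qed.

Let theta_ge0 A : (0 <= theta A)%E.
Proof. by rewrite lee_fin; apply: thetar_ge. Qed.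

Let theta_mono : {homo theta : A B / A `<=` B >-> (A <= B)%E}.
Proof.
move=> A B AB; rewrite lee_fin; apply: thetar_ge => U oU BU.
by apply: thetar_le => //; exact: subset_trans BU.
Qed.

Let theta_sigma_subadditive : sigma_subadditive theta.
Proof.
move=> A; apply/lee_addgt0Pr => e e0.
apply: le_trans (epsilon_trick _ _ (ltW e0)); last by move=> n; exact: theta_ge0.
have /choice[U HU] n : exists U, [/\ open U, A n `<=` U &
    m U < thetar (A n) + e / (2 ^ n.+1)%:R].
  by apply: thetar_adherent; rewrite divr_gt0// ltr0n expn_gt0.
set B := (X in (_ <= X)%E).
have UB n : ((\sum_(i < n) m (U i))%:E <= B)%E.
  rewrite -sumEFin (@le_trans _ _ (\sum_(0 <= i < n) (theta (A i) + (e / (2 ^ i.+1)%:R)%:E))%E)//.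
    rewrite big_mkord; apply: lee_sum => i _.
    by rewrite /theta -EFinD lee_fin ltW//; have [] := HU i.
  apply: nneseries_lim_ge => i _; rewrite /theta -EFinD lee_fin.
  by rewrite (le_trans (m_ge0 (U i)))// ltW//; have [] := HU i.
have thU : (theta (\bigcup_n A n) <= (m (\bigcup_n U n))%:E)%E.
  rewrite lee_fin; apply: thetar_le; first by apply: bigcup_open => i _; have [] := HU i.
  by apply: subset_bigcup => i _; have [] := HU i.
(* If the series is infinite the bound is trivial; the empty partial sum excludes minus infinity. *)
apply: (le_trans thU); move: UB; case: B => [b| |] UB; last 2 first.
- by rewrite leey.
- by have := UB 0%N; rewrite leeNy_eq.
- rewrite lee_fin; apply: m_bigcup => [i|n]; first by have [] := HU i.
  by have := UB n; rewrite lee_fin.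
Qed.

HB.instance Definition _ := isOuterMeasure.Build R T theta theta0 theta_ge0
  theta_mono theta_sigma_subadditive.

(* If [f] tests [V `&` U] and [g] tests [V' = V `&` [set x | f x < e / 3]], then
   [max 0 (f - e / 3)] and [g] have disjoint supports, so their sum tests [V]. *)
Let theta_caratheodory U : open U -> theta.-caratheodory U.
Proof.
move=> oU; apply: (@le_caratheodory_measurable R T theta) => X.
rewrite /theta -EFinD lee_fin; apply: thetar_ge => V oV XV.
(* Two thirds of [e] pay for the choices of [f] and [g], the last third for cutting [f] at level
   [e / 3]. *)
apply/ler_addgt0Pr => e e0; have e30 : 0 < e / 3 by rewrite divr_gt0.
have [f [lf fVU] fm] := m_adherent (V `&` U) e30.
pose V' := V `&` [set x | f x < e / 3].
have oV' : open V'.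
  apply: openI => //.
  have [k _ lkf] := lf; have /continuousP := lip_continuous md lkf.
  by move=> /(_ _ (@open_lt R (e / 3))).
have [g [lg gV'] gm] := m_adherent V' e30.
pose p x := Num.max 0 (f x - e / 3) + g x.
have lp0 : lipschitz d (fun x => Num.max 0 (f x - e / 3)).
  by apply: lipschitz_max0 => //; apply: lipschitzB => //; exact: lipschitz_cst.
have H1 : thetar (X `&` U) <= m (V `&` U).
  by apply: thetar_le; [exact: openI|move=> x [/XV]].
have H2 : thetar (X `&` ~` U) <= m V'.
  apply: thetar_le => // x [/XV Vx nUx]; split => //=.
  have := fVU x; rewrite indicE memNset; last by case.
  by move=> /andP[_ /le_lt_trans]; apply.
have H3 : L p <= m V.
  apply: m_ub; split; first exact: lipschitzD.
  move=> x; have := fVU x; have := gV' x; rewrite /p !indicE.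
  have [VU|VU] := boolP (x \in V `&` U); have [V'x|V'x] := boolP (x \in V').
  - move: (V'x) => /set_mem[Vx /= fx]; rewrite mem_set//= => /andP[? ?] _.
    by rewrite max_l ?add0r; [apply/andP|lra].
  - move: (VU) => /set_mem[Vx _]; rewrite mem_set//= => /andP[? ?] /andP[? ?].
    rewrite addr_ge0 ?le_max ?lexx//=.
    have -> : g x = 0 by lra.
    by rewrite addr0 ge_max ler01/=; lra.
  - move: (V'x) => /set_mem[Vx /= fx]; rewrite mem_set//= => /andP[? ?] _.
    by rewrite max_l ?add0r; [apply/andP|lra].
  - move=> /= /andP[? ?] /andP[? ?]; have -> : g x = 0 by lra.
    have -> : f x = 0 by lra.
    by rewrite addr0 max_l ?lexx ?ler0n//; lra.
have H4 : L f - e / 3 + L g <= L p.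
  rewrite /p LD// lerD2r.
  have <- : L (fun x => f x + (- (e / 3))) = L f - e / 3.
    by rewrite LD ?L_cst//; exact: lipschitz_cst.
  apply: L_le => //.
    by apply: lipschitzD => //; exact: lipschitz_cst.
  by move=> x; rewrite le_max lexx orbT.
lra.
Qed.

(** Layer cake gives [L f <= mean P f]; the same for [1 - f] gives equality. The limit is carried by
    the closure of the common sequence [w], since the distance to it has mean 0 along the sequence.
    Letting the second index of the Cauchy bound tend to infinity gives the estimate. *)
Lemma kr_complete : exists2 P : borel_prob R T, sep_carried P &
  forall e, 0 < e -> exists N, forall n, (N <= n)%N -> kr d (P_ n) P <= e.
Proof.
have theta1 : theta setT = 1%E.
  by rewrite /theta thetar_open ?m_setT//; exact: openT.
have [P PE] := @borel_prob_of_outer_measure R T theta (bp_nonempty (P_ 0%N))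
  theta_caratheodory theta1.
have probE U : open U -> prob P U = m U.
  by move=> oU; rewrite /prob (PE _ (borel_open oU)) /= thetar_open.
(* Layer cake: [N * f] is the sum of the truncations [c i], each of which tests
   the open set [U i = [set x | i < N * f x]]. *)
have L_le_mean f : lipschitz d f -> (forall x, 0 <= f x <= 1) -> L f <= mean P f.
  move=> lf f01; apply/ler_addgt0Pr => e e0.
  have /ltr_add_invr[n] := e0; rewrite add0r => /ltW ne.
  rewrite (le_trans _ (lerD (lexx _) ne))//.
  pose N : R := n.+1%:R.
  have N0 : 0 < N by [].
  pose c i x := Num.max 0 (Num.min 1 (N * f x - i%:R)).
  have lc i : lipschitz d (c i).
    apply: lipschitz_max0 => //; apply: lipschitz_min1 => //.
    exact: (lipschitzB md (lipschitzZ md (ltW N0) lf) (lipschitz_cst md _)).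
  have fE x : f x = N^-1 * \sum_(i < n.+1) c i x.
    have /andP[f0 f1] := f01 x.
    rewrite sum_clamp ?mulr_ge0// ?ltW// min_l; last by rewrite ler_piMr// ltW.
    by rewrite mulrA mulVf ?mul1r// gt_eqF.
  pose U i := [set x | i%:R < N * f x].
  have oU i : open (U i).
    have [k _ lk] := lipschitzZ md (ltW N0) lf.
    have /continuousP := lip_continuous md lk.
    by move=> /(_ _ (@open_gt R i%:R)).
  have bU i := borel_open (oU i).
  have Lc i : L (c i) <= prob P (U i).
    rewrite probE//; apply: m_ub; split => // x.
    rewrite le_max lexx/= indicE; have [/set_mem Ux|Ux] := boolP (x \in U i).
      by rewrite ge_max ler01 ge_min lexx.
    rewrite ge_max lexx/= ge_min; apply/orP; right.
    by rewrite subr_le0 leNgt; apply/negP => /mem_set; apply/negP.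
  have -> : f = (fun x => N^-1 * \sum_(i < n.+1) c i x) by apply/funext.
  rewrite LZ; last exact: lipschitz_sum.
  rewrite L_sum//.
  rewrite (@le_trans _ _ (N^-1 * \sum_(i < n.+1) prob P (U i)))//.
    by rewrite ler_pM2l ?invr_gt0//; apply: ler_sum.
  have -> : (fun x => N^-1 * \sum_(i < n.+1) c i x) = f by apply/esym/funext.
  have ind k : borel_fun (fun x => \sum_(i < k) \1_(U i) x : R) /\
      bounded_real (fun x => \sum_(i < k) \1_(U i) x : R) /\
      \sum_(i < k) prob P (U i) = mean P (fun x => \sum_(i < k) \1_(U i) x).
    elim: k => [|k [IH1 [IH2 IH3]]].
      rewrite big_ord0; under eq_fun do rewrite big_ord0.
      by rewrite mean_cst; split; [exact: borel_fun_cst|split; [exact: bounded_real_cst|]].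
    have bi : borel_fun (\1_(U k) : T -> R) by exact: borel_fun_indic.
    have Bi : bounded_real (\1_(U k) : T -> R) by exact: bounded_real_indic.
    rewrite big_ord_recr/= IH3 -(mean_indic P (bU k)) -meanD//.
    have -> : (fun x => \sum_(i < k.+1) \1_(U i) x) =
        (fun x => \sum_(i < k) \1_(U i) x + \1_(U k) x : R).
      by apply/funext => x; rewrite big_ord_recr.
    by split; [exact: borel_funD|split; [exact: bounded_realD|]].
  have [bi [Bi ->]] := ind n.+1.
  have N1 : 0 <= N^-1 by rewrite invr_ge0 ltW.
  have -> : n.+1%:R^-1 = N^-1 by [].
  rewrite -meanZ// -{2}(mean_cst P N^-1) -meanD//.
  - apply: le_mean.
    + exact: borel_funZ.
    + exact: bounded_realZ.
    + by apply: borel_funD; [exact: bL|exact: borel_fun_cst].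
    + by apply: bounded_realD; [exact: BL|exact: bounded_real_cst].
    + move=> x; have /andP[f0 f1] := f01 x.
      have := sum_lt_nat n.+1 (mulr_ge0 (ltW N0) f0).
      rewrite le_min => /andP[_]; rewrite -(ler_pM2l (_ : 0 < N^-1)) ?invr_gt0//.
      rewrite mulrDr mulrA mulVf ?gt_eqF// mul1r mulr1; apply: le_trans.
      rewrite ler_wpM2l//; apply: ler_sum => i _; rewrite indicE.
      by have [/set_mem/= ->|_] := boolP (x \in U i); last by case: ltP.
  - exact: bL.
  - exact: BL.
  - exact: borel_fun_cst.
  - exact: bounded_real_cst.
have L_mean f : lip d 1 f -> L f = mean P f.
  move=> lf1; have lf : lipschitz d f by exists 1.
  have [x0 _] := bp_nonempty P.
  (* An affine change of [f] with values between 0 and 1, to which the one-sided bound applies, as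
     it does to [1 - g]. *)
  pose g x := 2^-1 * (f x + (1 - f x0)).
  have lg : lipschitz d g.
    have h0 : 0 <= 2^-1 :> R by rewrite invr_ge0.
    exact: (lipschitzZ md h0 (lipschitzD lf (lipschitz_cst md _))).
  have g01 x : 0 <= g x <= 1.
    have := lip_osc x x0 ler01 lf1; have := lip_osc x0 x ler01 lf1; rewrite /g; lra.
  have bc k : borel_fun (fun _ : T => k : R) by exact: borel_fun_cst.
  have Bc k : bounded_real (fun _ : T => k : R) by exact: bounded_real_cst.
  have gE1 : L g = 2^-1 * (L f + (1 - f x0)).
    rewrite (LZ _ (lipschitzD lf (lipschitz_cst md _))).
    by rewrite (LD lf (lipschitz_cst md _)) L_cst.
  have gE2 : mean P g = 2^-1 * (mean P f + (1 - f x0)).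
    rewrite meanZ; [|exact: borel_funD (bL lf) (bc _)|exact: bounded_realD (BL lf) (Bc _)].
    by rewrite meanD ?mean_cst//; [exact: bL|exact: BL].
  have lg' : lipschitz d (fun x => 1 - g x) by apply: lipschitzB => //; exact: lipschitz_cst.
  have := L_le_mean g lg g01; have := L_le_mean (fun x => 1 - g x) lg'.
  have -> : L (fun x => 1 - g x) = 1 - L g.
    have := LD lg lg'; have -> : (fun x => g x + (1 - g x)) = (fun=> 1).
      by apply/funext => x; lra.
    by rewrite L_cst; lra.
  rewrite meanB//; [|exact: bL|exact: BL].
  rewrite mean_cst gE1 gE2 => H1 H2.
  have {}H1 := H1 (fun x => ltac:(have := g01 x; lra)).
  lra.
exists P.
  exists w.
  have cC : closed (closure (range w)) by exact: closed_closure.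
  apply/(prob1P md cC); rewrite -L_mean; last exact: set_dist_lip.
  apply: cvg_lim => //.
  have -> : (fun n => mean (P_ n) (set_dist d (closure (range w)))) = (fun=> 0).
    by apply/funext => n; apply/(prob1P md cC).
  exact: cvg_cst.
move=> e e0; have [N HN] := cauchyP e0; exists N => n Nn.
apply: kr_le => // f lf; rewrite -L_mean//.
have lf' : lipschitz d f by exists 1.
rewrite lerBlDr -lerBlDl; apply: cvgr_to_ge (L_cvg lf') _.
exists N => // k Nk /=; have := kr_ub md (P_ n) (P_ k) lf.
by have := HN n k Nn Nk; lra.
Qed.

End completeness.

(** * The Kantorovich distance on pairs of a probability and a point *)

Lemma metrizes_mdist (R : realType) (X : metricType R) : metrizes (@mdist R X).
Proof.
split.
- exact: mdistxx.
- exact: mdist_positivity.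
- exact: metric_sym.
- exact: metric_triangle.
- move=> x A; split=> [/nbhs_ballP[e e0 eA]|[e e0 eA]].
    by exists e => //; rewrite -ballEmdist.
  by apply/nbhs_ballP; exists e => //; rewrite ballEmdist.
Qed.

Section slices.
Variables (S Z : topologicalType).

Definition slice (z : Z) (a : S) : S * Z := (a, z).

Lemma slice_continuous z : continuous (slice z).
Proof. by move=> a; apply: cvg_pair => //=; exact: cvg_cst. Qed.

Lemma slice_embedding z : topological_embedding (slice z).
Proof.
split; [by move=> a b []|exact: slice_continuous|].
move=> A oA; exists (fst @^-1` A).
  have /continuousP : continuous (@fst S Z) by move=> p; exact: cvg_fst.
  by apply.
apply/seteqP; split=> [_ [a Aa <-]|p [+ [a _ ap]]]; first by split => //; exists a.
by rewrite /preimage -ap => Aa; exists a.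
Qed.

Lemma fst_continuous : continuous (@fst S Z).
Proof. by move=> p; exact: cvg_fst. Qed.

End slices.

Section product_metric.
Variables (R : realType) (S Z : topologicalType).
Variables (d : S * Z -> S * Z -> R) (dZ : Z -> Z -> R).
Hypotheses (md : metrizes d) (mZ : metrizes dZ).
Hypothesis sS : forall P : borel_prob R S, sep_carried P.

(** The product of [p.1] with the Dirac mass at [p.2]. *)
Definition push_slice (p : borel_prob R S * Z) : borel_prob R (S * Z)%type :=
  bp_push (@slice_continuous S Z p.2) p.1.

Lemma push_slice_fst p : bp_push (@fst_continuous S Z) (push_slice p) = p.1.
Proof.
by rewrite -(@bp_push_comp R _ _ _ _ _ id _ _ (@continuous_id S))// bp_push_id.
Qed.

Lemma prob_push_slice_snd p (U : set Z) : open U ->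
  prob (push_slice p) (snd @^-1` U) = (p.2 \in U)%:R.
Proof.
move=> oU; have cs : continuous (@snd S Z) by move=> q; exact: cvg_snd.
rewrite prob_push; last by apply: borel_open; move/continuousP: cs; apply.
rewrite (_ : _ @^-1` _ = if p.2 \in U then setT else set0).
  by case: ifP => _; [exact: probT|rewrite /prob measure0].
case: ifPn => pU; apply/seteqP; split=> // a; first by move=> _; exact/set_mem.
by move=> /= Up; case/negP: pU; exact/mem_set.
Qed.

Lemma push_slice_inj : injective push_slice.
Proof.
move=> p q pq; have p1 : p.1 = q.1 by rewrite -!push_slice_fst pq.
suff p2 : p.2 = q.2 by move: p q p1 p2 {pq} => [? ?] [? ?] /= -> ->.
apply: (metrizes_eq0 mZ); apply/eqP; rewrite eq_le (metrizes_ge0 mZ) andbT leNgt.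
apply/negP => pq0; pose U := [set z | dZ p.2 z < dZ p.2 q.2].
have oU : open U by exact: metrizes_open_ball.
have := prob_push_slice_snd p oU; rewrite pq prob_push_slice_snd//.
have -> : p.2 \in U by rewrite mem_set// /U/= (metrizes_xx mZ).
have -> : q.2 \in U = false by apply/negbTE/negP => /set_mem; rewrite /U/= ltxx.
by move=> /eqP; rewrite eq_sym oner_eq0.
Qed.

(* For [z'] near [z], the slices through [z] and [z'] are uniformly close on an
   open set carrying most of the mass of all measures near [P]. *)
Lemma push_slice_nbhs p (e : R) : 0 < e ->
  nbhs p [set q | kr d (push_slice p) (push_slice q) < e].
Proof.
case: p => P z e0; pose r := e / 4; have r0 : 0 < r by rewrite divr_gt0.
(* The interior makes [O k] open, as [nbhs_prob_gt] requires; the [O k] exhaust the space because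
   product neighbourhoods contain boxes. *)
pose O k :=
  interior [set a | forall y, dZ z y < k.+1%:R^-1 -> d (a, z) (a, y) <= r].
have oO k : open (O k) by exact: open_interior.
have bO k := borel_open (oO k).
have ndO k : O k `<=` O k.+1.
  apply: interiorS => a Ha y zy; apply: Ha; apply: (lt_le_trans zy).
  by rewrite lef_pV2 ?posrE// ler_nat.
have UO : \bigcup_k O k = setT.
  apply/seteqP; split=> // a _.
  have r20 : 0 < r / 2 by rewrite divr_gt0.
  have [[U V] /= [Ua Vz] UV] := metrizes_nbhs_ball md (a, z) r20.
  have [t /ltr_add_invr[k] + tV] := (metrizes_nbhsP mZ _ _).1 Vz.
  rewrite add0r => kt; exists k => //.
  apply: filterS Ua => a' Ua' y zy.
  have Vy : V y by apply: tV => /=; exact: lt_trans zy kt.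
  have Vzz : V z by apply: tV; rewrite /= (metrizes_xx mZ) (lt_trans _ kt)// invr_gt0.
  have /= H1 := UV (a', z) (conj Ua' Vzz); have /= H2 := UV (a', y) (conj Ua' Vy).
  have := metrizes_triangle md (a, z) (a', z) (a', y).
  by rewrite (metrizes_sym md (a', z) (a, z)); lra.
have [k Pk] : exists k, 1 - r < prob P (O k).
  have cv := @prob_cvg R S P O bO ndO; rewrite UO probT in cv.
  have [|k _ /(_ k (leqnn k))] := cvgr_gt _ cv (1 - r); first by lra.
  by exists k.
have mdz := metrizes_embedding md (@slice_embedding S Z z).
exists ([set Q | 1 - r < prob Q (O k)] `&`
    [set Q | kr (fun a b => d (slice z a) (slice z b)) P Q < r],
    [set y | dZ z y < k.+1%:R^-1]).
  split=> /=; last by apply: metrizes_nbhs_ball => //; rewrite invr_gt0.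
  apply: filterI; first exact: nbhs_prob_gt mdz _ _ _ _ _.
  exact: sep_carried_nbhs_kr.
case=> Q y /= [[Qk PQ] zy].
rewrite (le_lt_trans (kr_triangle md (push_slice (Q, z)) _ _))//.
have -> : kr d (push_slice (P, z)) (push_slice (Q, z)) =
    kr (fun a b => d (slice z a) (slice z b)) P Q by exact: kr_push_isometry.
have : kr d (push_slice (Q, z)) (push_slice (Q, y)) <= r + prob Q (~` O k).
  have bz := continuous_borel_fun (@slice_continuous S Z z).
  have by_ := continuous_borel_fun (@slice_continuous S Z y).
  rewrite /push_slice/= -(bp_map_push bz) -(bp_map_push by_).
  apply: kr_map_le => //; [exact: ltW|exact: borelC|].
  by move=> a /contrapT/interior_subset; apply.
by rewrite probC//; rewrite /r in PQ Qk *; lra.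
Qed.

(** Continuity of the first marginal controls the first coordinate. As the second marginal is a
    Dirac mass, positive mass over an open [W] already forces the second coordinate into [W]. *)
Lemma metrizes_kr_prod : metrizes (fun p q => kr d (push_slice p) (push_slice q)).
Proof.
split.
- by move=> p; exact: kr_xx.
- by move=> p q /(kr_eq0 md)/push_slice_inj.
- by move=> p q; exact: kr_sym.
- by move=> p q s; exact: kr_triangle.
move=> p A; split=> [|[e e0 eA]]; last first.
  by apply: filterS eA _; exact: push_slice_nbhs.
move=> [[U V] /= [Up Vp] UV].
have [r r0 rU] : exists2 r, 0 < r & forall q,
    kr d (push_slice p) (push_slice q) < r -> U q.1.
  have : nbhs (push_slice p) (bp_push (@fst_continuous S Z) @^-1` U).
    by apply: (@bp_push_continuous R _ _ _ (@fst_continuous S Z)); rewrite push_slice_fst.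
  move=> /(nbhs_kr md)[r r0 rU]; exists r => // q /rU.
  by rewrite /preimage/= push_slice_fst.
have [s s0 sV] : exists2 s, 0 < s & forall q,
    kr d (push_slice p) (push_slice q) < s -> V q.2.
  move: Vp; rewrite nbhsE => -[W [oW Wp] WV].
  have oW' : open (@snd S Z @^-1` W).
    by have /continuousP : continuous (@snd S Z) by [move=> q; exact: cvg_snd]; apply.
  have : 0 < prob (push_slice p) (@snd S Z @^-1` W).
    by rewrite prob_push_slice_snd// mem_set.
  move=> /(nbhs_prob_gt md oW')/(nbhs_kr md)[s s0 sW]; exists s => // q /sW /=.
  rewrite prob_push_slice_snd//; have [/set_mem/WV//|_] := boolP (_ \in _).
  by rewrite ltxx.
exists (Num.min r s); first by rewrite lt_min r0.
by move=> q /=; rewrite lt_min => /andP[/rU Uq /sV Vq]; exact: (UV q).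
Qed.

End product_metric.

(** Choosing [t n] within [n.+1%:R^-1] of the infimum of [D n] serves all [e] at once. *)
Lemma approximating_sequence (R : realType) (T_ : nat -> Type)
    (D : forall n, T_ n -> R) : (forall n, inhabited (T_ n)) ->
  (forall n t, 0 <= D n t) ->
  (forall e, 0 < e -> exists N, forall n, (N <= n)%N -> exists t, D n t < e) ->
  exists t : forall n, T_ n,
    forall e, 0 < e -> exists N, forall n, (N <= n)%N -> D n (t n) < e.
Proof.
move=> iT D0 De.
have H n : exists t, D n t < inf (range (D n)) + n.+1%:R^-1.
  have [t0] := iT n.
  have [||_ [t _ <-] ?] := @inf_adherent R (range (D n)) n.+1%:R^-1.
  - by rewrite invr_gt0.
  - split; first by exists (D n t0), t0.
    by exists 0 => _ [t _ <-].
  by exists t.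
exists (fun n => projT1 (cid (H n))) => e e0.
have [N HN] := De (e / 2) (divr_gt0 e0 (ltr0Sn R 1)).
have /ltr_add_invr[M] : 0 < e / 2 by rewrite divr_gt0.
rewrite add0r => Me; exists (maxn N M) => n; rewrite geq_max => /andP[Nn Mn].
case: cid => t /= /lt_trans; apply.
have [t' t'e] := HN n Nn.
have : inf (range (D n)) <= D n t'.
  by apply: ge_inf; [exists 0 => _ [s _ <-]|exists t'].
have : n.+1%:R^-1 <= M.+1%:R^-1 :> R by rewrite lef_pV2 ?posrE// ler_nat.
move=> /le_lt_trans/(_ Me); set x := n.+1%:R^-1; lra.
Qed.

(** * Structures of separably carried probabilities *)

Section sep_functor.
Variable R : realType.
Implicit Types tau : bcm_functor R.

Lemma sep_push_id (T : topologicalType) (f : T -> T) (fc : continuous f)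
  (P : sep_prob R T) : f =1 id -> sep_push fc P = P.
Proof. by move=> fid; apply: sep_prob_val_inj; exact: bp_push_id. Qed.

Lemma sep_push_comp (S T U : topologicalType) (f : S -> T) (g : T -> U)
    (h : S -> U) (fc : continuous f) (gc : continuous g) (hc : continuous h)
    (P : sep_prob R S) :
  h =1 g \o f -> sep_push hc P = sep_push gc (sep_push fc P).
Proof. by move=> hgf; apply: sep_prob_val_inj; exact: bp_push_comp. Qed.

Definition sep_functor tau : bcm_functor R :=
  @BcmFunctor R
    (fun X => sep_prob R (tau X))
    (fun X Y f => sep_push (@fmor_continuous R tau X Y f))
    (fun X Y f => @sep_push_continuous R _ _ _ (@fmor_continuous R tau X Y f))
    (fun X P => @sep_push_id _ _ _ P (@fmor_id R tau X))
    (fun X Y Z g f P => @sep_push_comp _ _ _ _ _ _ _ _ _ P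
      (@fmor_comp R tau X Y Z g f)).

Lemma sep_functor_structure tau : is_structure tau -> is_structure (sep_functor tau).
Proof.
move=> [mtau etau]; split=> [X|X Y f].
  have [d md] := mtau X; exists (fun P Q : sep_prob R _ => kr d P Q).
  exact: metrizes_sep_prob.
have [d md] := mtau Y; have md' := metrizes_embedding md (etau X Y f).
apply: (topological_embedding_isometry (metrizes_sep_prob md') (metrizes_sep_prob md)).
by move=> P Q; exact: kr_push_isometry.
Qed.

Lemma prob_functor_structure tau : is_structure tau ->
  (forall X (P : borel_prob R (tau X)), sep_carried P) ->
  is_structure (prob_functor tau).
Proof.
move=> [mtau etau] stau; split=> [X|X Y f].
  by have [d md] := mtau X; exists (kr d); exact: metrizes_borel_prob.
have [d md] := mtau Y; have md' := metrizes_embedding md (etau X Y f).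
apply: (topological_embedding_isometry (metrizes_borel_prob md' (stau X))
  (metrizes_borel_prob md (stau Y))).
by move=> P Q; exact: kr_push_isometry.
Qed.

Lemma sep_functor_complete tau : completely_space_rooted_metrizable tau ->
  completely_space_rooted_metrizable (sep_functor tau).
Proof.
move=> [d [[md isod] cd]].
exists (fun X rho (P Q : sep_prob R (tau X)) => kr (d X rho) P Q); split.
  split=> [X rho|X Y rhoX rhoY f frho P Q]; first exact: metrizes_sep_prob.
  by apply: kr_push_isometry => // a b; exact: isod.
move=> X rho P_ cP.
have [P sP Pcvg] := kr_complete (md X rho) (cd X rho) (fun n => sep_probP (P_ n)) cP.
exists (SepProb sP); apply/(metrizes_cvgP (metrizes_sep_prob (md X rho))).
move=> e e0; have [N HN] := Pcvg (e / 2) (divr_gt0 e0 (ltr0Sn R 1)).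
exists N => // n /HN /=; rewrite (kr_sym (md X rho)); lra.
Qed.

Lemma sep_functor_embedding_continuous tau :
  embedding_continuous tau -> embedding_continuous (sep_functor tau).
Proof.
move=> ec X Y f_ f ff P; apply: sep_prob_cvg_mean => g e gc Bg e0.
have bg := continuous_borel_fun gc.
have bfm (h : isoemb X Y) := continuous_borel_fun (@fmor_continuous R tau X Y h).
have [M gM] := Bg.
have : mean P (g \o fmor tau (f_ n)) @[n --> \oo] --> mean P (g \o fmor tau f).
  apply: (@mean_cvg _ _ _ _ _ M).
  - by move=> n; exact: borel_fun_comp.
  - exact: borel_fun_comp.
  - by move=> n x; exact: gM.
  - by move=> x; apply: (cvg_comp _ _ (ec _ _ _ _ ff x)); exact: gc.
move=> /cvgrPdist_lt/(_ e e0)[N _ HN]; exists N => n /HN.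
by rewrite /= !mean_push// distrC.
Qed.

(** Upper semicontinuity applied to a constant sequence of spaces. *)
Lemma usc_range_closed tau : is_structure tau -> upper_semicontinuous tau ->
  forall X Y (e : isoemb X Y), closed (range (fmor tau e)).
Proof.
move=> [mtau _] usc X Y e y; have [d md] := mtau Y.
move=> /(closureP_metrizes md) yr.
have H n : exists a, d y (fmor tau e a) < n.+1%:R^-1.
  have [|_ [a _ <-] ?] := yr n.+1%:R^-1; first by rewrite invr_gt0.
  by exists a.
have [a ya] := choice H.
apply: (usc Y (fun=> X) X (fun=> e) e _ a); first exact: cvg_cst.
apply/(metrizes_cvgP md) => r /ltr_add_invr[N]; rewrite add0r => Nr.
exists N => // n /= Nn; rewrite (lt_trans (ya n))// (le_lt_trans _ Nr)//.
by rewrite lef_pV2 ?posrE// ler_nat.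
Qed.

(* The support of the limit lies in the closed image of [tau X], because every
   point of the support is a limit of images of points of the [tau (X_ n)]. *)
Lemma sep_functor_usc tau : is_structure tau -> upper_semicontinuous tau ->
  upper_semicontinuous (sep_functor tau).
Proof.
move=> stau usc Y X_ X e_ e ee P_ P PP; have [mtau etau] := stau.
have [d md] := mtau Y.
have cr := @usc_range_closed tau stau usc X Y e.
have bV : borel (~` range (fmor tau e)) by apply: borelC; exact: borel_closed.
have V0 : prob P (~` range (fmor tau e)) = 0.
  apply: (sep_carried_locally_null md (sep_probP P)) => // b nb.
  apply: contrapT => nU; apply: nb.
  have [|||t bt] := @approximating_sequence R (fun n => tau (X_ n))
      (fun n t => d b (fmor tau (e_ n) t)).
  - by move=> n; have [x _] := bp_nonempty (P_ n).
  - by move=> n t; exact: metrizes_ge0.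
  - move=> r r0; pose U := [set y | d b y < r].
    have oU : open U by exact: metrizes_open_ball.
    have PU : 0 < prob P U.
      rewrite lt_neqAle prob_ge0 andbT; apply/eqP => U0; apply: nU.
      by exists U => //; split => //; rewrite /U/= (metrizes_xx md).
    (* [U] has positive mass under the limit, hence eventually under the images of the [P_ n], so
       [U] meets the image of [tau (X_ n)]. *)
    have [N _ HN] := PP _ (sep_prob_val_continuous (nbhs_prob_gt md oU PU)).
    exists N => n /HN; rewrite /preimage/= prob_push; last exact: borel_open.
    move=> Pn; apply: contrapT => nt; move: Pn.
    rewrite (_ : _ @^-1` _ = set0) ?/prob ?measure0 ?ltxx//.
    by apply/seteqP; split => // t Ut; apply: nt; exists t.
  apply: (usc _ _ _ _ _ ee t); apply/(metrizes_cvgP md) => r /bt[N HN].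
  by exists N.
have P1 : prob P (range (fmor tau e)) = 1.
  by move: V0; rewrite probC; [lra|exact: borel_closed].
pose ce := @fmor_continuous R tau X Y e.
have [Q QP] := prob_push_range (etau _ _ e) ce (borel_closed cr) P1.
have sQ : sep_carried Q.
  apply: (sep_carried_push_inv md (etau _ _ e) (fc := ce)).
  by rewrite QP; exact: sep_probP.
by exists (SepProb sQ) => //; apply: sep_prob_val_inj.
Qed.

(** Lower semicontinuity only provides a subsequence. Applied to a sequence of indices at which
    approximation fails, it gives a contradiction, so approximation holds from some index on. *)
Lemma lsc_eventually tau Y (X_ : nat -> bcm R) X (e_ : forall n, isoemb (X_ n) Y)
    (e : isoemb X Y) (d : tau Y -> tau Y -> R) : metrizes d ->
  Defs.lower_semicontinuous tau ->
  isoemb_range (e_ n) @[n --> \oo] --> isoemb_range e ->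
  forall (a : tau X) r, 0 < r -> exists N, forall n, (N <= n)%N ->
    exists t, d (fmor tau e a) (fmor tau (e_ n) t) < r.
Proof.
move=> md lsc ee a r r0; apply: contrapT => nN.
have H N : exists n, (N <= n)%N /\ forall t, ~ d (fmor tau e a) (fmor tau (e_ n) t) < r.
  apply: contrapT => nn; apply: nN; exists N => n Nn; apply: contrapT => nt.
  by apply: nn; exists n; split => // t tr; apply: nt; exists t.
have [f Hf] := choice H.
pose k := fix k j := if j is i.+1 then f (k i).+1 else f 0%N.
have kS j : (k j < k j.+1)%N by exact: (Hf _).1.
have kt j : forall t, ~ d (fmor tau e a) (fmor tau (e_ (k j)) t) < r.
  by case: j => [|j]; exact: (Hf _).2.
have kj j : (j <= k j)%N by elim: j => // j IH; exact: leq_ltn_trans (kS j).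
have ek : isoemb_range (e_ (k j)) @[j --> \oo] --> isoemb_range e.
  move=> A /ee[N _ HN]; exists N => // j Nj; apply: HN.
  exact: leq_trans (kj j).
have [k' [_ [b bcvg]]] := lsc _ _ _ _ _ ek a.
have [N _ HN] := (metrizes_cvgP md _ _).2 bcvg _ r0.
exact: kt (HN N (leqnn N)).
Qed.

(* [P] is first discretized along finitely many points of [tau X], each of which
   is then moved to a nearby point of [tau (X_ n)]. *)
Lemma sep_functor_lsc tau : is_structure tau -> Defs.lower_semicontinuous tau ->
  Defs.lower_semicontinuous (sep_functor tau).
Proof.
move=> [mtau etau] lsc Y X_ X e_ e ee P; have [d md] := mtau Y.
have mdX := metrizes_embedding md (etau _ _ e).
have approx r : 0 < r -> exists N, forall n, (N <= n)%N ->
    exists Q : sep_functor tau (X_ n),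
    kr d (fmor (sep_functor tau) e P) (fmor (sep_functor tau) (e_ n) Q) < r.
  move=> r0; pose s := r / 4; have s0 : 0 < s by rewrite divr_gt0.
  have [u u1] := sep_probP P.
  have [|M PM] := sep_carried_ball_union mdX (c := 1 - s) u1 s0; first lra.
  pose B i := [set x | d (fmor tau e (u i)) (fmor tau e x) < s].
  have bB i : borel (B i).
    exact: (borel_open (metrizes_open_ball mdX _ _)).
  (* The largest index below [m] whose ball contains [x], with default 0; its fibres are the cells
     of the discretization. *)
  pose g := fix g m x := if m is i.+1 then if x \in B i then i else g i x else 0%N.
  have bg m n : borel (g m @^-1` [set n]).
    elim: m => [|m IH].
      have [->|n0] := eqVneq n 0%N.
        by rewrite (_ : _ @^-1` _ = setT); [exact: borelT|apply/seteqP].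
      rewrite (_ : _ @^-1` _ = set0); first exact: borel0.
      by apply/seteqP; split => // x /= xn; case/eqP: n0.
    rewrite (_ : _ @^-1` _ = (B m `&` (if m == n then setT else set0)) `|`
        (~` B m `&` g m @^-1` [set n])).
      apply: borelU; apply: borelI => //; last exact: borelC.
      by case: ifP => _; [exact: borelT|exact: borel0].
    apply/seteqP; split=> x /=.
      have [/set_mem xB /= <-|xB xn] := boolP (x \in B m).
        by left; rewrite eqxx.
      by right; split => // /mem_set; exact/negP.
    move=> [[xB]|[xB gn]]; last by rewrite memNset.
    by rewrite mem_set//; case: eqP.
  have gP m x : ball_union (fun x y => d (fmor tau e x) (fmor tau e y)) u s m x ->
      (g m x < m)%N /\ B (g m x) x.
    elim: m => [[//]|m IH] [i]; rewrite ltnS leq_eqVlt /=.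
    have [/set_mem xB _ _|xB] := boolP (x \in B m); first by [].
    move=> /predU1P[->|im] ux; first by case/negP: xB; exact/mem_set.
    by have [|gm gB] := IH; [exists i|split => //; exact: leqW].
  have near_u i : exists N, forall n, (N <= n)%N ->
      exists t, d (fmor tau e (u i)) (fmor tau (e_ n) t) < s.
    exact: (lsc_eventually md lsc ee).
  (* The bound [M.+1] instead of [M] always includes the index 0, which supplies a point of
     [tau (X_ n)] as default value for [c]. *)
  have [N HN] : exists N, forall n, (N <= n)%N -> forall i, (i < M.+1)%N ->
      exists t, d (fmor tau e (u i)) (fmor tau (e_ n) t) < s.
    elim: (M.+1) => [|m [N IH]]; first by exists 0%N.
    have [N' IH'] := near_u m; exists (maxn N N') => n.
    rewrite geq_max => /andP[Nn N'n] i; rewrite ltnS leq_eqVlt.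
    by move=> /predU1P[->|]; [exact: IH'|exact: IH].
  exists N => n Nn.
  have Hc i : exists t, (i < M.+1)%N -> d (fmor tau e (u i)) (fmor tau (e_ n) t) < s.
    have [iM|iM] := boolP (i < M.+1)%N; first by have [t] := HN n Nn i iM; exists t.
    by have [t _] := HN n Nn 0%N isT; exists t.
  have [c c_s] := choice Hc.
  have bc := @borel_fun_countable _ _ (g M) c (bg M).
  have sQ := sep_carried_countable bc P.
  exists (SepProb sQ) => /=.
  pose ce := @fmor_continuous R tau _ _ e; pose cen := @fmor_continuous R tau _ _ (e_ n).
  have be := continuous_borel_fun ce; have ben := continuous_borel_fun cen.
  have becg := borel_fun_comp bc ben.
  have -> : bp_push cen (bp_map bc P) = bp_map becg P.
    apply: borel_prob_eq => A bA; rewrite bp_pushE// !bp_mapE//.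
    exact: borel_fun_preimage.
  rewrite -(bp_map_push be).
  have bU : borel (~` ball_union (fun x y => d (fmor tau e x) (fmor tau e y)) u s M).
    by apply: borelC; apply: borel_open; exact: (ball_union_open mdX).
  have : kr d (bp_map be P) (bp_map becg P) <= 2 * s + prob P (~` ball_union
      (fun x y => d (fmor tau e x) (fmor tau e y)) u s M).
    apply: kr_map_le => //; first by rewrite mulr_ge0// ltW.
    move=> x /contrapT/gP[gM xB] /=.
    have := c_s _ (leqW gM); move: xB; rewrite /B/=.
    have := metrizes_triangle md (fmor tau e (u (g M x))) (fmor tau e x)
      (fmor tau (e_ n) (c (g M x))).
    by rewrite (metrizes_sym md (fmor tau e x) (fmor tau e (u _))); lra.
  rewrite probC; last by apply: borel_open; exact: (ball_union_open mdX).
  by move: PM s0; rewrite /s; lra.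
(* From [N0] on there are separably carried probabilities on [tau (X_ n)] at all; the subsequence is
   the shift by [N0]. *)
have [N0 HN0] := approx 1 ltr01.
have [|||t Ht] := @approximating_sequence R (fun n => sep_functor tau (X_ (N0 + n)%N))
    (fun n Q => kr d (fmor (sep_functor tau) e P)
      (fmor (sep_functor tau) (e_ (N0 + n)%N) Q)).
- by move=> n; have [Q _] := HN0 (N0 + n)%N (leq_addr _ _).
- by move=> n Q; exact: kr_ge0.
- move=> r /approx[N HN]; exists N => n Nn; apply: HN.
  by rewrite (leq_trans Nn)// leq_addl.
exists (addn N0); split; first by move=> m n mn; rewrite ltn_add2l.
exists t; apply/(metrizes_cvgP (metrizes_sep_prob md)) => r /Ht[N HN].
by exists N.
Qed.

Lemma sep_functor_continuous tau : is_structure tau -> continuous_structure tau ->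
  continuous_structure (sep_functor tau).
Proof.
move=> stau [ec usc lsc]; split.
- exact: sep_functor_embedding_continuous.
- exact: sep_functor_usc.
- exact: sep_functor_lsc.
Qed.

(** Everything follows from [le_kr_push] along the maps sending [a] to [(fmor tau f a, f x)]:
    [t = Th e] gives stability, and [t = 0] with identity embeddings on one side gives the
    isometry. *)
Lemma prob_functor_stable tau :
  (forall X (P : borel_prob R (tau X)), sep_carried P) ->
  stably_metrizable tau -> stably_metrizable (prob_functor tau).
Proof.
move=> stau [d [[md isod] [Th [Th_ge0 Th0 Thcvg dTh]]]].
exists (fun X (p q : borel_prob R (tau X) * X) =>
  kr (d X) (push_slice p) (push_slice q)).
have fmorE (X Y : bcm R) (f : isoemb X Y) (p : borel_prob R (tau X) * X)
    (c : continuous (fun a => (fmor tau f a, f p.2) : tau Y * Y)) :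
    push_slice (fmor_prod (tau := prob_functor tau) f p) = bp_push c p.1.
  by apply/esym; exact: bp_push_comp.
have cont (X Y : bcm R) (f : isoemb X Y) (x : X) :
    continuous (fun a => (fmor tau f a, f x) : tau Y * Y).
  by move=> a; apply: cvg_pair => /=; [exact: fmor_continuous|exact: cvg_cst].
have kr_fmor (X Y M1 M2 : bcm R) (f1 : isoemb X M1) (f2 : isoemb X M2)
    (g1 : isoemb Y M1) (g2 : isoemb Y M2) (t : R) (p : borel_prob R (tau X) * X)
    (q : borel_prob R (tau Y) * Y) : 0 <= t ->
    (forall a b, d M2 (fmor_prod f2 (a, p.2)) (fmor_prod g2 (b, q.2)) <=
      d M1 (fmor_prod f1 (a, p.2)) (fmor_prod g1 (b, q.2)) + t) ->
    kr (d M2) (push_slice (fmor_prod (tau := prob_functor tau) f2 p))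
      (push_slice (fmor_prod (tau := prob_functor tau) g2 q)) <=
    kr (d M1) (push_slice (fmor_prod (tau := prob_functor tau) f1 p))
      (push_slice (fmor_prod (tau := prob_functor tau) g1 q)) + t.
  move=> t0 dt; rewrite !(fmorE _ _ _ _ (cont _ _ _ _)).
  exact: le_kr_push (md M1) (md M2) t0 dt.
have idE (X : bcm R) (p : borel_prob R (tau X) * X) :
    fmor_prod (tau := prob_functor tau) (isoemb_id X) p = p.
  by case: p => P x; rewrite /fmor_prod fmor_id.
split.
  split=> [X|X Y f p q].
    exact: (metrizes_kr_prod (md X) (@metrizes_mdist R X) (stau X)).
  have dE a b : d Y (fmor_prod f (a, p.2)) (fmor_prod f (b, q.2)) =
      d X (fmor_prod (isoemb_id X) (a, p.2)) (fmor_prod (isoemb_id X) (b, q.2)).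
    by rewrite !isod.
  apply/le_anti/andP; split.
    rewrite -[X in _ <= kr _ (push_slice X) _]idE -[X in _ <= kr _ _ (push_slice X)]idE.
    by rewrite -[leRHS]addr0; apply: kr_fmor => // a b; rewrite dE addr0.
  rewrite -[X in kr _ (push_slice X) _ <= _]idE -[X in kr _ _ (push_slice X) <= _]idE.
  by rewrite -[leRHS]addr0; apply: kr_fmor => // a b; rewrite dE addr0.
exists Th; split => // X Y M1 M2 f1 f2 g1 g2 e e0 fg p q.
apply: kr_fmor; first exact: Th_ge0.
by move=> a b; exact: dTh.
Qed.

Lemma prob_functor_polish tau :
  (forall X (P : borel_prob R (tau X)), sep_carried P) ->
  polish_with_preserved_roots tau -> polish_with_preserved_roots (prob_functor tau).
Proof.
move=> stau [tau' [eta [tau_ [stau' [eeta neta] _ [[ctau' srm] [otau ptau] eta_cap]]]]].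
have ceta X : continuous (eta X) by have [] := eeta X.
have seta X (P : borel_prob R (tau X)) : sep_carried (bp_push (ceta X) P).
  exact: sep_carried_map.
(* The double sequence of open conditions is indexed by pickled pairs; a number that codes no pair
   gets the whole space. *)
pose tauP n (X : bcm R) (rho : X) : set (sep_functor tau' X) :=
  if unpickle n is Some ij then
    [set Q : sep_prob R (tau' X) | 1 - ij.2.+1%:R^-1 < prob Q (tau_ ij.1 X rho)]
  else setT.
have pb n (X Y : bcm R) (rhoX : X) (rhoY : Y) (f : isoemb X Y) : f rhoX = rhoY ->
    fmor (sep_functor tau') f @^-1` tauP n Y rhoY = tauP n X rhoX.
  move=> frho; rewrite /tauP; case: unpickle => // ij.
  rewrite -(ptau _ _ _ _ _ _ frho); apply/seteqP.
  by split=> Q; rewrite /preimage/= prob_push//; exact: borel_open.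
exists (sep_functor tau'), (fun X P => SepProb (seta X P)), tauP; split.
- exact: sep_functor_structure.
- have [mtau' _] := stau'; split=> [X|X Y f P].
    have [d md] := mtau' X; have md' := metrizes_embedding md (eeta X).
    apply: (topological_embedding_isometry (metrizes_borel_prob md' (stau X))
      (metrizes_sep_prob md)).
    by move=> P Q; exact: kr_push_isometry.
  apply: sep_prob_val_inj => /=.
  pose cf := @fmor_continuous R tau' X Y f.
  have ch : continuous (fmor tau' f \o eta X).
    by move=> a; apply: continuous_comp; [exact: ceta|exact: cf].
  have h1 : fmor tau' f \o eta X =1 eta Y \o fmor tau f by move=> a /=; rewrite neta.
  apply: etrans (bp_push_comp (ceta X) cf ch P (fun=> erefl)).
  exact: esym (bp_push_comp _ (ceta Y) ch P h1).
- move=> n X Y rhoX rhoY f frho _ [Q tQ <-].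
  by have := pb n X Y rhoX rhoY f frho => E; rewrite -E in tQ.
split.
- by split; [exact: sep_functor_continuous|exact: sep_functor_complete].
- split=> [n X rho|//]; rewrite /tauP; case: unpickle => [ij|]; last exact: openT.
  have [mtau' _] := stau'; have [d md] := mtau' X.
  rewrite openE => Q HQ; exact: sep_prob_val_continuous (nbhs_prob_gt md (otau _ _ _) HQ).
move=> X rho; have [mtau' _] := stau'; have [d md] := mtau' X.
have bo i : borel (tau_ i X rho) by exact: borel_open.
apply/seteqP; split=> [_ [P _ <-] n _|Q HQ].
  rewrite /tauP; case: unpickle => // ij /=; rewrite prob_push//.
  rewrite (_ : _ @^-1` _ = setT) ?probT ?ltrBlDr ?ltrDl ?invr_gt0//.
  apply/seteqP; split => // a _ /=.
  by have : range (eta X) (eta X a) by [exists a]; rewrite (eta_cap X rho); apply.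
have Q1 : prob Q (range (eta X)) = 1.
  rewrite (eta_cap X rho); apply: prob_bigcap1 => // i.
  apply/eqP; rewrite eq_le prob_le1//=; apply/ler_addgt0Pr => r /ltr_add_invr[j].
  rewrite add0r => jr; have := HQ (pickle (i, j)) I; rewrite /tauP pickleK/= ltrBlDr.
  by move=> /lt_trans Qj; rewrite ltW// Qj// ltrD2l.
have br : borel (range (eta X)) by rewrite (eta_cap X rho); exact: borel_bigcap.
have [P PQ] := prob_push_range (eeta X) (ceta X) br Q1.
by exists P => //; apply: sep_prob_val_inj.
Qed.

End sep_functor.

Theorem theorem8p35 (R : realType) (sigma : bcm_functor R)
  (sigma_structure : is_structure sigma)
  (sigma_stable : stably_metrizable sigma)
  (sigma_polish : polish_with_preserved_roots sigma)
  (prob_metrizable : forall X : bcm R,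
     separable (sigma X) \/ metrizable R (prob_functor sigma X)) :
  is_structure (prob_functor sigma) /\
  stably_metrizable (prob_functor sigma) /\
  polish_with_preserved_roots (prob_functor sigma).
Proof.
(* Either alternative of [prob_metrizable] leads to the one property of [sigma X] on which the rest
   relies. *)
have sep X (P : borel_prob R (sigma X)) : sep_carried P.
  have [sX|mX] := prob_metrizable X; first exact: separable_sep_carried.
  by apply: metrizable_sep_carried mX; have [] := sigma_structure.
split; first exact: prob_functor_structure.
by split; [exact: prob_functor_stable|exact: prob_functor_polish].
Qed.
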